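(* Let $K$ be a field with $\mathrm{char}\,K\neq 2$, let $a\in K^\times$ and $\varepsilon_1\in\{1,-1\}$, and let $G_{7,1,1}=\langle\tau_1,\lambda_1,\sigma_{3B}\rangle$ act on the rational function field $K(x,y,z)$ by the $K$-automorphisms $$\tau_1: x\mapsto \frac{a}{x},\ y\mapsto\frac{\varepsilon_1 a}{y},\ z\mapsto\varepsilon_1 z,$$ $$\lambda_1: x\mapsto\frac{\varepsilon_1 a}{x},\ y\mapsto\varepsilon_1 y,\ z\mapsto\frac{a}{z},$$ $$\sigma_{3B}: x\mapsto y,\ y\mapsto z,\ z\mapsto x.$$ (i) If $\varepsilon_1=1$ then $K(x,y,z)^{G_{7,1,1}}$ is rational over $K$. (ii) If $\varepsilon_1=-1$ and $[K(\sqrt{a},\sqrt{-1}):K]\leq 2$ then $K(x,y,z)^{G_{7,1,1}}$ is rational over $K$.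
   Context: A field extension of $K$ is rational over $K$ if it is purely transcendental over $K$. The group $G_{7,1,1}$ is isomorphic to the alternating group $\mathcal{A}_4$. *)

(* Defs.v *)
From HB Require Import structures.
From mathcomp Require Import all_boot all_order all_algebra all_field.
From mathcomp Require Import mpoly.

Set Implicit Arguments.
Unset Strict Implicit.
Unset Printing Implicit Defensive.

Import GRing.Theory.
Local Open Scope ring_scope.

Section PurelyTranscendental.

Variables (K F : fieldType) (iota : {rmorphism K -> F}).

Inductive adjoin (S : F -> Prop) : F -> Prop :=
| adjoin_base c : adjoin S (iota c)
| adjoin_gen s : S s -> adjoin S s
| adjoin_sub u v : adjoin S u -> adjoin S v -> adjoin S (u - v)
| adjoin_mul u v : adjoin S u -> adjoin S v -> adjoin S (u * v)
| adjoin_inv u : adjoin S u -> adjoin S u^-1.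

Definition alg_independent (S : F -> Prop) : Prop :=
  forall (n : nat) (t : 'I_n -> F),
    injective t -> (forall i, S (t i)) ->
    forall p : {mpoly K[n]}, mmap iota t p = 0 -> p = 0.

(* The intermediate field [L] of F / iota(K), given by its membership
   predicate, is rational over K. *)
Definition rational (L : F -> Prop) : Prop :=
  exists S : F -> Prop,
    alg_independent S /\ (forall f, L f <-> adjoin S f).

End PurelyTranscendental.

Section Groups.

Variable T : Type.

Inductive generated (gens : (T -> T) -> Prop) : (T -> T) -> Prop :=
| generated_gen g : gens g -> generated gens g
| generated_id : generated gens id
| generated_comp g h :
    generated gens g -> generated gens h -> generated gens (g \o h)
| generated_inv g h :
    generated gens g -> cancel g h -> cancel h g -> generated gens h.

Definition generated3 (g1 g2 g3 : T -> T) : (T -> T) -> Prop :=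
  generated (fun g => [\/ g = g1, g = g2 | g = g3]).

Definition fixed (G : (T -> T) -> Prop) (f : T) : Prop :=
  forall g, G g -> g f = f.

End Groups.

Section RationalFunctions.

Variable K : fieldType.

Definition ratfun : fieldType := {fraction {mpoly K[3]}}.

Definition constF : {rmorphism K -> ratfun} :=
  (@FracField.tofrac {mpoly K[3]} \o @mpolyC 3 K).

Definition varF (i : 'I_3) : ratfun := FracField.tofrac ('X_i : {mpoly K[3]}).
Definition x : ratfun := varF (@Ordinal 3 0 isT).
Definition y : ratfun := varF (@Ordinal 3 1 isT).
Definition z : ratfun := varF (@Ordinal 3 2 isT).

(* [s] is the K-automorphism of K(x,y,z) such that x |-> u, y |-> v, z |-> w;
   it is unique as K(x,y,z) is generated by x, y, z over K. *)
Definition is_Kaut (s : {rmorphism ratfun -> ratfun}) (u v w : ratfun) : Prop :=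
  [/\ bijective s, forall c, s (constF c) = constF c
    & [/\ s x = u, s y = v & s z = w]].

End RationalFunctions.

Arguments x {K}.
Arguments y {K}.
Arguments z {K}.

(* Main.v *)
(* Let V be the Klein four-group generated by tau and lambda; sigma permutes cyclically
   three generators at each stage, and a field K(a, b, c)^C3 is handled by Masuda's
   generators a + b + c, u, v, with Galois descent along a, b, c.

   For eps = 1, K(x, y, z)^V is generated by three elements permuted by sigma.

   For eps = -1, one of a, -a, -1 is a square in K, and K(x, y, z) is generated by three
   points (al_j, be_j) of a circle al^2 + be^2 = d, permuted by sigma, on whose
   coordinates V acts by signs; d = 1 if a or -a is a square, d = a if -1 is. Then
   K(x, y, z)^V = K(R0, R1, R2, W), where sigma permutes the R_j, fixes W, and
   W^2 + (R0 R1 R2 / d)^2 = R0^2 + R1^2 + R2^2 + 2 d.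
   - If -1 = i^2, one factor g of the left-hand side and three elements f_j permuted by
     sigma generate this field, with a relation linear in f0 + f1 + f2 over K(g, u, v).
   - If d = 1, the equation becomes a conic over K(u, v), and a suitable change of
     variables brings it to X^2 - r^2 = w (Y^2 - 4 + t^2), where w = t^2 + 16; this is
     linear in r once X - r is taken as a variable.

   Algebraic independence always follows from the exchange property: three elements are
   independent if three independent ones are algebraic over them. *)

Require Import Defs.
From Stdlib Require Import ClassicalEpsilon.
From HB Require Import structures.
From mathcomp Require Import all_boot all_order all_algebra all_field.
From mathcomp Require Import generic_quotient mpoly ring.

Set Implicit Arguments.
Unset Strict Implicit.
Unset Printing Implicit Defensive.

Import GRing.Theory.
Local Open Scope ring_scope.

(** For eps = -1, V acts by characters on the six coordinates al_j, be_j, and al_(j+1) has the same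
    character as be_j. A hyperbolic difference of such a pair is therefore rational in the
    coordinates and changes only by a sign under V; it gives units e_j = c_j + t_j sqrt(-d) of norm
    1. The three signs have product 1, so e_1 e_2 / e_0 and its images under sigma are invariant,
    and the R_j are sqrt d times the tangents of half their arguments. The field K(R0, R1, R2) falls
    one square root short of the invariants; W supplies it.

    The obstacle is then to find coordinates for the quotient of this double cover by sigma over K
    itself: K need not contain a cube root of unity, and characteristic 3 is allowed. Masuda's
    generators answer this because they make the second and third elementary symmetric functions
    affine in the first, so suitable cyclic relations become linear or quadratic.

    No Galois correspondence is invoked: a fixed element is descended along explicit conjugates of a
    generator, and most nonvanishing claims reduce to the value of a polynomial at one point. *)

(** * Intermediate fields, algebraic elements and the exchange property *)

Section Adjoin.

Variables (K F : fieldType) (iota : {rmorphism K -> F}).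
Implicit Types S T : F -> Prop.
Local Notation adj := (adjoin iota).

Lemma adjoin0 S : adj S 0.
Proof. by rewrite -(rmorph0 iota); apply: adjoin_base. Qed.

Lemma adjoin1 S : adj S 1.
Proof. by rewrite -(rmorph1 iota); apply: adjoin_base. Qed.

Lemma adjoin_opp S u : adj S u -> adj S (- u).
Proof. by move=> Su; rewrite -sub0r; apply: adjoin_sub Su; apply: adjoin0. Qed.

Lemma adjoin_add S u v : adj S u -> adj S v -> adj S (u + v).
Proof. by move=> Su Sv; rewrite -[v]opprK; apply: adjoin_sub => //; apply: adjoin_opp. Qed.

Lemma adjoin_div S u v : adj S u -> adj S v -> adj S (u / v).
Proof. by move=> Su Sv; apply: adjoin_mul => //; apply: adjoin_inv. Qed.

Lemma adjoin_exp S u n : adj S u -> adj S (u ^+ n).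
Proof.
by move=> Su; elim: n => [|n IHn]; rewrite ?expr0 ?exprS;
  [apply: adjoin1 | apply: adjoin_mul].
Qed.

Lemma adjoin_natmul S u n : adj S u -> adj S (u *+ n).
Proof.
by move=> Su; elim: n => [|n IHn]; rewrite ?mulr0n ?mulrS;
  [apply: adjoin0 | apply: adjoin_add].
Qed.

Lemma adjoin_sum S (I : Type) (r : seq I) (P : pred I) (f : I -> F) :
  (forall i, adj S (f i)) -> adj S (\sum_(i <- r | P i) f i).
Proof.
by move=> Sf; elim/big_rec: _ => [|i u _ Su];
  [apply: adjoin0 | apply: adjoin_add].
Qed.

Lemma adjoin_trans S T :
  (forall f, S f -> adj T f) -> forall f, adj S f -> adj T f.
Proof.
move=> ST f; elim=> {f} [c|f /ST //|u v _ Tu _ Tv|u v _ Tu _ Tv|u _ Tu].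
- exact: adjoin_base.
- exact: adjoin_sub.
- exact: adjoin_mul.
- exact: adjoin_inv.
Qed.

Lemma adjoin_mono S T : (forall f, S f -> T f) -> forall f, adj S f -> adj T f.
Proof. by move=> ST; apply: adjoin_trans => f /ST; apply: adjoin_gen. Qed.

(* The intermediate field as a type, so that the theory of integral elements of
   mxpoly applies to it. *)
Definition adjoinb S : {pred F} :=
  fun f => if excluded_middle_informative (adj S f) then true else false.

Lemma adjoinbP S f : reflect (adj S f) (f \in adjoinb S).
Proof.
by rewrite unfold_in; case: excluded_middle_informative => Sf; constructor.
Qed.

Lemma adjoinb_divring S : divring_closed (adjoinb S).
Proof.
split=> [|u v /adjoinbP Su /adjoinbP Sv|u v /adjoinbP Su /adjoinbP Sv];
  apply/adjoinbP; [exact: adjoin1 | exact: adjoin_sub | exact: adjoin_div].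
Qed.

Record adjoin_type S :=
  AdjoinType { adjoin_val :> F; adjoin_valP : adjoin_val \in adjoinb S }.

HB.instance Definition _ S := [isSub for @adjoin_val S].
HB.instance Definition _ S := [Choice of adjoin_type S by <:].
HB.instance Definition _ S := GRing.SubChoice_isSubIntegralDomain.Build
  F (adjoinb S) (adjoin_type S) (adjoinb_divring S).
HB.instance Definition _ S := [SubIntegralDomain_isSubField of adjoin_type S by <:].

Definition algebraic S (f : F) : Prop :=
  algebraicOver (val : adjoin_type S -> F) f.

Lemma adjoin_polyP S (p : {poly F}) : (forall i, adj S p`_i) ->
  exists q : {poly adjoin_type S}, map_poly val q = p.
Proof.
move=> Sp; exists (\poly_(i < size p) insubd 0 p`_i).
apply/polyP=> i; rewrite coef_map coef_poly; case: ltnP => [ip|pi].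
  by apply: insubdK; apply/adjoinbP.
by rewrite nth_default // rmorph0.
Qed.

Lemma algebraicP S f : algebraic S f <->
  exists p : {poly F}, [/\ p != 0, forall i, adj S p`_i & root p f].
Proof.
split=> [[p p0 pf]|[p [p0 Sp pf]]].
  exists (map_poly val p); split=> //; first by rewrite map_poly_eq0.
  by move=> i; rewrite coef_map; apply/adjoinbP/adjoin_valP.
have [q qp] := adjoin_polyP Sp; exists q; last by rewrite qp.
by rewrite -(map_poly_eq0 (val : {rmorphism adjoin_type S -> F})) /= qp.
Qed.

Lemma algebraic_adjoin S f : adj S f -> algebraic S f.
Proof. by move/adjoinbP=> Sf; apply: (algebraic_id _ (AdjoinType Sf)). Qed.

Lemma algebraic_root S (p : {poly F}) f :
  p != 0 -> root p f -> (forall i, algebraic S p`_i) -> algebraic S f.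
Proof.
move=> p0 pf Sp; apply/integral_algebraic/(integral_root p0 pf).
by move=> _ /(nthP 0)[i _ <-]; apply/integral_algebraic/Sp.
Qed.

Lemma algebraic_adjoin_closed S T :
  (forall f, T f -> algebraic S f) -> forall f, adj T f -> algebraic S f.
Proof.
move=> ST f; elim=> {f} [c|f /ST //|u v _ Su _ Sv|u v _ Su _ Sv|u _ Su].
- exact/algebraic_adjoin/adjoin_base.
- exact: algebraic_sub.
- exact: algebraic_mul.
- exact: algebraic_inv.
Qed.

Lemma algebraic_trans S T f :
  (forall g, T g -> algebraic S g) -> algebraic T f -> algebraic S f.
Proof.
move=> ST /algebraicP[p [p0 Tp pf]]; apply: (algebraic_root p0 pf) => i.
exact: algebraic_adjoin_closed ST _ (Tp i).
Qed.

Lemma algebraic_mono S T f :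
  (forall g, S g -> T g) -> algebraic S f -> algebraic T f.
Proof.
by move=> ST; apply: algebraic_trans => g /ST Tg; apply/algebraic_adjoin/adjoin_gen.
Qed.

Lemma algebraic_sqrt S f : algebraic S (f ^+ 2) -> algebraic S f.
Proof.
move=> Sf2; apply: (@algebraic_root S ('X^2 - (f ^+ 2)%:P)).
- by rewrite -size_poly_eq0 size_XnsubC.
- by rewrite /root !hornerE subrr.
move=> i; rewrite coefB coefXn coefC; apply: algebraic_sub.
  by case: (_ == _); [apply: algebraic1 | apply: algebraic0].
by case: (_ == _) => //; apply: algebraic0.
Qed.

Lemma algebraicN S f : algebraic S f -> algebraic S (- f).
Proof. exact: algebraic_opp. Qed.

Lemma algebraicD S f g : algebraic S f -> algebraic S g -> algebraic S (f + g).
Proof. exact: algebraic_add. Qed.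

Lemma algebraicM S f g : algebraic S f -> algebraic S g -> algebraic S (f * g).
Proof. exact: algebraic_mul. Qed.

Lemma algebraicV S f : algebraic S f -> algebraic S f^-1.
Proof. exact: algebraic_inv. Qed.

Lemma algebraicX S f n : algebraic S f -> algebraic S (f ^+ n).
Proof.
by move=> Sf; elim: n => [|n IHn]; rewrite ?expr0 ?exprS;
  [apply/algebraic_adjoin/adjoin1 | apply: algebraicM].
Qed.

Lemma algebraicMn S f n : algebraic S f -> algebraic S (f *+ n).
Proof.
by move=> Sf; elim: n => [|n IHn]; rewrite ?mulr0n ?mulrS;
  [apply/algebraic_adjoin/adjoin0 | apply: algebraicD].
Qed.

Lemma algebraic_sum_prod S f g :
  algebraic S (f + g) -> algebraic S (f * g) -> algebraic S f.
Proof.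
move=> Sa Sm; apply: (@algebraic_root S (('X - f%:P) * ('X - g%:P))).
- by rewrite mulf_neq0 ?polyXsubC_eq0.
- by rewrite rootM root_XsubC eqxx.
have -> : ('X - f%:P) * ('X - g%:P) = 'X^2 - (f + g)%:P * 'X + (f * g)%:P :> {poly F}.
  by rewrite polyCD polyCM; ring.
have [S0 S1] : algebraic S 0 /\ algebraic S 1.
  by split; apply: algebraic_adjoin; [apply: adjoin0 | apply: adjoin1].
move=> i; rewrite coefD coefB coefXn coefCM coefX coefC.
apply: algebraicD; last by case: (_ == _).
apply: algebraicD; first exact: algebraicMn.
by apply/algebraicN/algebraicM => //; apply: algebraicMn.
Qed.

Definition add1 S a : F -> Prop := fun f => S f \/ f = a.

Lemma adjoin_add1P S a f : adj (add1 S a) f ->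
  exists p q : {poly F}, [/\ forall i, adj S p`_i, forall i, adj S q`_i,
    q.[a] != 0 & f = p.[a] / q.[a]].
Proof.
have cst c : adj S c -> forall i, adj S (c%:P : {poly F})`_i.
  by move=> Sc i; rewrite coefC; case: (_ == _) => //; apply: adjoin0.
have mul (p q : {poly F}) : (forall i, adj S p`_i) -> (forall i, adj S q`_i) ->
    forall i, adj S (p * q)`_i.
  by move=> Sp Sq i; rewrite coefM; apply: adjoin_sum => j; apply: adjoin_mul.
have S1 := cst 1 (adjoin1 S).
elim=> {f} [c|f [Sf|->]|u v _ [p [q [Sp Sq q0 ->]]] _ [p' [q' [Sp' Sq' q'0 ->]]]
  |u v _ [p [q [Sp Sq q0 ->]]] _ [p' [q' [Sp' Sq' q'0 ->]]]
  |u _ [p [q [Sp Sq q0 ->]]]].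
- exists (iota c)%:P, 1%:P; split=> //; first exact/cst/adjoin_base.
    by rewrite hornerC oner_eq0.
  by rewrite !hornerC divr1.
- exists f%:P, 1%:P; split=> //; first exact/cst/adjoin_gen.
    by rewrite hornerC oner_eq0.
  by rewrite !hornerC divr1.
- exists 'X, 1%:P; split=> //; last by rewrite hornerC hornerX divr1.
    move=> i; rewrite coefX.
    by case: (_ == _); [apply: adjoin1 | apply: adjoin0].
  by rewrite hornerC oner_eq0.
- exists (p * q' - p' * q), (q * q'); split.
  + by move=> i; rewrite coefB; apply: adjoin_sub; apply: mul.
  + exact: mul.
  + by rewrite hornerM mulf_neq0.
  + by rewrite !hornerE; field; rewrite q0 q'0.
- exists (p * p'), (q * q'); split; try exact: mul.
    by rewrite hornerM mulf_neq0.
  by rewrite !hornerM mulf_div.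
- have [pa0|pa0] := eqVneq p.[a] 0.
    exists 0, 1%:P; split=> //; last by rewrite pa0 mul0r invr0 horner0 mul0r.
      by move=> i; rewrite coef0; apply: adjoin0.
    by rewrite hornerC oner_eq0.
  by exists q, p; split=> //; rewrite invf_div.
Qed.

Lemma adjoin_add1_family S a n (f : nat -> F) :
    (forall i, adj (add1 S a) (f i)) ->
  exists (p : nat -> {poly F}) (q : {poly F}),
    [/\ forall i j, adj S (p i)`_j, q.[a] != 0 &
        forall i, (i < n)%N -> f i * q.[a] = (p i).[a]].
Proof.
move=> Sf; suff [p [q [Sp Sq q0 fE]]] : exists (p : nat -> {poly F}) (q : {poly F}),
    [/\ forall i j, adj S (p i)`_j, forall j, adj S q`_j, q.[a] != 0 &
        forall i, (i < n)%N -> f i * q.[a] = (p i).[a]] by exists p, q.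
have mul (p q : {poly F}) : (forall i, adj S p`_i) -> (forall i, adj S q`_i) ->
    forall i, adj S (p * q)`_i.
  by move=> Sp Sq i; rewrite coefM; apply: adjoin_sum => j; apply: adjoin_mul.
elim: n => [|n [p [q [Sp Sq q0 fE]]]].
  exists (fun=> 0), 1; split=> // [i j|j|]; rewrite ?coef0 ?coef1.
  - exact: adjoin0.
  - by case: (_ == _); [apply: adjoin1 | apply: adjoin0].
  - by rewrite hornerC oner_eq0.
have [p' [q' [Sp' Sq' q'0 fnE]]] := adjoin_add1P (Sf n).
exists (fun i => if i == n then p' * q else p i * q'), (q * q'); split.
- by move=> i; case: eqP => _; apply: mul.
- exact: mul.
- by rewrite hornerM mulf_neq0.
move=> i; rewrite ltnS leq_eqVlt; case: eqP => [-> _|_ /= ltin].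
  by rewrite fnE !hornerM; field.
by rewrite !hornerM mulrA fE.
Qed.

(** A relation for [b] over K(S, a), cleared of denominators, is a polynomial in [a] and [b] over
    K(S); read as a polynomial in [a], it is a relation over K(S, b). It is nonzero because its
    coefficients are polynomials in [b], not all trivial, and [b] is transcendental over K(S). *)
Lemma algebraic_exchange S a b :
  algebraic (add1 S a) b -> ~ algebraic S b -> algebraic (add1 S b) a.
Proof.
move=> /algebraicP[P [P0 SP Pb]] trb.
have [p [q [Sp q0 PE]]] := adjoin_add1_family (size P) SP.
pose R := \sum_(i < size P) (b ^+ i)%:P * p i.
apply/algebraicP; exists R; split.
- apply/eqP=> R0; apply: trb; apply/algebraicP.
  have [i [j pij]] : exists i : 'I_(size P), exists j, (p i)`_j != 0.
    have sP : ((size P).-1 < size P)%N by rewrite prednK // size_poly_gt0.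
    have p0 : p (size P).-1 != 0.
      apply/eqP=> p0; have := PE _ sP; rewrite p0 horner0 => /eqP.
      by rewrite mulf_eq0 (negbTE q0) orbF lead_coef_eq0 (negbTE P0).
    exists (Ordinal sP), (size (p (size P).-1)).-1.
    by rewrite /= lead_coef_eq0.
  exists (\poly_(i < size P) (p i)`_j); split.
  + apply/eqP=> /polyP/(_ i); rewrite coef_poly ltn_ord coef0 => pij0.
    by rewrite pij0 eqxx in pij.
  + by move=> k; rewrite coef_poly; case: ifP => _ //; apply: adjoin0.
  + rewrite /root horner_poly; apply/eqP; transitivity R`_j; last by rewrite R0 coef0.
    by rewrite coef_sum; apply: eq_bigr => k _; rewrite coefCM mulrC.
- move=> j; rewrite coef_sum; apply: adjoin_sum => i; rewrite coefCM.
  apply: adjoin_mul; first by apply: adjoin_exp; apply: adjoin_gen; right.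
  by apply: adjoin_mono (Sp i j) => f Sf; left.
- rewrite /root /R horner_sum; apply/eqP.
  transitivity (P.[b] * q.[a]); last by rewrite (rootP Pb) mul0r.
  rewrite horner_coef mulr_suml; apply: eq_bigr => i _.
  by rewrite hornerM hornerC -PE //; ring.
Qed.

(** A tower: each element is transcendental over K(S) and the preceding ones. This form of
    independence suits the induction of the exchange argument. *)
Fixpoint transcendental S (s : seq F) : Prop :=
  if s is a :: s' then ~ algebraic S a /\ transcendental (add1 S a) s' else True.

(** Steinitz replacement: add the elements of [s] one by one until [a] becomes algebraic; the last
    one added, [b], can be exchanged for [a]. *)
Lemma algebraic_switch S a (s : seq F) :
    algebraic (fun f => S f \/ f \in s) a -> ~ algebraic S a ->
  exists s1 b s2, s = s1 ++ b :: s2 /\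
    forall f, f \in s -> algebraic (fun g => add1 S a g \/ g \in s1 ++ s2) f.
Proof.
elim: s S => [|b s IHs] S Sa trS.
  by case: trS; apply: algebraic_mono Sa => f [].
have [Sba|trSb] := excluded_middle_informative (algebraic (add1 S b) a).
  exists [::], b, s; split=> // f; rewrite in_cons => /orP[/eqP->|sf] /=.
    apply: algebraic_mono (algebraic_exchange Sba trS) => g Sg; by left.
  by apply/algebraic_adjoin/adjoin_gen; right.
have [|s1 [c [s2 [sE sf]]]] := IHs (add1 S b) _ trSb.
  apply: algebraic_mono Sa => f; rewrite in_cons.
  by case=> [Sf|/orP[/eqP->|sf]]; [left; left | left; right | right].
exists (b :: s1), c, s2; split; first by rewrite sE.
move=> f; rewrite in_cons => /orP[/eqP->|/sf].
  by apply/algebraic_adjoin/adjoin_gen; right; rewrite mem_head.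
apply: algebraic_mono => g; rewrite cat_cons in_cons.
case=> [[[Sg|->]|->]|->]; [by left; left | | by left; right | by right; rewrite orbT].
by right; rewrite eqxx.
Qed.

Lemma transcendental_size S (s r : seq F) :
    transcendental S s ->
    (forall f, f \in s -> algebraic (fun g => S g \/ g \in r) f) ->
  (size s <= size r)%N.
Proof.
elim: s S r => [//|a s IHs] S r /= [trSa trs] sr.
have [s1 [b [s2 [rE rf]]]] := algebraic_switch (sr a (mem_head _ _)) trSa.
rewrite rE size_cat /= addnS ltnS -size_cat.
apply: IHs trs _ => f sf; apply: algebraic_trans (sr f _); last first.
  by rewrite in_cons sf orbT.
by move=> g [Sg|/rf //]; apply/algebraic_adjoin/adjoin_gen; left; left.
Qed.

End Adjoin.

(** * Algebraic independence of finite families *)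

Lemma mpoly_rmorph_eq (n : nat) (R S : comNzRingType)
    (f g : {rmorphism {mpoly R[n]} -> S}) :
  (forall c, f c%:MP = g c%:MP) -> (forall i, f 'X_i = g 'X_i) -> f =1 g.
Proof.
move=> fgC fgX p; rewrite [p]mpolyE !rmorph_sum; apply: eq_bigr => m _.
rewrite -mul_mpolyC !rmorphM fgC mpolyXE_id; congr (_ * _).
by rewrite !rmorph_prod; apply: eq_bigr => i _; rewrite !rmorphXn fgX.
Qed.

Lemma mmapXi (n : nat) (R S : comNzRingType) (f : {rmorphism R -> S})
  (h : 'I_n -> S) i : mmap f h 'X_i = h i.
Proof. by rewrite mmapX mmap1U. Qed.

Section Independence.

Variables (K F : fieldType) (iota : {rmorphism K -> F}).
Local Notation adj := (adjoin iota).
Local Notation alg := (algebraic iota).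
Local Notation widen := (widen_ord (leqnSn _)).

Definition range n (t : 'I_n -> F) : F -> Prop := fun f => exists i, f = t i.

Definition independent n (t : 'I_n -> F) : Prop :=
  forall p : {mpoly K[n]}, mmap iota t p = 0 -> p = 0.

Lemma mmap_mwiden n (t : 'I_n.+1 -> F) (p : {mpoly K[n]}) :
  mmap iota t (mwiden p) = mmap iota (t \o widen) p.
Proof.
apply: (@mpoly_rmorph_eq _ _ _ (mmap iota t \o @mwiden n K) (mmap iota (t \o widen))).
  by move=> c /=; rewrite mwidenC !mmapC.
by move=> i /=; rewrite mwidenX mnmwiden1 !mmapXi.
Qed.

Lemma independent_widen n (t : 'I_n.+1 -> F) :
  independent t -> independent (t \o widen).
Proof.
move=> tI p tp0; apply/inj_mwiden; rewrite mwiden0.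
by apply: tI; rewrite mmap_mwiden.
Qed.

Lemma adjoin_range_quotient n (t : 'I_n -> F) f : adj (range t) f ->
  exists p q : {mpoly K[n]},
    mmap iota t q != 0 /\ f = mmap iota t p / mmap iota t q.
Proof.
elim=> {f} [c|f [i ->]|u v _ [p [q [q0 ->]]] _ [p' [q' [q'0 ->]]]
  |u v _ [p [q [q0 ->]]] _ [p' [q' [q'0 ->]]] |u _ [p [q [q0 ->]]]].
- by exists c%:MP, 1; rewrite rmorph1 oner_eq0 mmapC divr1.
- by exists 'X_i, 1; rewrite rmorph1 oner_eq0 mmapXi divr1.
- exists (p * q' - p' * q), (q * q'); rewrite !(rmorphB, rmorphM) mulf_neq0 //.
  by split=> //; field; rewrite q0 q'0.
- by exists (p * p'), (q * q'); rewrite !rmorphM mulf_neq0 // mulf_div.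
have [p0|p0] := eqVneq (mmap iota t p) 0.
  by exists 0, 1; rewrite p0 rmorph0 rmorph1 oner_eq0 !mul0r invr0.
by exists q, p; rewrite invf_div.
Qed.

Lemma adjoin_range_family n (t : 'I_n -> F) m (f : nat -> F) :
    (forall i, adj (range t) (f i)) ->
  exists (p : nat -> {mpoly K[n]}) (q : {mpoly K[n]}), mmap iota t q != 0 /\
    forall i, (i < m)%N -> f i * mmap iota t q = mmap iota t (p i).
Proof.
move=> tf; elim: m => [|m [p [q [q0 fE]]]].
  by exists (fun=> 0), 1; rewrite rmorph1 oner_eq0.
have [p' [q' [q'0 fmE]]] := adjoin_range_quotient (tf m).
exists (fun i => if i == m then p' * q else p i * q'), (q * q').
rewrite rmorphM mulf_neq0 //; split=> // i.
rewrite ltnS leq_eqVlt; case: eqP => [-> _|_ /= ltim].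
  by rewrite fmE rmorphM; field.
by rewrite rmorphM mulrA fE.
Qed.

Lemma muni_mwiden n (p : {mpoly K[n]}) : muni (mwiden p) = p%:P.
Proof.
apply: (@mpoly_rmorph_eq _ _ _ (@muni n K \o @mwiden n K) polyC).
  by move=> c /=; rewrite mwidenC muniC.
move=> i /=; rewrite mwidenX mnmwiden1 muniE msuppX big_seq1 mcoeffX eqxx scale1r.
rewrite mnm1E -val_eqE /= ltn_eqF // expr0 alg_polyC; congr ('X_[_]%:P).
by apply/mnmP=> j; rewrite mnmE !mnm1E -val_eqE.
Qed.

Lemma muni_last n : muni ('X_ord_max : {mpoly K[n.+1]}) = 'X.
Proof.
rewrite muniE msuppX big_seq1 mcoeffX eqxx scale1r mnm1E eqxx expr1.
suff -> : [multinom U_(ord_max)%MM (widen i) | i < n] = 0%MM.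
  by rewrite mpolyX0 scale1r.
by apply/mnmP=> j; rewrite mnmE mnm1E mnm0E -val_eqE /= gtn_eqF.
Qed.

Lemma mmultiK n (p : {poly {mpoly K[n]}}) : muni (mmulti p) = p.
Proof.
rewrite /mmulti rmorph_sum /= -[RHS]coefK poly_def; apply: eq_bigr => i _.
by rewrite rmorphM rmorphXn /= muni_mwiden muni_last mul_polyC.
Qed.

Lemma muniK n (p : {mpoly K[n.+1]}) : mmulti (muni p) = p.
Proof.
have mmultiE (q : {poly {mpoly K[n]}}) :
    mmulti q = (map_poly (@mwiden n K) q).['X_ord_max].
  rewrite (horner_coef_wide _ (size_poly _ _)); apply: eq_bigr => i _.
  by rewrite coef_map.
rewrite mmultiE; apply: (@mpoly_rmorph_eq _ _ _
  (horner_eval 'X_ord_max \o map_poly (@mwiden n K) \o @muni n K) idfun).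
  by move=> c /=; rewrite muniC map_polyC /horner_eval hornerC /= mwidenC.
move=> i /=; rewrite /horner_eval.
have [->|im] := eqVneq i ord_max; first by rewrite muni_last map_polyX hornerX.
have lt_in : (i < n)%N.
  by have := ltn_ord i; rewrite ltnS leq_eqVlt => /orP[/eqP ein|//];
    case/eqP: im; apply: val_inj.
have -> : 'X_i = mwiden ('X_(Ordinal lt_in) : {mpoly K[n]}).
  by rewrite mwidenX mnmwiden1; congr ('X_[U_(_)]); apply: val_inj.
by rewrite muni_mwiden map_polyC hornerC.
Qed.

(** A relation for the last element over the others, cleared of denominators, is a polynomial in n +
    1 variables that vanishes at [t]. *)
Lemma independent_last n (t : 'I_n.+1 -> F) :
  independent t -> ~ alg (range (t \o widen)) (t ord_max).
Proof.
move=> tI /algebraicP[P [P0 tP Pt]].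
have [p [q [q0 PE]]] := adjoin_range_family (size P) tP.
pose R := \poly_(i < size P) p i.
have R0 : mmulti R = 0.
  apply: tI; rewrite rmorph_sum.
  have sR : (size R <= size P)%N by apply: size_poly.
  transitivity (P.[t ord_max] * mmap iota (t \o widen) q); last first.
    by rewrite (rootP Pt) mul0r.
  rewrite horner_coef mulr_suml.
  rewrite (big_ord_widen _ (fun i => mmap iota t (mwiden R`_i * 'X_ord_max ^+ i)) sR).
  rewrite big_mkcond; apply: eq_bigr => i _.
  have -> : P`_i * t ord_max ^+ i * mmap iota (t \o widen) q =
      mmap iota (t \o widen) (p i) * t ord_max ^+ i by rewrite -PE //; ring.
  have pE : R`_i = p i by rewrite coef_poly ltn_ord.
  case: ltnP => [_|Ri].
    by rewrite rmorphM rmorphXn /= mmapXi mmap_mwiden pE.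
  by rewrite -pE nth_default // rmorph0 mul0r.
have sP : ((size P).-1 < size P)%N by rewrite prednK // size_poly_gt0.
have p0 : p (size P).-1 = 0.
  transitivity R`_(size P).-1; first by rewrite coef_poly sP.
  suff -> : R = 0 by rewrite coef0.
  by rewrite -[R]mmultiK R0 rmorph0.
have := PE _ sP; rewrite p0 rmorph0 => /eqP.
by rewrite mulf_eq0 (negbTE q0) orbF lead_coef_eq0 (negbTE P0).
Qed.

Lemma independent_rec n (t : 'I_n.+1 -> F) :
    independent (t \o widen) -> ~ alg (range (t \o widen)) (t ord_max) ->
  independent t.
Proof.
move=> tI ttr p tp0; apply/eqP/negPn/negP=> p0; apply: ttr; apply/algebraicP.
exists (map_poly (mmap iota (t \o widen)) (muni p)); split.
- apply/eqP=> /polyP mp0; case/eqP: p0; rewrite -[p]muniK.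
  suff -> : muni p = 0 by rewrite /mmulti size_poly0 big_ord0.
  apply/polyP=> i; rewrite coef0; apply: tI.
  by have := mp0 i; rewrite coef_map coef0.
- move=> i; rewrite coef_map /=; move: ((muni p)`_i) => q.
  rewrite [q]mpolyE rmorph_sum; apply: adjoin_sum => m.
  rewrite -mul_mpolyC rmorphM /= mmapC mmapX.
  apply: adjoin_mul; first exact: adjoin_base.
  rewrite /mmap1; elim/big_rec: _ => [|j f _ Sf]; first exact: adjoin1.
  by apply: adjoin_mul => //; apply/adjoin_exp/adjoin_gen; exists j.
- apply/eqP; rewrite -[RHS]tp0 -[p in RHS]muniK; symmetry.
  rewrite rmorph_sum /= horner_coef.
  rewrite (big_ord_widen (size (muni p))
    (fun i => (map_poly (mmap iota (t \o widen)) (muni p))`_i * t ord_max ^+ i));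
    last exact: size_poly.
  rewrite [RHS]big_mkcond; apply: eq_bigr => i _.
  have mE : mmap iota t (mwiden (muni p)`_i * 'X_ord_max ^+ i) =
      (map_poly (mmap iota (t \o widen)) (muni p))`_i * t ord_max ^+ i.
    by rewrite rmorphM rmorphXn /= mmapXi mmap_mwiden coef_map.
  by rewrite mE; case: ltnP => // le; rewrite nth_default // mul0r.
Qed.

Lemma independent_or_algebraic n (t : 'I_n -> F) :
  independent t \/ exists j, alg (fun f => exists2 i, i != j & f = t i) (t j).
Proof.
elim: n t => [|n IHn] t.
  left=> p; have -> : p = (p@_(0%MM : 'X_{1.. 0}))%:MP.
    apply/mpolyP=> m; have -> : m = 0%MM by apply/mnmP => -[].
    by rewrite mcoeffC eqxx mulr1.
  by rewrite mmapC => /eqP; rewrite fmorph_eq0 => /eqP->; rewrite mpolyC0.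
have [tI|[j tj]] := IHn (t \o widen); last first.
  right; exists (widen j); apply: algebraic_mono tj => _ [i ij ->].
  by exists (widen i).
have [ta|ttr] := excluded_middle_informative
    (alg (range (t \o widen)) (t ord_max)); last by left; apply: independent_rec.
right; exists ord_max; apply: algebraic_mono ta => _ [i ->].
by exists (widen i) => //; rewrite -val_eqE /= neq_ltn ltn_ord.
Qed.

Lemma transcendental_rcons S (s : seq F) a :
    transcendental iota S s -> ~ alg (fun f => S f \/ f \in s) a ->
  transcendental iota S (rcons s a).
Proof.
elim: s S => [|b s IHs] S /=.
  by move=> _ tra; split=> // Sa; apply: tra; apply: algebraic_mono Sa => f; left.
move=> [trb trs] tra; split=> //; apply: IHs => // Sa; apply: tra.
apply: algebraic_mono Sa => f; rewrite in_cons => -[[Sf|->]|->].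
- by left.
- by right; rewrite eqxx.
- by right; rewrite orbT.
Qed.

Lemma independent_transcendental n (t : 'I_n -> F) :
  independent t -> transcendental iota (fun=> False) [seq t i | i <- enum 'I_n].
Proof.
elim: n t => [|n IHn] t tI; first by rewrite (size0nil (size_enum_ord 0)).
rewrite enum_ordSr map_rcons -map_comp; apply: transcendental_rcons.
  exact/IHn/independent_widen.
move=> ta; apply: (independent_last tI); apply: algebraic_mono ta => f [//|].
by case/mapP=> i _ ->; exists i.
Qed.

(* By the exchange property, n independent elements cannot be algebraic over
   fewer than n elements. *)
Lemma independent_algebraic n (t u : 'I_n -> F) :
    independent t -> (forall i, alg (range u) (t i)) -> independent u.
Proof.
move=> tI tu; have [//|[j uj]] := independent_or_algebraic u; exfalso.
pose s := [seq u i | i <- rem j (enum 'I_n)].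
have := transcendental_size (r := s) (independent_transcendental tI).
rewrite size_map size_enum_ord /s size_map size_rem ?mem_enum // size_enum_ord.
have jn := ltn_ord j; have -> : (n <= n.-1)%N = false.
  by apply/negbTE; rewrite -ltnNge prednK // (leq_ltn_trans _ jn).
move=> abs; have // : false; apply: abs => _ /mapP[i _ ->].
have us k : k != j -> u k \in s.
  move=> kj; apply: map_f; rewrite mem_rem_uniq ?enum_uniq //.
  by rewrite inE kj mem_enum.
apply: algebraic_trans (tu i) => _ [k ->].
have [->|kj] := eqVneq k j; last first.
  by apply/algebraic_adjoin/adjoin_gen; right; apply: us.
by apply: algebraic_mono uj => _ [l lj ->]; right; apply: us.
Qed.

Lemma rational_independent n (t : 'I_n -> F) (L : F -> Prop) :
    independent t -> (forall f, L f <-> adj (range t) f) -> rational iota L.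
Proof.
move=> tI LE; exists (range t); split=> // m u u_inj ut p up0.
have {ut}[k uE] : exists k : 'I_m -> 'I_n, forall i, u i = t (k i).
  exists (fun i => proj1_sig (constructive_indefinite_description _ (ut i))) => i.
  by case: constructive_indefinite_description.
(* The definition of [rational] ranges over injective families [u] of any length. Such a family is a
   subfamily of [t]: [ren] renames its variables along [k], and [l] undoes this, sending the
   variables outside the image of [k] to 0. *)
pose ren := mmap (@mpolyC n K) (fun i : 'I_m => 'X_(k i) : {mpoly K[n]}).
pose l (j : 'I_n) : {mpoly K[m]} :=
  if [pick i | k i == j] is Some i then 'X_i else 0.
have lk i : l (k i) = 'X_i.
  rewrite /l; case: pickP => [i' /eqP ki|/(_ i)]; last by rewrite eqxx.
  by congr ('X__); apply: u_inj; rewrite !uE ki.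
have renK : mmap (@mpolyC m K) l (ren p) = p.
  apply: (@mpoly_rmorph_eq _ _ _ (mmap (@mpolyC m K) l \o
    mmap (@mpolyC n K) (fun i : 'I_m => 'X_(k i) : {mpoly K[n]})) idfun).
    by move=> c /=; rewrite !mmapC.
  by move=> i /=; rewrite !mmapXi lk.
rewrite -renK (_ : ren p = 0) ?rmorph0 //; apply: tI.
rewrite -up0; apply: (@mpoly_rmorph_eq _ _ _ (mmap iota t \o
  mmap (@mpolyC n K) (fun i : 'I_m => 'X_(k i) : {mpoly K[n]})) (mmap iota u)).
  by move=> c /=; rewrite !mmapC.
by move=> i /=; rewrite !mmapXi uE.
Qed.

End Independence.

(* Syntax of polynomial expressions: such an expression in three independent elements
   is nonzero as soon as it is nonzero at one point. *)
Inductive pexp (K : Type) :=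
| Pvar of nat
| Pcst of K
| Padd of pexp K & pexp K
| Pmul of pexp K & pexp K
| Popp of pexp K
| Pexp of pexp K & nat
| Pnat of pexp K & nat
| Pzero
| Pone.

Arguments Pvar {K}.
Arguments Pzero {K}.
Arguments Pone {K}.

Fixpoint peval (K : Type) (R : comNzRingType) (f : K -> R) (v : nat -> R)
    (e : pexp K) : R :=
  match e with
  | Pvar i => v i
  | Pcst c => f c
  | Padd e1 e2 => peval f v e1 + peval f v e2
  | Pmul e1 e2 => peval f v e1 * peval f v e2
  | Popp e1 => - peval f v e1
  | Pexp e1 n => peval f v e1 ^+ n
  | Pnat e1 n => peval f v e1 *+ n
  | Pzero => 0
  | Pone => 1
  end.

Lemma peval_rmorph (K : Type) (R R' : comNzRingType) (g : {rmorphism R -> R'})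
    (f : K -> R) (f' : K -> R') (v : nat -> R) (v' : nat -> R') e :
    (forall c, g (f c) = f' c) -> (forall i, g (v i) = v' i) ->
  g (peval f v e) = peval f' v' e.
Proof.
move=> fE vE; elim: e => //= [e1 IH1 e2 IH2|e1 IH1 e2 IH2|e IH|e IH n|e IH n||].
- by rewrite rmorphD IH1 IH2.
- by rewrite rmorphM IH1 IH2.
- by rewrite rmorphN IH.
- by rewrite rmorphXn IH.
- by rewrite rmorphMn IH.
- exact: rmorph0.
- exact: rmorph1.
Qed.

Ltac reify K i c0 c1 c2 t :=
  match t with
  | c0 => constr:(@Pvar K 0%N)
  | c1 => constr:(@Pvar K 1%N)
  | c2 => constr:(@Pvar K 2%N)
  | GRing.add ?u ?v =>
    let u := reify K i c0 c1 c2 u in let v := reify K i c0 c1 c2 v in constr:(@Padd K u v)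
  | GRing.mul ?u ?v =>
    let u := reify K i c0 c1 c2 u in let v := reify K i c0 c1 c2 v in constr:(@Pmul K u v)
  | GRing.opp ?u => let u := reify K i c0 c1 c2 u in constr:(@Popp K u)
  | GRing.exp ?u ?n => let u := reify K i c0 c1 c2 u in constr:(@Pexp K u n)
  | GRing.natmul ?u ?n => let u := reify K i c0 c1 c2 u in constr:(@Pnat K u n)
  | 0%R => constr:(@Pzero K)
  | 1%R => constr:(@Pone K)
  | GRing.RMorphism.sort i ?c => constr:(@Pcst K c)
  | _ ?c => constr:(@Pcst K c)
  end.

(** * Specialization and descent along conjugates *)

Section Descent.

Variables (K F : fieldType) (iota : {rmorphism K -> F}).
Local Notation adj := (adjoin iota).
Local Notation alg := (algebraic iota).

Definition tri (T : Type) (a b c : T) : nat -> T := fun i => nth c [:: a; b] i.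

Definition set3 (a b c : F) : F -> Prop := fun f => [\/ f = a, f = b | f = c].

Definition independent3 (a b c : F) : Prop :=
  independent iota (fun i : 'I_3 => tri a b c i).

Lemma range_tri a b c f : range (fun i : 'I_3 => tri a b c i) f <-> set3 a b c f.
Proof.
split; first by case=> -[[|[|[|//]]] i3] ->; [apply: Or31 | apply: Or32 | apply: Or33].
by case=> ->; [exists (@Ordinal 3 0 isT) | exists (@Ordinal 3 1 isT)
  | exists (@Ordinal 3 2 isT)].
Qed.

Lemma independent3_algebraic a b c a' b' c' : independent3 a b c ->
    alg (set3 a' b' c') a -> alg (set3 a' b' c') b -> alg (set3 a' b' c') c ->
  independent3 a' b' c'.
Proof.
move=> abcI ha hb hc; apply: (independent_algebraic abcI) => i.
have mono d : alg (set3 a' b' c') d ->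
    alg (range (fun i : 'I_3 => tri a' b' c' i)) d.
  by apply: algebraic_mono => f /range_tri.
by case: i => -[|[|[|//]]] i3 /=; apply: mono.
Qed.

Lemma rational3 a b c (L : F -> Prop) : independent3 a b c ->
  (forall f, L f <-> adj (set3 a b c) f) -> rational iota L.
Proof.
move=> abcI LE; apply: (rational_independent abcI) => f; rewrite LE.
by split; apply: adjoin_mono => g /range_tri.
Qed.

(** Vanishing at (a, b, c) forces the formal polynomial to vanish, hence its value at every point of
    every K-algebra [R]. Points over K mostly suffice; one use needs a point over F. *)
Lemma independent3_neq0 a b c (e : pexp K) (R : comNzRingType)
    (h : {rmorphism K -> R}) (u v w : R) : independent3 a b c ->
  peval h (tri u v w) e != 0 -> peval iota (tri a b c) e != 0.
Proof.
move=> abcI; apply: contraNN => /eqP e0.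
(* [tri] takes the value of its third argument at every index from 2 on, hence the truncation
   [minn i 2]. *)
pose X (i : nat) : {mpoly K[3]} := 'X_(inord (minn i 2)).
have triE (T : Type) (p q r : T) i : tri p q r (inord (minn i 2) : 'I_3) = tri p q r i.
  case: i => [|[|i]]; rewrite inordK //.
  by rewrite /tri /= nth_nil.
have P0 : peval (@mpolyC 3 K) X e = 0.
  apply: abcI; rewrite -e0.
  by apply: peval_rmorph => [k|i]; [rewrite /= mmapC | rewrite /X /= mmapXi triE].
apply/eqP; rewrite -(rmorph0 (mmap h (fun i : 'I_3 => tri u v w i))) -P0.
by symmetry; apply: peval_rmorph => [k|i]; [rewrite /= mmapC | rewrite /X /= mmapXi triE].
Qed.

(* With f = p(w) / q(w), the polynomial p - f q vanishes at all conjugates of w;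
   reducing p and q modulo the product of the X - w' gives p = f q. *)
Lemma adjoin_fixed S w (ws : seq F) f :
    adj (add1 S w) f -> w \in ws -> uniq ws ->
    (forall i, adj S (\prod_(w' <- ws) ('X - w'%:P))`_i) ->
    (forall w', w' \in ws -> exists s : {rmorphism F -> F},
      [/\ forall c, s (iota c) = iota c, forall g, S g -> s g = g,
          s w = w' & s f = f]) ->
  adj S f.
Proof.
move=> /adjoin_add1P[p [q [Sp Sq q0 fE]]] wws ws_uniq Sm sws.
have [P PE] := adjoin_polyP Sp; have [Q QE] := adjoin_polyP Sq.
have [M ME] := adjoin_polyP Sm; set m := \prod_(_ <- _) _ in Sm ME.
have mod_root (r : {poly F}) w' : w' \in ws -> (r %% m).[w'] = r.[w'].
  move=> w'ws; rewrite [in RHS](divp_eq r m) hornerD hornerM.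
  have : root m w' by rewrite root_prod_XsubC.
  by move/rootP->; rewrite mulr0 add0r.
have mod_adj (r : {poly F}) (R : {poly adjoin_type iota S}) :
    map_poly val R = r -> forall i, adj S (r %% m)`_i.
  move=> rE i.
  have -> : r %% m = map_poly (val : {rmorphism adjoin_type iota S -> F}) (R %% M).
    by rewrite map_modp -rE -ME.
  by rewrite coef_map; apply/adjoinbP/adjoin_valP.
have pq : p %% m = f *: (q %% m).
  apply/eqP; rewrite -subr_eq0; apply/negPn/negP=> r0.
  have : all (root (p %% m - f *: (q %% m))) ws.
    apply/allP=> w' w'ws; rewrite /root hornerD hornerN hornerZ !mod_root //.
    have [s [sK sS sw sf]] := sws _ w'ws.
    have sadj g : adj S g -> s g = g.
      elim=> {g} [c|g /sS //|g h _ sg _ sh|g h _ sg _ sh|g _ sg] //.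
      - by rewrite rmorphB sg sh.
      - by rewrite rmorphM sg sh.
      - by rewrite fmorphV sg.
    have sh (r : {poly F}) : (forall i, adj S r`_i) -> s r.[w] = r.[w'].
      move=> Sr; rewrite !horner_coef rmorph_sum; apply: eq_bigr => i _.
      by rewrite rmorphM rmorphXn /= sw sadj.
    have : s f = p.[w'] / q.[w'] by rewrite fE fmorph_div !sh.
    have qw' : q.[w'] != 0 by rewrite -sh // fmorph_eq0.
    by rewrite sf => ->; rewrite divfK // subrr.
  move/(max_poly_roots r0)/(_ ws_uniq).
  have sm : size m = (size ws).+1 by rewrite size_prod_XsubC.
  have m0 : m != 0 by rewrite -size_poly_eq0 sm.
  rewrite ltnNge => /negP; apply.
  apply: leq_trans (size_polyD _ _) _; rewrite geq_max size_polyN -ltnS -sm.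
  rewrite ltn_modp m0 /= -ltnS -sm; apply: leq_ltn_trans (size_scale_leq _ _) _.
  by rewrite ltn_modp.
have qm0 : q %% m != 0.
  by apply: contraNneq q0 => qm0; rewrite -(mod_root q w) // qm0 horner0.
have : (p %% m)`_(size (q %% m)).-1 = f * lead_coef (q %% m) by rewrite pq coefZ.
move/(canLR (mulfK _)); rewrite lead_coef_eq0 => /(_ qm0) <-.
by apply: adjoin_div; [apply: mod_adj PE _ | apply: mod_adj QE _].
Qed.

Lemma adjoin_set3 a b c :
  [/\ adj (set3 a b c) a, adj (set3 a b c) b & adj (set3 a b c) c].
Proof. by split; apply: adjoin_gen; [apply: Or31 | apply: Or32 | apply: Or33]. Qed.

End Descent.

Ltac neq0_at abcI h u v w :=
  match type of abcI with
  | @independent3 ?K ?F ?i ?a ?b ?c =>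
    match goal with
    | |- is_true (?t != _) =>
      let e := reify (GRing.Field.sort K) i a b c t in
      have := @independent3_neq0 _ _ i a b c e _ h u v w abcI;
      cbn [peval tri nth]; apply; rewrite /=
    end
  end.

Ltac adjoin_tac :=
  repeat first
    [ assumption | apply: adjoin0 | apply: adjoin1 | apply: adjoin_base
    | apply: adjoin_opp | apply: adjoin_add | apply: adjoin_mul
    | apply: adjoin_inv | apply: adjoin_exp | apply: adjoin_natmul ].

(** * Involutions, cyclic permutations and Masuda's generators *)

Section CyclicDescent.

Variables (K F : fieldType) (iota : {rmorphism K -> F}).
Local Notation adj := (adjoin iota).
Local Notation alg := (algebraic iota).

Lemma adjoin_add1 S w f : adj S f -> adj (add1 S w) f.
Proof. by apply: adjoin_mono => g; left. Qed.

Lemma adjoin_add1_gen S w : adj (add1 S w) w.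
Proof. by apply: adjoin_gen; right. Qed.

Lemma adjoin_fixed_quadratic S w w' f (s : {rmorphism F -> F}) :
    adj S (w + w') -> adj S (w * w') -> w != w' -> adj (add1 S w) f ->
    (forall c, s (iota c) = iota c) -> (forall g, S g -> s g = g) ->
    s w = w' -> s f = f ->
  adj S f.
Proof.
move=> Sa Sm ww' Sf sK sS sw sf; apply: (adjoin_fixed (ws := [:: w; w'])) Sf _ _ _ _.
- by rewrite mem_head.
- by rewrite /= inE ww'.
- move=> i; rewrite !big_cons big_nil.
  have -> : ('X - w%:P) * (('X - w'%:P) * 1) =
      'X^2 - (w + w')%:P * 'X + (w * w')%:P :> {poly F}.
    by rewrite polyCD polyCM; ring.
  rewrite coefD coefB coefXn coefCM coefX coefC.
  by case: (i == 0)%N; adjoin_tac.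
- move=> u; rewrite !inE => /orP[/eqP->|/eqP->]; last by exists s.
  by exists idfun.
Qed.

Lemma coef_cubic (a b c : F) i :
  (('X - a%:P) * (('X - b%:P) * (('X - c%:P) * 1)))`_i =
  (i == 3%N)%:R - (a + b + c) * (i == 2%N)%:R +
  (a * b + b * c + c * a) * (i == 1%N)%:R - (a * b * c) *+ (i == 0%N).
Proof.
have -> : ('X - a%:P) * (('X - b%:P) * (('X - c%:P) * 1)) =
    'X^3 - (a + b + c)%:P * 'X^2 + (a * b + b * c + c * a)%:P * 'X
    - (a * b * c)%:P :> {poly F}.
  by rewrite !polyCD !polyCM; ring.
rewrite coefB coefD coefB !coefXn !coefCM coefX coefXn coefC.
by case: (i == 0)%N.
Qed.

(* Masuda's generators of K(a, b, c)^C3; they work in every characteristic. *)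
Definition masuda_den (a b c : F) : F :=
  (a + b + c) ^+ 2 - 3 * (a * b + b * c + c * a).
Definition masuda_u (a b c : F) : F :=
  (a * b ^+ 2 + b * c ^+ 2 + c * a ^+ 2 - 3 * (a * b * c)) / masuda_den a b c.
Definition masuda_v (a b c : F) : F :=
  (a ^+ 2 * b + b ^+ 2 * c + c ^+ 2 * a - 3 * (a * b * c)) / masuda_den a b c.

(** Together with [masuda_e3]: over K(u, v), the other two elementary symmetric functions are affine
    in a + b + c. A relation linear in all three can thus be solved for the sum. *)
Lemma masuda_e2 a b c : masuda_den a b c != 0 ->
  let u := masuda_u a b c in let v := masuda_v a b c in
  a * b + b * c + c * a =
  (a + b + c) * (u + v) - 3 * (u ^+ 2 - u * v + v ^+ 2).
Proof.
by move=> n0 /=; rewrite /masuda_u /masuda_v; move: n0; rewrite /masuda_den => n0; field.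
Qed.

Lemma masuda_e3 a b c : masuda_den a b c != 0 ->
  let u := masuda_u a b c in let v := masuda_v a b c in
  a * b * c = (a + b + c) * u * v - u ^+ 3 - v ^+ 3.
Proof.
by move=> n0 /=; rewrite /masuda_u /masuda_v; move: n0; rewrite /masuda_den => n0; field.
Qed.

Lemma masuda_diff a b c : masuda_den a b c != 0 ->
  (a - b) * (b - c) * (c - a) =
  (masuda_u a b c - masuda_v a b c) * masuda_den a b c.
Proof.
by move=> n0 /=; rewrite /masuda_u /masuda_v; move: n0; rewrite /masuda_den => n0; field.
Qed.

Lemma masuda_cycle a b c : masuda_den a b c != 0 ->
  [/\ masuda_den b c a = masuda_den a b c, masuda_u b c a = masuda_u a b c
    & masuda_v b c a = masuda_v a b c].
Proof.
move=> n0; have nE : masuda_den b c a = masuda_den a b c by rewrite /masuda_den; ring.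
by rewrite /masuda_u /masuda_v nE; split=> //; congr (_ / _); ring.
Qed.

Lemma masuda_morph (r : {rmorphism F -> F}) a b c :
  r (masuda_u a b c) = masuda_u (r a) (r b) (r c) /\
  r (masuda_v a b c) = masuda_v (r a) (r b) (r c).
Proof.
have r3 : r 3 = 3 by exact: rmorph_nat.
rewrite /masuda_u /masuda_v /masuda_den; move: r3; move: (3 : F) => k rk.
by split; rewrite fmorph_div !(rmorphB, rmorphD, rmorphN, rmorphM, rmorphXn) rk.
Qed.

Section Masuda.

Variables (S : F -> Prop) (a b c : F).
Hypothesis n0 : masuda_den a b c != 0.
Hypotheses (Sa : adj S (a + b + c)) (Su : adj S (masuda_u a b c)).
Hypothesis Sv : adj S (masuda_v a b c).

Lemma adjoin_masuda_cubic i : adj S (\prod_(w <- [:: a; b; c]) ('X - w%:P))`_i.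
Proof.
rewrite !big_cons big_nil coef_cubic (masuda_e2 n0) (masuda_e3 n0).
by move: Sa Su Sv; move: (masuda_u a b c) (masuda_v a b c) (a + b + c);
  move=> u v s *; adjoin_tac.
Qed.

Lemma algebraic_masuda w : w \in [:: a; b; c] -> alg S w.
Proof.
move=> wabc; apply: algebraic_root (_ : \prod_(w' <- [:: a; b; c]) ('X - w'%:P) != 0) _ _.
- by rewrite -size_poly_eq0 size_prod_XsubC.
- by rewrite root_prod_XsubC.
- by move=> i; apply/algebraic_adjoin/adjoin_masuda_cubic.
Qed.

Hypotheses (two0 : 2 != 0 :> F) (ab : a != b) (bc : b != c) (ca : c != a).

(** The sum b + c comes from the trace. The difference b - c is the square root of the discriminant,
    given by [masuda_diff], divided by (a - b)(c - a), which is minus the derivative of the cubic at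
    [a]. *)
Lemma adjoin_masuda_bc : adj (add1 S a) b /\ adj (add1 S a) c.
Proof.
have [Sa' Su' Sv'] : [/\ adj (add1 S a) (a + b + c),
    adj (add1 S a) (masuda_u a b c) & adj (add1 S a) (masuda_v a b c)].
  by split; apply: adjoin_add1.
have Sw := adjoin_add1_gen S a.
have Sn : adj (add1 S a) (masuda_den a b c).
  rewrite /masuda_den (masuda_e2 n0); move: Sa' Su' Sv'.
  by move: (masuda_u a b c) (masuda_v a b c) (a + b + c) => u v s *; adjoin_tac.
have dE : (a - b) * (c - a) =
    - (3 * a ^+ 2 - 2 * (a + b + c) * a + (a * b + b * c + c * a)) by ring.
have d0 : (a - b) * (c - a) != 0 by rewrite mulf_neq0 // subr_eq0.
have Sd : adj (add1 S a) (b - c).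
  have -> : b - c = (masuda_u a b c - masuda_v a b c) * masuda_den a b c
      / ((a - b) * (c - a)).
    by apply: (mulIf d0); rewrite divfK // -masuda_diff //; ring.
  rewrite dE (masuda_e2 n0); move: Sa' Su' Sv' Sn Sw.
  move: (masuda_u a b c) (masuda_v a b c) (a + b + c) (masuda_den a b c).
  by move=> u v s n *; adjoin_tac.
have Ss : adj (add1 S a) (b + c).
  have -> : b + c = a + b + c - a by ring.
  by move: Sa' Sw; move: (a + b + c) => s *; adjoin_tac.
have bE : b = ((b + c) + (b - c)) / 2 by field.
have cE : c = ((b + c) - (b - c)) / 2 by field.
by split; [rewrite bE | rewrite cE]; move: Ss Sd; move: (b + c) (b - c) => u v *;
  adjoin_tac.
Qed.

Lemma adjoin_fixed_cyclic f (s : {rmorphism F -> F}) :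
    (forall k, s (iota k) = iota k) -> (forall g, S g -> s g = g) ->
    s a = b -> s b = c -> s f = f ->
    adj (fun g => S g \/ set3 a b c g) f ->
  adj S f.
Proof.
move=> sK sS sa sb sf Sf.
have {}Sf : adj (add1 S a) f.
  have [Sb Sc] := adjoin_masuda_bc; have Sw := adjoin_add1_gen S a.
  by apply: adjoin_trans Sf => g [Sg|[->|->|->]] //; apply: adjoin_gen; left.
apply: (adjoin_fixed (ws := [:: a; b; c])) Sf _ _ _ _.
- by rewrite mem_head.
- by rewrite /= !inE negb_or ab bc eq_sym ca.
- exact: adjoin_masuda_cubic.
- move=> w; rewrite !inE => /or3P[/eqP->|/eqP->|/eqP->].
  + by exists idfun.
  + by exists s.
  + exists (s \o s); split=> [k|g Sg||] /=; first by rewrite !sK.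
    * by rewrite !sS.
    * by rewrite sa sb.
    * by rewrite !sf.
Qed.

End Masuda.

End CyclicDescent.

(** * The rational function field in three variables *)

Section RationalFunctionField.

Variable K : fieldType.
Local Notation F := (ratfun K).
Local Notation iota := (constF K).
Local Notation adj := (adjoin iota).

Lemma mmap_ratfun (p : {mpoly K[3]}) :
  mmap iota (fun i : 'I_3 => tri x y z i) p = FracField.tofrac p :> F.
Proof.
apply: (@mpoly_rmorph_eq _ _ _ (mmap iota (fun i : 'I_3 => tri x y z i))
  (@FracField.tofrac {mpoly K[3]})) => [c|i] /=; first by rewrite mmapC.
rewrite mmapXi; case: i => -[|[|[|//]]] i3 /=;
  by congr (FracField.tofrac 'X__); apply: val_inj.
Qed.

Lemma independent3_xyz : independent3 iota x y z.
Proof.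
by move=> p; rewrite mmap_ratfun => /eqP; rewrite tofrac_eq0 => /eqP.
Qed.

Lemma adjoin_xyz (f : F) : adj (set3 x y z) f.
Proof.
have pol (p : {mpoly K[3]}) : adj (set3 x y z) (FracField.tofrac p).
  rewrite -mmap_ratfun [p]mpolyE rmorph_sum; apply: adjoin_sum => m.
  rewrite -mul_mpolyC rmorphM /= mmapC mmapX; apply: adjoin_mul.
    exact: adjoin_base.
  rewrite /mmap1; elim/big_rec: _ => [|j g _ Sg]; first exact: adjoin1.
  by apply: adjoin_mul => //; apply/adjoin_exp/adjoin_gen/range_tri; exists j.
elim/quotW: f => r; have r0 := denom_ratioP r.
have fE : (\pi_(F) r)%qT * FracField.tofrac r.2 = FracField.tofrac r.1 :> F.
  unlock FracField.tofrac; rewrite -[LHS]FracField.pi_mul; apply/eqmodP => /=.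
  by rewrite FracField.equivfE /FracField.mulf /= !numden_Ratio ?mulf_neq0
    ?oner_neq0 ?mulr1 // mulrC.
rewrite (_ : (\pi_(F) r)%qT = FracField.tofrac r.1 / FracField.tofrac r.2); last first.
  by rewrite -fE mulfK // tofrac_eq0.
by apply: adjoin_div; apply: pol.
Qed.

End RationalFunctionField.

Lemma fixed_generated3 (T : Type) (g1 g2 g3 : T -> T) f :
  fixed (generated3 g1 g2 g3) f <-> [/\ g1 f = f, g2 f = f & g3 f = f].
Proof.
split=> [ff|[f1 f2 f3] g].
  by split; apply: ff; apply: generated_gen;
    [apply: Or31 | apply: Or32 | apply: Or33].
elim=> {g} [g [->|->|->]|//|g h _ gf _ hf|g h _ gf gK _] //=.
  by rewrite hf gf.
by rewrite -{1}gf gK.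
Qed.

Lemma adjoin_stable (K F : fieldType) (iota : {rmorphism K -> F}) (S : F -> Prop)
    (s : {rmorphism F -> F}) :
  (forall c, s (iota c) = iota c) -> (forall g, S g -> s g = g) ->
  forall f, adjoin iota S f -> s f = f.
Proof.
move=> sK sS f; elim=> {f} [c|g /sS|u v _ su _ sv|u v _ su _ sv|u _ su] //.
- by rewrite rmorphB su sv.
- by rewrite rmorphM su sv.
- by rewrite fmorphV su.
Qed.

(** * The case eps = 1 *)

Section InversionInvariant.

Variables (F : fieldType) (a : F).

(* If a = s^2 and X = (x - s)/(x + s), then x |-> a/x becomes X |-> -X, and the
   product YZ/X and its conjugates are invariant under even sign changes. The
   element below is (YZ/X - 1)/(s(YZ/X + 1)), up to sign: it lies in K(x, y, z). *)
Definition invol (x y z : F) : F :=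
  (a + y * z - x * z - x * y) / (x * y * z + a * (x - y - z)).

Variables (x y z : F).
Hypotheses (a0 : a != 0) (x0 : x != 0) (y0 : y != 0) (z0 : z != 0).
Hypothesis d1 : x * y * z + a * (x - y - z) != 0.
Hypothesis d2 : y * z * x + a * (y - z - x) != 0.
Hypothesis d3 : z * x * y + a * (z - x - y) != 0.

(** In the notation X, Y, Z above, x + a/x = 2 s (1 + X^2)/(1 - X^2), and X^2 is the product of the
    invariants ZX/Y and XY/Z. *)
Lemma invol_sum :
  (x + a / x) * (invol y z x + invol z x y) = - 2 * (1 + a * invol y z x * invol z x y).
Proof. by rewrite /invol; field; rewrite d3 d2. Qed.

(** Here x - a/x = 4 s X/(1 - X^2), and the product of the three invariants YZ/X, ZX/Y, XY/Z is XYZ.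
    So the product of the three differences is a function of the invariants, and two of the
    differences determine the third. *)
Lemma invol_diff :
  (x - a / x) * (y - a / y) * (z - a / z) *
    ((invol y z x + invol z x y) * (invol z x y + invol x y z) *
     (invol x y z + invol y z x)) =
  - 8 * ((1 - a * invol x y z ^+ 2) * (1 - a * invol y z x ^+ 2) *
         (1 - a * invol z x y ^+ 2)).
Proof. by rewrite /invol; field; rewrite x0 y0 z0 d1 d2 d3. Qed.

Lemma invol_xy : invol (a / x) (a / y) z = invol x y z.
Proof.
rewrite /invol; have -> : a / x * (a / y) * z + a * (a / x - a / y - z) =
  - a / (x * y) * (x * y * z + a * (x - y - z)) by field; rewrite y0 x0.
by field; rewrite d1 x0 y0 oppr_eq0 a0.
Qed.

Lemma invol_xz : invol (a / x) y (a / z) = invol x y z.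
Proof.
rewrite /invol; have -> : a / x * y * (a / z) + a * (a / x - y - a / z) =
  - a / (x * z) * (x * y * z + a * (x - y - z)) by field; rewrite z0 x0.
by field; rewrite ?oppr_eq0 d1 ?a0 ?x0 ?z0.
Qed.

Lemma invol_yz : invol x (a / y) (a / z) = invol x y z.
Proof.
rewrite /invol; have -> : x * (a / y) * (a / z) + a * (x - a / y - a / z) =
  a / (y * z) * (x * y * z + a * (x - y - z)) by field; rewrite z0 y0.
by field; rewrite ?oppr_eq0 d1 ?a0 ?y0 ?z0.
Qed.

End InversionInvariant.

Section Positive.

Variables (K F : fieldType) (iota : {rmorphism K -> F}) (a : K) (x y z : F).
Local Notation adj := (adjoin iota).
Hypothesis xyzI : independent3 iota x y z.
Hypothesis adjoin_gens : forall f, adj (set3 x y z) f.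
Variables t l s : {rmorphism F -> F}.
Hypotheses (two0 : 2 != 0 :> K) (a0 : a != 0).
Hypotheses (tK : forall c, t (iota c) = iota c) (lK : forall c, l (iota c) = iota c).
Hypothesis sK : forall c, s (iota c) = iota c.
Hypotheses (tx : t x = iota a / x) (ty : t y = iota a / y) (tz : t z = z).
Hypotheses (lx : l x = iota a / x) (ly : l y = y) (lz : l z = iota a / z).
Hypotheses (sx : s x = y) (sy : s y = z) (sz : s z = x).

Let A : F := iota a.
Let P1 := invol A x y z.
Let P2 := invol A y z x.
Let P3 := invol A z x y.
Let D1 : F := x * y * z + A * (x - y - z).
Let D2 : F := y * z * x + A * (y - z - x).
Let D3 : F := z * x * y + A * (z - x - y).

Lemma var_neq0 : [/\ x != 0, y != 0 & z != 0].
Proof.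
have I := xyzI.
by split; neq0_at I (idfun : {rmorphism K -> K}) (1 : K) (1 : K) (1 : K);
  apply: oner_neq0.
Qed.

Lemma invol_den_neq0 : [/\ D1 != 0, D2 != 0 & D3 != 0].
Proof.
have I := xyzI; rewrite /D1 /D2 /D3 /A; split.
- neq0_at I (idfun : {rmorphism K -> K}) (1 : K) (0 : K) (0 : K).
  by rewrite !(mulr0, subr0, mulr1, add0r).
- neq0_at I (idfun : {rmorphism K -> K}) (0 : K) (1 : K) (0 : K).
  by rewrite !(mulr0, mul0r, subr0, mulr1, add0r).
- neq0_at I (idfun : {rmorphism K -> K}) (0 : K) (0 : K) (1 : K).
  by rewrite !(mulr0, mul0r, subr0, mulr1, add0r).
Qed.

Lemma invol_cycle : [/\ s P1 = P2, s P2 = P3 & s P3 = P1].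
Proof.
have mor (r : {rmorphism F -> F}) u v w : r A = A ->
    r (invol A u v w) = invol A (r u) (r v) (r w).
  by rewrite /invol => rA; rewrite fmorph_div !(rmorphB, rmorphD, rmorphN, rmorphM) rA.
by split; rewrite /P1 /P2 /P3 mor ?sx ?sy ?sz ?sK.
Qed.

Lemma invol_sum_neq0 : [/\ P2 + P3 != 0, P3 + P1 != 0 & P1 + P2 != 0].
Proof.
have [d1 d2 d3] := invol_den_neq0; have I := xyzI.
have main : P2 + P3 != 0.
  have : (P2 + P3) * (D2 * D3) != 0.
    have -> : (P2 + P3) * (D2 * D3) = (A + z * x - y * x - y * z) * D3
        + (A + x * y - z * y - z * x) * D2.
      by rewrite /P2 /P3 /invol -/D2 -/D3; field; rewrite d2 d3.
    rewrite /D2 /D3 /A.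
    neq0_at I (idfun : {rmorphism K -> K}) (1 : K) (0 : K) (0 : K).
    have -> : (a + 0 * 1 - 0 * 1 - 0 * 0) * (0 * 1 * 0 + a * (0 - 1 - 0))
       + (a + 1 * 0 - 0 * 0 - 0 * 1) * (0 * 0 * 1 + a * (0 - 0 - 1)) = - 2 * a ^+ 2.
      by ring.
    by rewrite mulf_neq0 ?oppr_eq0 ?expf_neq0.
  by apply: contraNneq => ->; rewrite mul0r.
have [s1 s2 s3] := invol_cycle; split=> //.
- by rewrite -s2 -s3 -rmorphD fmorph_eq0.
- by rewrite -s3 -s1 -rmorphD fmorph_eq0 -s2 -s3 -rmorphD fmorph_eq0.
Qed.

Local Notation S3 := (set3 P1 P2 P3).


Lemma adjoin_invol_trace :
  [/\ adj S3 (x + A / x), adj S3 (y + A / y) & adj S3 (z + A / z)].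
Proof.
have [x0 y0 z0] := var_neq0; have [d1 d2 d3] := invol_den_neq0.
have [h1 h2 h3] := invol_sum_neq0.
have e1 := invol_sum x0 d2 d3.
have e2 := invol_sum y0 d3 d1.
have e3 := invol_sum z0 d1 d2.
have [SP1 SP2 SP3] := adjoin_set3 iota P1 P2 P3.
have AE : adj S3 A by apply: adjoin_base.
split.
- have -> : x + A / x = - 2 * (1 + A * P2 * P3) / (P2 + P3).
    by rewrite -e1 mulfK.
  by adjoin_tac.
- have -> : y + A / y = - 2 * (1 + A * P3 * P1) / (P3 + P1).
    by rewrite -e2 mulfK.
  by adjoin_tac.
- have -> : z + A / z = - 2 * (1 + A * P1 * P2) / (P1 + P2).
    by rewrite -e3 mulfK.
  by adjoin_tac.
Qed.

Lemma independent3_invol : independent3 iota P1 P2 P3.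
Proof.
have [x0 y0 z0] := var_neq0; have [Sx Sy Sz] := adjoin_invol_trace.
have alg (w : F) : w != 0 -> adj S3 (w + A / w) -> algebraic iota S3 w.
  move=> w0 Sw; apply: algebraic_sum_prod (algebraic_adjoin Sw) _.
  by rewrite mulrC divfK //; apply/algebraic_adjoin/adjoin_base.
by apply: (independent3_algebraic xyzI); apply: alg.
Qed.

Lemma sqr_var_neq : [/\ x - A / x != 0, y - A / y != 0
  & z - A / z != 0].
Proof.
have [x0 y0 z0] := var_neq0; have I := xyzI.
have sq (w : F) : w != 0 -> w ^+ 2 - A != 0 -> w - A / w != 0.
  move=> w0; apply: contraNneq => w2.
  have -> : w ^+ 2 - A = w * (w - A / w) by field.
  by rewrite w2 mulr0.
by split; apply: sq => //; rewrite /A;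
  neq0_at I (idfun : {rmorphism K -> K}) (0 : K) (0 : K) (0 : K);
  rewrite expr0n add0r oppr_eq0.
Qed.

Lemma adjoin_invol_xy f : adj (add1 (add1 S3 x) y) f.
Proof.
have [x0 y0 z0] := var_neq0; have [d1 d2 d3] := invol_den_neq0.
have [qx qy qz] := sqr_var_neq; have [h1 h2 h3] := invol_sum_neq0.
have [SP1 SP2 SP3] := adjoin_set3 iota P1 P2 P3.
have up g : adj S3 g -> adj (add1 (add1 S3 x) y) g.
  by move=> Sg; do 2!apply: adjoin_add1.
have Ax : adj (add1 (add1 S3 x) y) x by apply/adjoin_add1/adjoin_add1_gen.
have Ay : adj (add1 (add1 S3 x) y) y by apply: adjoin_add1_gen.
have AA : adj (add1 (add1 S3 x) y) A by apply: adjoin_base.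
have [tx' ty' tz'] := adjoin_invol_trace.
suff Az : adj (add1 (add1 S3 x) y) z.
  by apply: adjoin_trans (adjoin_gens f) => g [] ->.
have zE : z - A / z = - 8 * ((1 - A * P1 ^+ 2) * (1 - A * P2 ^+ 2) *
   (1 - A * P3 ^+ 2)) / (((P2 + P3) * (P3 + P1) * (P1 + P2)) *
   ((x - A / x) * (y - A / y))).
  rewrite -(invol_diff x0 y0 z0 d1 d2 d3) -/P1 -/P2 -/P3.
  move: qx qy h1 h2 h3; move: (x - A / x) (y - A / y) (z - A / z) (P2 + P3) (P3 + P1) (P1 + P2).
  by move=> u v w r1 r2 r3 *; field; apply/and5P.
have two : 2 != 0 :> F by rewrite -(rmorph_nat iota) fmorph_eq0.
have -> : z = ((z + A / z) + (z - A / z)) / 2 by field; rewrite ?two ?z0.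
rewrite zE; move: (up _ tz') (up _ SP1) (up _ SP2) (up _ SP3) Ax Ay AA.
move: (z + A / z) P1 P2 P3 => w p1 p2 p3 *.
by adjoin_tac.
Qed.

Lemma invol_fixed : [/\ t P1 = P1, t P2 = P2 & t P3 = P3] /\
  [/\ l P1 = P1, l P2 = P2 & l P3 = P3].
Proof.
have [x0 y0 z0] := var_neq0; have [d1 d2 d3] := invol_den_neq0.
have A0 : A != 0 by rewrite fmorph_eq0.
have mor (r : {rmorphism F -> F}) u v w : r A = A ->
    r (invol A u v w) = invol A (r u) (r v) (r w).
  by rewrite /invol => rA; rewrite fmorph_div !(rmorphB, rmorphD, rmorphN, rmorphM) rA.
split; split; rewrite /P1 /P2 /P3 mor ?tx ?ty ?tz ?lx ?ly ?lz ?tK ?lK //.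
- exact: invol_xy.
- exact: invol_xz.
- exact: invol_yz.
- exact: invol_xz.
- exact: invol_yz.
- exact: invol_xy.
Qed.

Lemma rational_positive : rational iota (fixed (generated3 t l s)).
Proof.
have two : 2 != 0 :> F by rewrite -(rmorph_nat iota) fmorph_eq0.
have [x0 y0 z0] := var_neq0; have [qx qy qz] := sqr_var_neq.
have [[t1 t2 t3] [l1 l2 l3]] := invol_fixed; have [s1 s2 s3] := invol_cycle.
have I := independent3_invol.
have n0 : masuda_den P1 P2 P3 != 0.
  rewrite /masuda_den; neq0_at I (idfun : {rmorphism K -> K}) (1 : K) (0 : K) (0 : K).
  by rewrite !(mulr0, mul0r, addr0) subr0 expr1n oner_eq0.
have [p12 p23 p31] : [/\ P1 != P2, P2 != P3 & P3 != P1].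
  by split; rewrite -subr_eq0;
    [neq0_at I (idfun : {rmorphism K -> K}) (1 : K) (0 : K) (0 : K)
    |neq0_at I (idfun : {rmorphism K -> K}) (0 : K) (1 : K) (0 : K)
    |neq0_at I (idfun : {rmorphism K -> K}) (0 : K) (0 : K) (1 : K)];
    rewrite subr0 oner_eq0.
pose e := P1 + P2 + P3; pose u := masuda_u P1 P2 P3; pose v := masuda_v P1 P2 P3.
have [Se Su Sv] := adjoin_set3 iota e u v.
have Sabc w (wP : w \in [:: P1; P2; P3]) : algebraic iota (set3 e u v) w.
  exact: (algebraic_masuda n0 Se Su Sv wP).
have Ie : independent3 iota e u v.
  by apply: (independent3_algebraic I); apply: Sabc; rewrite !inE eqxx ?orbT.
have muE (r : {rmorphism F -> F}) := masuda_morph r P1 P2 P3.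
have tS g : set3 e u v g -> t g = g.
  by have [tu tv] := muE t; case=> ->; rewrite ?tu ?tv /e ?rmorphD t1 t2 t3.
have lS g : set3 e u v g -> l g = g.
  by have [lu lv] := muE l; case=> ->; rewrite ?lu ?lv /e ?rmorphD l1 l2 l3.
have sS g : set3 e u v g -> s g = g.
  have [su sv] := muE s; have [_ cu cv] := masuda_cycle n0.
  case=> ->; rewrite ?su ?sv ?rmorphD s1 s2 s3 //.
  by rewrite /e; ring.
apply: (rational3 Ie) => f; rewrite fixed_generated3; split; last first.
  by move=> Sf; split; [apply: adjoin_stable tK tS _ Sf | apply: adjoin_stable lK lS _ Sf
    | apply: adjoin_stable sK sS _ Sf].
case=> tf lf sf.
have S3t g : S3 g -> t g = g by case=> ->.
have S3l g : S3 g -> l g = g by case=> ->.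
have tr (w : F) : w != 0 -> w * (A / w) = A by move=> w0; rewrite mulrC divfK.
have [Tx Ty Tz] := adjoin_invol_trace.
(* Each involution moves one step of the tower: t o l fixes [x] and sends [y] to A/y; then t sends
   [x] to A/x. *)
have f2 : adj (add1 S3 x) f.
  apply: (@adjoin_fixed_quadratic _ _ _ _ y (A / y) _ (t \o l)) (adjoin_invol_xy f) _ _ _ _.
  - exact: adjoin_add1.
  - by rewrite tr //; apply: adjoin_base.
  - by rewrite -subr_eq0.
  - by move=> c /=; rewrite lK tK.
  - move=> g [Sg|->] /=; first by rewrite S3l // S3t.
    by rewrite lx fmorph_div tK tx invf_div mulrC divfK // fmorph_eq0.
  - by rewrite /= ly ty.
  - by rewrite /= lf tf.
have f3 : adj S3 f.
  apply: (@adjoin_fixed_quadratic _ _ _ _ x (A / x) _ t) f2 _ _ _ _ => //.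
  - by rewrite tr //; apply: adjoin_base.
  - by rewrite -subr_eq0.
apply: (adjoin_fixed_cyclic n0 Se Su Sv two p12 p23 p31 sK sS s1 s2 sf).
by apply: adjoin_mono f3 => g; right.
Qed.

End Positive.

(** * The quotient by sigma when -1 is a square *)

Section SqrtMinusOne.

Variables (K F : fieldType) (iota : {rmorphism K -> F}) (d i : K).
Local Notation adj := (adjoin iota).
Local Notation alg := (algebraic iota).
Let D : F := iota d.
Let I : F := iota i.
Hypotheses (two0 : 2 != 0 :> K) (d0 : d != 0) (i2 : i ^+ 2 = -1).

Variables (R0 R1 R2 W : F) (s : {rmorphism F -> F}).
Hypothesis RI : independent3 iota R0 R1 R2.
Hypothesis W2 :
  W ^+ 2 + (R0 * R1 * R2 / D) ^+ 2 = R0 ^+ 2 + R1 ^+ 2 + R2 ^+ 2 + 2 * D.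
Hypothesis sK : forall c, s (iota c) = iota c.
Hypotheses (s0 : s R0 = R1) (s1 : s R1 = R2) (s2 : s R2 = R0) (sW : s W = W).

(* Over K(i) the equation factors as g (W - iQ) = ..., and for fixed g it becomes
   a Markov cubic surface with an orbit of three skew lines. Projecting from the
   lines of another orbit gives the f_k, which satisfy a single symmetric relation
   linear in each of them. *)
Let g : F := W + I * (R0 * R1 * R2 / D).
Let X0 : F := g * R0 - I * D.
Let X1 : F := g * R1 - I * D.
Let X2 : F := g * R2 - I * D.
Let c : F := D - g ^+ 2.
Let f0 : F := (X1 - X2 + c) / X0.
Let f1 : F := (X2 - X0 + c) / X1.
Let f2 : F := (X0 - X1 + c) / X2.

Let two : 2 != 0 :> F. Proof. by rewrite -(rmorph_nat iota) fmorph_eq0. Qed.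
Let Dn : D != 0. Proof. by rewrite fmorph_eq0. Qed.
Let I2 : I ^+ 2 = -1. Proof. by rewrite -rmorphXn i2 rmorphN rmorph1. Qed.
Let In : I != 0.
Proof. by have := oner_neq0 F; rewrite -oppr_eq0 -I2 expf_eq0. Qed.

Lemma markov_g : g ^+ 2 = R0 ^+ 2 + R1 ^+ 2 + R2 ^+ 2 + 2 * D
  + 2 * I * g * (R0 * R1 * R2 / D).
Proof.
rewrite -W2 /g; move: (R0 * R1 * R2 / D) => Q.
by ring: I2.
Qed.

Lemma markov_s : s g = g /\ [/\ s X0 = X1, s X1 = X2 & s X2 = X0].
Proof.
have sg : s g = g.
  rewrite /g rmorphD sW rmorphM fmorph_div !rmorphM !sK s0 s1 s2; congr (_ + _ * (_ / _)).
  by ring.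
by split=> //; split; rewrite /X0 /X1 /X2 rmorphB !rmorphM !sK ?sg ?s0 ?s1 ?s2.
Qed.

Lemma markov_g_neq0 : g != 0.
Proof.
have: g * (W - I * (R0 * R1 * R2 / D)) = R0 ^+ 2 + R1 ^+ 2 + R2 ^+ 2 + 2 * D.
  by rewrite -W2 /g; move: (R0 * R1 * R2 / D) => Q; ring: I2.
apply: contra_eq_neq => ->; rewrite mul0r eq_sym /D.
neq0_at RI (idfun : {rmorphism K -> K}) (0 : K) (0 : K) (0 : K).
by rewrite expr0n !add0r mulf_neq0.
Qed.

(** If X0 = 0, then g = I D / R0, and substituting this in [markov_g] leaves a polynomial relation
    among the R_j, whose value at the origin is D^2. *)
Lemma markov_X_neq0 : [/\ X0 != 0, X1 != 0 & X2 != 0].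
Proof.
have [_ [sX0 sX1 _]] := markov_s.
suff X0n : X0 != 0 by rewrite -sX1 -sX0 !fmorph_eq0.
have : R0 ^+ 2 * (R0 ^+ 2 + R1 ^+ 2 + R2 ^+ 2 + 2 * D - 2 * R1 * R2) + D ^+ 2 != 0.
  rewrite /D; neq0_at RI (idfun : {rmorphism K -> K}) (0 : K) (0 : K) (0 : K).
  by rewrite [0 ^+ 2]expr0n mul0r add0r expf_neq0.
apply: contraNneq => X0z; have gR : g * R0 = I * D by apply/eqP; rewrite -subr_eq0 -/X0 X0z.
have -> : R0 ^+ 2 + R1 ^+ 2 + R2 ^+ 2 + 2 * D = g ^+ 2 - 2 * I * g * (R0 * R1 * R2 / D).
  by rewrite markov_g; ring.
have -> : g ^+ 2 - 2 * I * g * (R0 * R1 * R2 / D) =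
    g ^+ 2 - 2 * I * (g * R0) * (R1 * R2 / D) by ring.
have -> : R0 ^+ 2 * (g ^+ 2 - 2 * I * (g * R0) * (R1 * R2 / D) - 2 * R1 * R2) =
    (g * R0) ^+ 2 - R0 ^+ 2 * (2 * I * (g * R0) * (R1 * R2 / D) + 2 * R1 * R2) by ring.
by rewrite gR; apply/eqP; field: I2; rewrite Dn.
Qed.

(** At X0 = 0 this reads (X1 - X2)^2 = c^2: the cubic surface contains the line X0 = X1 - X2 + c =
    0, from which [f0] projects. *)
Lemma markov_X : 2 * I / D * (X0 * X1 * X2) =
  c ^+ 2 - (X0 ^+ 2 + X1 ^+ 2 + X2 ^+ 2) + 2 * (X0 * X1 + X1 * X2 + X2 * X0).
Proof.
apply/eqP; rewrite -subr_eq0; apply/eqP.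
transitivity (g ^+ 2 * (R0 ^+ 2 + R1 ^+ 2 + R2 ^+ 2 + 2 * D
  + 2 * I * g * (R0 * R1 * R2 / D) - g ^+ 2)); last by rewrite -markov_g subrr mulr0.
by rewrite /X0 /X1 /X2 /c; move: g => g'; field: I2; rewrite Dn.
Qed.

Lemma markov_f : f0 * f1 * f2 + f0 + f1 + f2 = 2 * I * c / D.
Proof.
have [n0 n1 n2] := markov_X_neq0.
have -> : 2 * I * c / D = c * (2 * I / D * (X0 * X1 * X2)) / (X0 * X1 * X2).
  by move: n0 n1 n2; move: X0 X1 X2 c => *; field; apply/and4P.
rewrite markov_X /f0 /f1 /f2; move: n0 n1 n2; move: X0 X1 X2 c => x y z e *.
by field; apply/and3P.
Qed.

(** Cramer's rule for the system f0 X0 - X1 + X2 = c and its cyclic images, whose determinant is f0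
    f1 f2 + f0 + f1 + f2. *)
Lemma markov_det : [/\ (f0 * f1 * f2 + f0 + f1 + f2) * X0 = c * (f1 * f2 + f2 - f1 + 3),
  (f0 * f1 * f2 + f0 + f1 + f2) * X1 = c * (f2 * f0 + f0 - f2 + 3) &
  (f0 * f1 * f2 + f0 + f1 + f2) * X2 = c * (f0 * f1 + f1 - f0 + 3)].
Proof.
have [n0 n1 n2] := markov_X_neq0; rewrite /f0 /f1 /f2.
by split; move: n0 n1 n2; move: X0 X1 X2 c => x y z e *; field; apply/and3P.
Qed.

(** If c = 0, then g^2 = D and the equation becomes linear in g; squaring it leaves a polynomial
    relation among the R_j. *)
Lemma markov_c_neq0 : c != 0.
Proof.
have : (R0 ^+ 2 + R1 ^+ 2 + R2 ^+ 2 + D) ^+ 2 * D + 4 * (R0 * R1 * R2) ^+ 2 != 0.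
  rewrite /D; neq0_at RI (idfun : {rmorphism K -> K}) (0 : K) (0 : K) (0 : K).
  rewrite [0 ^+ 2]expr0n !add0r !mul0r [0 ^+ 2]expr0n mulr0 addr0.
  by rewrite mulf_neq0 ?expf_neq0.
apply: contraNneq => c0; have gD : g ^+ 2 = D by apply/esym/eqP; rewrite -subr_eq0 -/c c0.
have -> : R0 ^+ 2 + R1 ^+ 2 + R2 ^+ 2 + D = - (2 * I * g * (R0 * R1 * R2 / D)).
  have -> : R0 ^+ 2 + R1 ^+ 2 + R2 ^+ 2 + D =
    g ^+ 2 - D - 2 * I * g * (R0 * R1 * R2 / D) by rewrite markov_g; ring.
  by rewrite gD; ring.
by move: g gD => g' gD; apply/eqP; field: I2 gD; rewrite Dn.
Qed.

Lemma markov_R : [/\ R0 = - (I * D) / (2 * g) * (f1 * f2 + f2 - f1 + 1),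
  R1 = - (I * D) / (2 * g) * (f2 * f0 + f0 - f2 + 1) &
  R2 = - (I * D) / (2 * g) * (f0 * f1 + f1 - f0 + 1)].
Proof.
have cn := markov_c_neq0; have gn := markov_g_neq0.
have X_R r x n : x = g * r - I * D ->
    (f0 * f1 * f2 + f0 + f1 + f2) * x = c * n ->
    r = - (I * D) / (2 * g) * (n - 2).
  rewrite markov_f => xE nE.
  have -> : r = (x + I * D) / g by rewrite xE; field.
  have -> : x = 2 * I * c / D * x * D / (2 * I * c) by field; rewrite Dn cn In two.
  rewrite nE; move: g gn c cn => g' gn c' cn; field: I2.
  by rewrite ?Dn ?cn ?In ?two ?gn.
have [e0 e1 e2] := markov_det.
split; first by rewrite (X_R _ _ _ (erefl _) e0); congr (_ * _); ring.
- by rewrite (X_R _ _ _ (erefl _) e1); congr (_ * _); ring.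
- by rewrite (X_R _ _ _ (erefl _) e2); congr (_ * _); ring.
Qed.

Lemma markov_f_s : [/\ s f0 = f1, s f1 = f2 & s f2 = f0].
Proof.
have [sg [sX0 sX1 sX2]] := markov_s.
have sc : s c = c by rewrite /c rmorphB rmorphXn sg sK.
by split; rewrite /f0 /f1 /f2 fmorph_div rmorphD sc rmorphB ?sX0 ?sX1 ?sX2.
Qed.

(** By [markov_f], c = D - g^2 is a polynomial in the f_k, so g is algebraic over them; [markov_R]
    then gives the R_k. *)
Lemma independent3_markov : independent3 iota f0 f1 f2.
Proof.
have [S0 S1 S2] := adjoin_set3 iota f0 f1 f2; set S := set3 _ _ _ in S0 S1 S2.
have SI : adj S I by apply: adjoin_base.
have SD : adj S D by apply: adjoin_base.
have Sg : alg S g.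
  apply: algebraic_sqrt; apply: algebraic_adjoin.
  have -> : g ^+ 2 = D + I * D * (f0 * f1 * f2 + f0 + f1 + f2) / 2.
    by rewrite markov_f /c; move: g => g'; field: I2; rewrite Dn two.
  by adjoin_tac.
have SR r q : r = - (I * D) / (2 * g) * q -> adj S q -> alg S r.
  move=> -> Sq; apply: algebraicM; last exact: algebraic_adjoin.
  apply: algebraicM; first by apply: algebraic_adjoin; adjoin_tac.
  by apply/algebraicV/algebraicM => //; apply: algebraic_adjoin; adjoin_tac.
have [e0 e1 e2] := markov_R.
by apply: (independent3_algebraic RI); [apply: SR e0 _ | apply: SR e1 _ | apply: SR e2 _];
  adjoin_tac.
Qed.

Lemma rational_markov (L : F -> Prop) :
  (forall f, L f <-> adj (add1 (set3 R0 R1 R2) W) f /\ s f = f) -> rational iota L.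
Proof.
move=> LE; have fI := independent3_markov.
have n0 : masuda_den f0 f1 f2 != 0.
  rewrite /masuda_den; neq0_at fI (idfun : {rmorphism K -> K}) (1 : K) (0 : K) (0 : K).
  by rewrite !(mulr0, mul0r, addr0) subr0 expr1n oner_eq0.
have [f01 f12 f20] : [/\ f0 != f1, f1 != f2 & f2 != f0].
  by split; rewrite -subr_eq0;
    [neq0_at fI (idfun : {rmorphism K -> K}) (1 : K) (0 : K) (0 : K)
    |neq0_at fI (idfun : {rmorphism K -> K}) (0 : K) (1 : K) (0 : K)
    |neq0_at fI (idfun : {rmorphism K -> K}) (0 : K) (0 : K) (1 : K)];
    rewrite subr0 oner_eq0.
pose u := masuda_u f0 f1 f2; pose v := masuda_v f0 f1 f2; pose S := set3 g u v.
have [Sg Su Sv] := adjoin_set3 iota g u v; rewrite -/S in Sg Su Sv.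
have uv : u * v + 1 != 0.
  have : masuda_den f0 f1 f2 ^+ 2 * (u * v + 1) != 0.
    have -> : masuda_den f0 f1 f2 ^+ 2 * (u * v + 1) =
      (f0 * f1 ^+ 2 + f1 * f2 ^+ 2 + f2 * f0 ^+ 2 - 3 * (f0 * f1 * f2)) *
      (f0 ^+ 2 * f1 + f1 ^+ 2 * f2 + f2 ^+ 2 * f0 - 3 * (f0 * f1 * f2)) +
      masuda_den f0 f1 f2 ^+ 2.
      by rewrite /u /v /masuda_u /masuda_v; move: (masuda_den _ _ _) n0 => n nn; field.
    rewrite /masuda_den.
    neq0_at fI (idfun : {rmorphism K -> K}) (1 : K) (0 : K) (0 : K).
    rewrite (_ : _ + _ = 1) ?oner_eq0 //; ring.
  by rewrite mulf_eq0 negb_or => /andP[].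
(* [masuda_e3] turns [markov_f] into a linear equation for the sum, with leading coefficient u v +
   1. *)
have Se : adj S (f0 + f1 + f2).
  have e3 := masuda_e3 n0; rewrite -/u -/v /= in e3.
  have -> : f0 + f1 + f2 = (2 * I * c / D + u ^+ 3 + v ^+ 3) / (u * v + 1).
    apply: (mulIf uv); rewrite divfK // -markov_f e3.
    by ring.
  have SD : adj S D by apply: adjoin_base.
  have SI : adj S I by apply: adjoin_base.
  by rewrite /c; adjoin_tac.
have Sf w (wP : w \in [:: f0; f1; f2]) : alg S w.
  exact: (algebraic_masuda n0 Se Su Sv wP).
have SI3 : independent3 iota g u v.
  by apply: (independent3_algebraic fI); apply: Sf; rewrite !inE eqxx ?orbT.
have [sf0 sf1 sf2] := markov_f_s; have [sg _] := markov_s.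
have sS h : S h -> s h = h.
  have [su sv] := masuda_morph s f0 f1 f2; have [_ cu cv] := masuda_cycle n0.
  by case=> -> //; rewrite /u /v ?su ?sv sf0 sf1 sf2.
apply: (rational3 SI3) => f; rewrite LE; split=> [[Sf' sf]|Sf'].
  apply: (adjoin_fixed_cyclic n0 Se Su Sv two f01 f12 f20 sK sS sf0 sf1 sf).
  set T := (fun h => _); have TS h : adj S h -> adj T h.
    by apply: adjoin_mono => h' ?; left.
  have TF h : set3 f0 f1 f2 h -> adj T h by move=> ?; apply: adjoin_gen; right.
  have [T0 T1 T2] : [/\ adj T f0, adj T f1 & adj T f2].
    by split; apply: TF; [apply: Or31 | apply: Or32 | apply: Or33].
  have TI : adj T I by apply: adjoin_base.
  have TD : adj T D by apply: adjoin_base.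
  have Tg := TS _ Sg; have [e0 e1 e2] := markov_R.
  have [TR0 TR1 TR2] : [/\ adj T R0, adj T R1 & adj T R2].
    by split; [rewrite e0 | rewrite e1 | rewrite e2];
      adjoin_tac.
  apply: adjoin_trans Sf' => h [[->|->|->]|->] //.
  have -> : W = g - I * (R0 * R1 * R2 / D) by rewrite /g; ring.
  by adjoin_tac.
split; last exact: adjoin_stable sK sS _ Sf'.
have [A0 A1 A2] := adjoin_set3 iota R0 R1 R2.
set T := add1 _ _; have {A0 A1 A2}[A0 A1 A2] : [/\ adj T R0, adj T R1 & adj T R2].
  by split; apply: adjoin_add1.
have AW : adj T W by apply: adjoin_add1_gen.
have AI : adj T I by apply: adjoin_base.
have AD : adj T D by apply: adjoin_base.
have Ag : adj T g by rewrite /g; adjoin_tac.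
have [F0 F1 F2] : [/\ adj T f0, adj T f1 & adj T f2].
  by split; rewrite /f0 /f1 /f2 /X0 /X1 /X2 /c; adjoin_tac.
apply: adjoin_trans Sf' => h; case=> -> //; rewrite /u /v /masuda_u /masuda_v /masuda_den;
  by adjoin_tac.
Qed.

End SqrtMinusOne.

(** * The quotient by sigma for the circle with d = 1 *)

Section ConicIdentities.

Variable F : fieldType.

(* With p = (u + v) / 2, e = (u - v) / 2 for Masuda's u, v of (R0, R1, R2) and
   h = R0 + R1 + R2 - R0 R1 R2, the equation of W becomes a conic in (W, h) over
   K(p, e); its coefficients are polynomials in [cb p e = 1 - u v], [cB p e], [cJ p e]. *)
Definition cb (p e : F) : F := 1 - p ^+ 2 + e ^+ 2.
Definition cJ (p e : F) : F :=
  4 * p ^+ 2 * (1 + 4 * e ^+ 2) + cb p e ^+ 2 + 8 * cb p e * e ^+ 2.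
Definition cB (p e : F) : F := p * (2 + 4 * e ^+ 2 - cb p e).

(** The squares cancel in q^2 - (q - h)^2, which leaves an expression linear in q, itself affine in
    h. This is what [h] gains over the sum q. *)
Lemma conic_identity (p e q h : F) :
    h = q * cb p e + 2 * p ^+ 3 + 6 * p * e ^+ 2 ->
  cb p e * (2 + q ^+ 2 - 2 * (2 * p * q - 3 * (p ^+ 2 + 3 * e ^+ 2)) - (q - h) ^+ 2) =
  (2 - cb p e) * h ^+ 2 - 4 * cB p e * h + 2 * cJ p e.
Proof. by move=> ->; rewrite /cJ /cB /cb; ring. Qed.

Definition n12 (t s : F) : F :=
  ((t * s - t ^+ 2 - 8) ^+ 2 - 4 * (t ^+ 2 + 16)) *
  ((s ^+ 2 + t ^+ 2 + 20) ^+ 2 - 16 * (t ^+ 2 + 16)).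
Definition cmu (t s : F) : F := (s - t) ^+ 2 + 12.

(* (t, s) are the coordinates t = (p^2 + 3 e^2 - 1) / e and s = ((p - 1)^2 + 3 e^2) / e
   on the (p, e)-plane, and T is the square of W / h. *)
Lemma conic_discriminant (t s T : F) : cmu t s != 0 -> t != 0 -> s != 0 -> 2 != 0 :> F ->
  let p := (t ^+ 2 - s ^+ 2 + 12) / cmu t s in
  let e := 4 * s / cmu t s in
  cB p e ^+ 2 + cJ p e * ((T + 1) * cb p e / 2 - 1) =
  e ^+ 4 * (t ^+ 2 + 16 - n12 t s / (32 * t * s ^+ 3) * (T - 1)).
Proof.
move=> m0 t0 s0 two /=.
have n32 : 32 != 0 :> F by rewrite (_ : 32 = 2 ^+ 5) ?expf_neq0 //; ring.
rewrite /cJ /cB /cb /n12; move: m0; rewrite /cmu => m0.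
by field; rewrite n32 t0 s0 m0 two.
Qed.

End ConicIdentities.

Section ConicNorm.

Variables (K F : fieldType) (iota : {rmorphism K -> F}).
Local Notation adj := (adjoin iota).
Local Notation alg := (algebraic iota).

Variables t s T y h : F.
Hypothesis two0 : 2 != 0 :> K.
Hypothesis tshI : independent3 iota t s h.
Let w : F := t ^+ 2 + 16.
Let m : F := 32 * t * s ^+ 3.
Let r : F := 8 - t * s.
Hypothesis T1 : T != 1.
Hypothesis y2 : y ^+ 2 = w - n12 t s / m * (T ^+ 2 - 1).
Hypothesis adjoin_h : adj (fun g => g \in [:: t; s; T; y]) h.

(* The two factors of [n12 t s], and [n3], are norms from F(sqrt w); [nre + nim sqrt w]
   is the product of the corresponding elements. Dividing by it brings the conic to the
   form X^2 - r^2 = w (Y^2 - 4 + t^2), in which r is rational in t, Y and X - r. *)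
Let n3 : F := (cmu t s + t * s) ^+ 2 - w * s ^+ 2.
Let nn : F := n12 t s * n3.
Let n12re : F :=
  (t * s - t ^+ 2 - 8) * (s ^+ 2 + t ^+ 2 + 20) + 8 * w.
Let n12im : F := 4 * (t * s - t ^+ 2 - 8) + 2 * (s ^+ 2 + t ^+ 2 + 20).
Let nre : F := n12re * (cmu t s + t * s) + w * n12im * s.
Let nim : F := n12re * s + n12im * (cmu t s + t * s).
Let k : F := m / (T - 1).
Let A0 : F := k * w - n12 t s.
Let B0 : F := k * y.
Definition conic_X : F := (A0 * nre - w * B0 * nim) / nn.
Definition conic_Y : F := (B0 * nre - A0 * nim) / nn.
Definition conic_Z : F := conic_X - r.
Local Notation X := conic_X.
Local Notation Y := conic_Y.
Local Notation Z := conic_Z.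

Let two : 2 != 0 :> F. Proof. by rewrite -(rmorph_nat iota) fmorph_eq0. Qed.

Lemma conic_nre_nim : nre ^+ 2 - w * nim ^+ 2 = nn.
Proof. by rewrite /nre /nim /nn /n12re /n12im /n12 /n3 /w; move: (cmu t s) => M; ring. Qed.

(** What the coordinates (t, s) achieve: up to the norm [n3], this value is r^2 - (4 - t^2) w with r
    of degree 1 in s. *)
Lemma conic_norm_q : n12 t s + m * w = (r ^+ 2 - (4 - t ^+ 2) * w) * n3.
Proof. by rewrite /n12 /n3 /m /w /r /cmu; ring. Qed.

Lemma conic_ts_neq0 : [/\ t != 0, s != 0, w != 0 & nn != 0].
Proof.
split.
- by neq0_at tshI (idfun : {rmorphism K -> K}) (1 : K) (0 : K) (0 : K); rewrite oner_eq0.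
- by neq0_at tshI (idfun : {rmorphism K -> K}) (0 : K) (1 : K) (0 : K); rewrite oner_eq0.
- rewrite /w; neq0_at tshI (idfun : {rmorphism K -> K}) (0 : K) (0 : K) (0 : K).
  by rewrite (_ : _ + _ = 2 ^+ 4) ?expf_neq0 //; ring.
- rewrite /nn /n12 /n3 /cmu /w.
  (* At t = 2, s = 0 the three factors are powers of 2, hence nonzero in K; at t = s = 0 the first
     one would vanish. *)
  neq0_at tshI (idfun : {rmorphism K -> K}) (2 : K) (0 : K) (0 : K).
  by rewrite (_ : _ * _ = 2 ^+ 22) ?expf_neq0 //; ring.
Qed.

Lemma conic_k : [/\ k != 0, T = 1 + m / k & y = B0 / k].
Proof.
have [t0 s0 _ _] := conic_ts_neq0.
have m0 : m != 0.
  by rewrite /m (_ : 32 = 2 ^+ 5) ?mulf_neq0 ?expf_neq0 //; ring.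
have T0 : T - 1 != 0 by rewrite subr_eq0.
have k0 : k != 0 by rewrite /k mulf_neq0 // invr_eq0.
by split=> //; [rewrite /k; field; rewrite m0 T0 | rewrite /B0; field].
Qed.

(** The conic meets T = 1 where y^2 = w. The substitution T = 1 + m / k turns its equation into a
    formula for the norm of A0 + B0 sqrt w, which by [conic_norm_q] is [nn] times the right-hand
    side; X + Y sqrt w is the quotient by nre + nim sqrt w. *)
Lemma conic_XY : X ^+ 2 - w * Y ^+ 2 = r ^+ 2 - (4 - t ^+ 2) * w.
Proof.
have [k0 TE yE] := conic_k; have [t0 s0 _ nn0] := conic_ts_neq0.
have m0 : m != 0.
  by rewrite /m (_ : 32 = 2 ^+ 5) ?mulf_neq0 ?expf_neq0 //; ring.
have AB : A0 ^+ 2 - w * B0 ^+ 2 = n12 t s * (n12 t s + m * w).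
  rewrite /B0 exprMn y2 /A0 TE; move: k k0 m m0 (n12 t s) w => k' k0 m' m0 n w'.
  by field; rewrite k0.
rewrite conic_norm_q in AB.
have : nn * (X ^+ 2 - w * Y ^+ 2) = nn * (r ^+ 2 - (4 - t ^+ 2) * w).
  transitivity ((A0 ^+ 2 - w * B0 ^+ 2) * (nre ^+ 2 - w * nim ^+ 2) / nn).
    by rewrite /X /Y; move: nn nn0 A0 B0 nre nim w => n n0 *; field.
  by rewrite AB conic_nre_nim {1 2}/nn mulfK // /nn; ring.
by apply: mulfI.
Qed.

Lemma conic_A0B0 : A0 = X * nre + w * Y * nim /\ B0 = X * nim + Y * nre.
Proof.
have [_ _ _ nn0] := conic_ts_neq0; have nE := conic_nre_nim.
by split; [apply: (mulfI nn0) | apply: (mulfI nn0)]; rewrite -{1}nE /X /Y;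
  move: nn nn0 A0 B0 nre nim w {nE} => n n0 *; field.
Qed.

Lemma conic_inverse S : adj S t -> adj S s -> adj S X -> adj S Y -> 
  [/\ adj S T, adj S y & adj S h].
Proof.
move=> St Ss SX SY; have [_ _ w0 _] := conic_ts_neq0.
have [k0 TE yE] := conic_k; have [A0E B0E] := conic_A0B0.
have Smu : adj S (cmu t s) by rewrite /cmu; adjoin_tac.
have Sw : adj S w by rewrite /w; adjoin_tac.
have Sn12 : adj S (n12 t s) by rewrite /n12; adjoin_tac.
have Sre : adj S nre by rewrite /nre /n12re /n12im; adjoin_tac.
have Sim : adj S nim by rewrite /nim /n12re /n12im; adjoin_tac.
have SA : adj S A0 by rewrite A0E; adjoin_tac.
have SB : adj S B0 by rewrite B0E; adjoin_tac.
have Sk : adj S k.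
  have -> : k = (A0 + n12 t s) / w by rewrite /A0; field.
  by adjoin_tac.
have ST : adj S T by rewrite TE /m; adjoin_tac.
have Sy : adj S y by rewrite yE; adjoin_tac.
split=> //; apply: adjoin_trans adjoin_h => g.
by rewrite !inE => /or4P[] /eqP->.
Qed.

(** If Z = 0, then Y^2 = 4 - t^2, so Y is algebraic over K(t). As t, s, X, Y generate h, this would
    make h algebraic over K(t, s). *)
Lemma conic_Z_neq0 : Z != 0.
Proof.
apply/negP => /eqP Z0; have [t0 _ w0 _] := conic_ts_neq0.
have Xr : X = r by apply/eqP; rewrite -subr_eq0 -/Z Z0.
have Y2 : Y ^+ 2 = 4 - t ^+ 2.
  apply: (mulfI w0); rewrite (_ : w * Y ^+ 2 = X ^+ 2 - (X ^+ 2 - w * Y ^+ 2)); last by ring.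
  by rewrite conic_XY Xr; ring.
have [St Ss _] := adjoin_set3 iota t s s.
have aY : alg (set3 t s s) Y.
  by apply/algebraic_sqrt/algebraic_adjoin; rewrite Y2; adjoin_tac.
have [_ _ Sh] : [/\ adj (add1 (set3 t s s) Y) T, adj (add1 (set3 t s s) Y) y
    & adj (add1 (set3 t s s) Y) h].
  have [St' Ss'] : adj (add1 (set3 t s s) Y) t /\ adj (add1 (set3 t s s) Y) s.
    by split; apply: adjoin_add1.
  by apply: conic_inverse => //; [rewrite Xr /r; adjoin_tac | apply: adjoin_add1_gen].
(* The contradiction takes the form of an independent triple with a repeated entry: the difference
   of the last two variables vanishes there, but not at (0, 1, 0). *)
have I : independent3 iota t s s.
  apply: (independent3_algebraic tshI); [exact: algebraic_adjoin | exact: algebraic_adjoin |].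
  apply: algebraic_adjoin_closed Sh => g [Sg|->] //.
  by apply/algebraic_adjoin/adjoin_gen.
have := @independent3_neq0 _ _ iota t s s (Padd (Pvar 1) (Popp (Pvar 2))) _
  (idfun : {rmorphism K -> K}) 0 1 0 I.
by rewrite /= subr0 subrr eqxx => /(_ (oner_neq0 _)).
Qed.

Lemma conic_adjoin : [/\ adj (set3 t Y Z) s, adj (set3 t Y Z) T, adj (set3 t Y Z) y
  & adj (set3 t Y Z) h].
Proof.
have Z0 := conic_Z_neq0; have [t0 _ w0 _] := conic_ts_neq0.
have [St SY SZ] := adjoin_set3 iota t Y Z.
have Sr : adj (set3 t Y Z) r.
  have -> : r = (w * (Y ^+ 2 - 4 + t ^+ 2) / Z - Z) / 2.
    have wE : w * (Y ^+ 2 - 4 + t ^+ 2) = X ^+ 2 - r ^+ 2.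
      rewrite -[X ^+ 2](subrK (w * Y ^+ 2)) conic_XY.
      by ring.
    rewrite wE (_ : X = Z + r); last by rewrite /Z; ring.
    by field; rewrite two Z0.
  by rewrite /w; adjoin_tac.
have Ss : adj (set3 t Y Z) s.
  have -> : s = (8 - r) / t by rewrite /r; field.
  by adjoin_tac.
have SX : adj (set3 t Y Z) X.
  have -> : X = Z + r by rewrite /Z; ring.
  by adjoin_tac.
by have [] := conic_inverse St Ss SX SY.
Qed.

Lemma independent3_conic : independent3 iota t Y Z.
Proof.
have [Ss ST Sy Sh] := conic_adjoin; have [St _ _] := adjoin_set3 iota t Y Z.
by apply: (independent3_algebraic tshI); apply: algebraic_adjoin.
Qed.

Lemma adjoin_conic_YZ S : adj S t -> adj S s -> adj S T -> adj S y ->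
  adj S Y /\ adj S Z.
Proof.
move=> St Ss ST Sy.
rewrite /Z /X /Y /nn /A0 /B0 /nre /nim /n12re /n12im /k /m /n3 /n12 /cmu /w /r.
by split; adjoin_tac.
Qed.

End ConicNorm.

Section UnitCircle.

Variables (K F : fieldType) (iota : {rmorphism K -> F}).
Local Notation adj := (adjoin iota).
Local Notation alg := (algebraic iota).
Hypothesis two0 : 2 != 0 :> K.

Variables (R0 R1 R2 W : F) (r : {rmorphism F -> F}).
Hypothesis RI : independent3 iota R0 R1 R2.
Hypothesis W2 : W ^+ 2 + (R0 * R1 * R2) ^+ 2 = R0 ^+ 2 + R1 ^+ 2 + R2 ^+ 2 + 2.
Hypothesis rK : forall c, r (iota c) = iota c.
Hypotheses (r0 : r R0 = R1) (r1 : r R1 = R2) (r2 : r R2 = R0) (rW : r W = W).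

Let u : F := masuda_u R0 R1 R2.
Let v : F := masuda_v R0 R1 R2.
Let q : F := R0 + R1 + R2.
Let p : F := (u + v) / 2.
Let e : F := (u - v) / 2.
Let h : F := q - R0 * R1 * R2.
Let T : F := W / h.
Let A : F := (T ^+ 2 + 1) * cb p e / 2 - 1.
Let y : F := (A * h + cB p e) / e ^+ 2.
Let t : F := (p ^+ 2 + 3 * e ^+ 2 - 1) / e.
Let s : F := ((p - 1) ^+ 2 + 3 * e ^+ 2) / e.

Let two : 2 != 0 :> F. Proof. by rewrite -(rmorph_nat iota) fmorph_eq0. Qed.

Let n0 : masuda_den R0 R1 R2 != 0.
Proof.
rewrite /masuda_den; neq0_at RI (idfun : {rmorphism K -> K}) (1 : K) (0 : K) (0 : K).
by rewrite !(mulr0, mul0r, addr0) subr0 expr1n oner_eq0.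
Qed.

Let uE : u = p + e. Proof. by rewrite /p /e; field. Qed.
Let vE : v = p - e. Proof. by rewrite /p /e; field. Qed.

Lemma unit_h : h = q * cb p e + 2 * p ^+ 3 + 6 * p * e ^+ 2.
Proof.
have e3 := masuda_e3 n0; rewrite -/u -/v -/q uE vE /= in e3.
by rewrite /h e3 /cb; ring.
Qed.

Lemma unit_conic :
  cb p e * W ^+ 2 = (2 - cb p e) * h ^+ 2 - 4 * cB p e * h + 2 * cJ p e.
Proof.
rewrite -(conic_identity unit_h); congr (_ * _).
have e2 := masuda_e2 n0; rewrite -/u -/v -/q uE vE /= in e2.
rewrite -[W ^+ 2](addrK ((R0 * R1 * R2) ^+ 2)) W2 /h.
rewrite (_ : R0 ^+ 2 + R1 ^+ 2 + R2 ^+ 2 = q ^+ 2 - 2 * (R0 * R1 + R1 * R2 + R2 * R0)).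
  by rewrite e2; move: (R0 * R1 * R2) q p e => *; ring.
by rewrite /q; ring.
Qed.

Lemma unit_adjoin_R S : adj S p -> adj S e -> adj S h -> cb p e != 0 ->
  [/\ adj S q, adj S u & adj S v].
Proof.
move=> Sp Se Sh b0.
have -> : q = (h - 2 * p ^+ 3 - 6 * p * e ^+ 2) / cb p e.
  by apply: (mulIf b0); rewrite divfK // unit_h; ring.
by rewrite uE vE /cb; split; adjoin_tac.
Qed.

Lemma unit_cb_neq0 : cb p e != 0.
Proof.
have [Sq Su Sv] := adjoin_set3 iota q u v.
have Sw w (wP : w \in [:: R0; R1; R2]) : alg (set3 q u v) w.
  exact: (algebraic_masuda n0 Sq Su Sv wP).
have I : independent3 iota q u v.
  by apply: (independent3_algebraic RI); apply: Sw; rewrite !inE eqxx ?orbT.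
have -> : cb p e = 1 - u * v by rewrite uE vE /cb; ring.
neq0_at I (idfun : {rmorphism K -> K}) (0 : K) (0 : K) (0 : K).
by rewrite mul0r subr0 oner_eq0.
Qed.

Lemma unit_independent_peh : independent3 iota p e h.
Proof.
have [Sp Se Sh] := adjoin_set3 iota p e h.
have [Sq Su Sv] := unit_adjoin_R Sp Se Sh unit_cb_neq0.
have Sw w (wP : w \in [:: R0; R1; R2]) : alg (set3 p e h) w.
  exact: (algebraic_masuda n0 Sq Su Sv wP).
by apply: (independent3_algebraic RI); apply: Sw; rewrite !inE eqxx ?orbT.
Qed.

Lemma unit_neq0 : [/\ e != 0, h != 0, A != 0 & T != 1].
Proof.
have I := unit_independent_peh; have b0 := unit_cb_neq0; have WE := unit_conic.
have h0 : h != 0.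
  by neq0_at I (idfun : {rmorphism K -> K}) (0 : K) (0 : K) (1 : K); rewrite oner_eq0.
split=> //.
- by neq0_at I (idfun : {rmorphism K -> K}) (0 : K) (1 : K) (0 : K); rewrite oner_eq0.
- have : cJ p e - 2 * cB p e * h != 0.
    rewrite /cJ /cB /cb; neq0_at I (idfun : {rmorphism K -> K}) (0 : K) (0 : K) (0 : K).
    by rewrite (_ : _ - _ = 1) ?oner_eq0 //; ring.
  apply: contraNneq => A0.
  have : 2 * A * h ^+ 2 = 0 by rewrite A0 mulr0 mul0r.
  have -> : 2 * A * h ^+ 2 = cb p e * W ^+ 2 + (cb p e - 2) * h ^+ 2.
    by rewrite /A /T; field; rewrite two h0.
  rewrite WE => E; apply/eqP/(mulfI two); rewrite mulr0 -E.
  by ring.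
- have : (2 - 2 * cb p e) * h ^+ 2 - 4 * cB p e * h + 2 * cJ p e != 0.
    rewrite /cJ /cB /cb; neq0_at I (idfun : {rmorphism K -> K}) (0 : K) (0 : K) (0 : K).
    by rewrite (_ : _ + _ = 2) //; ring.
  apply: contraNneq => T1; have WT : W = h by rewrite -[W](divfK h0) -/T T1 mul1r.
  rewrite WT in WE; rewrite -(subrr (cb p e * h ^+ 2)) {1}WE.
  by apply/eqP; ring.
Qed.

(** The value s - t = 2 (1 - p)/e fixes a line through (p, e) = (1, 0), and s fixes a conic through
    that point, which meets the line in one further point. Hence p and e are rational in t and s. *)
Lemma unit_ts : [/\ t != 0, s != 0 & cmu t s != 0] /\
  e = 4 * s / cmu t s /\ p = (t ^+ 2 - s ^+ 2 + 12) / cmu t s.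
Proof.
have I := unit_independent_peh; have [e0 _ _ _] := unit_neq0.
have muE : cmu t s = 4 * ((1 - p) ^+ 2 + 3 * e ^+ 2) / e ^+ 2.
  by rewrite /cmu /t /s; field.
have q0 : (1 - p) ^+ 2 + 3 * e ^+ 2 != 0.
  neq0_at I (idfun : {rmorphism K -> K}) (0 : K) (0 : K) (0 : K).
  by rewrite (_ : _ + _ = 1) ?oner_eq0 //; ring.
have four : 4 != 0 :> F by rewrite (_ : 4 = 2 * 2) ?mulf_neq0 //; ring.
have mu0 : cmu t s != 0 by rewrite muE !mulf_neq0 ?invr_eq0 ?expf_neq0.
split; last first.
  by rewrite muE /t /s; split; field; rewrite ?e0 ?q0 ?four.
split=> //; rewrite mulf_neq0 ?invr_eq0 //.
- neq0_at I (idfun : {rmorphism K -> K}) (0 : K) (0 : K) (0 : K).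
  by rewrite (_ : _ - _ = -1) ?oppr_eq0 ?oner_eq0 //; ring.
- neq0_at I (idfun : {rmorphism K -> K}) (0 : K) (0 : K) (0 : K).
  by rewrite (_ : _ + _ = 1) ?oner_eq0 //; ring.
Qed.

Lemma unit_adjoin_pe S : adj S t -> adj S s -> adj S p /\ adj S e.
Proof.
move=> St Ss; have [_ [eE pE]] := unit_ts.
have Smu : adj S (cmu t s) by rewrite /cmu; adjoin_tac.
by rewrite eE pE; split; adjoin_tac.
Qed.

Lemma unit_independent_tsh : independent3 iota t s h.
Proof.
have [St Ss Sh] := adjoin_set3 iota t s h; have [Sp Se] := unit_adjoin_pe St Ss.
by apply: (independent3_algebraic unit_independent_peh); apply: algebraic_adjoin.
Qed.

(** With W = T h the conic becomes A h^2 + 2 cB h - cJ = 0, so A h + cB = e^2 y is a square root of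
    the reduced discriminant, computed in [conic_discriminant]. *)
Lemma unit_y2 :
  y ^+ 2 = t ^+ 2 + 16 - n12 t s / (32 * t * s ^+ 3) * (T ^+ 2 - 1).
Proof.
have [e0 h0 A0 _] := unit_neq0; have [[t0 s0 m0] [eE pE]] := unit_ts.
have := conic_discriminant (T ^+ 2) m0 t0 s0 two; rewrite /= -eE -pE -/A => E.
have : e ^+ 4 * y ^+ 2 = cB p e ^+ 2 + cJ p e * A.
  have JE : cJ p e = A * h ^+ 2 + 2 * cB p e * h.
    apply: (mulfI two).
    have -> : 2 * (A * h ^+ 2 + 2 * cB p e * h) =
        cb p e * W ^+ 2 + (cb p e - 2) * h ^+ 2 + 4 * cB p e * h.
      by rewrite /A /T; field; rewrite two h0.
    by rewrite unit_conic; ring.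
  by rewrite JE /y; move: A h (cB p e) => *; field.
by rewrite E; apply: mulfI; rewrite expf_neq0.
Qed.

Lemma unit_adjoin_h : adj (fun g => g \in [:: t; s; T; y]) h.
Proof.
set S := (fun g => _).
have [St Ss ST Sy] : [/\ adj S t, adj S s, adj S T & adj S y].
  by split; apply: adjoin_gen; rewrite /S !inE eqxx ?orbT.
have [Sp Se] := unit_adjoin_pe St Ss; have [e0 h0 A0 _] := unit_neq0.
have -> : h = (e ^+ 2 * y - cB p e) / A.
  by apply: (mulIf A0); rewrite divfK // /y; move: A (cB p e) => *; field.
by rewrite /A /cB /cb; adjoin_tac.
Qed.

Lemma unit_fixed : [/\ r t = t, r s = s, r T = T & r y = y].
Proof.
have [ru rv] := masuda_morph r R0 R1 R2; have [_ cu cv] := masuda_cycle n0.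
rewrite r0 r1 r2 cu -/u in ru; rewrite r0 r1 r2 cv -/v in rv.
have rnat n : r n%:R = n%:R by exact: rmorph_nat.
have rp : r p = p by rewrite /p fmorph_div rmorphD ru rv rnat.
have re : r e = e by rewrite /e fmorph_div rmorphB ru rv rnat.
have rh : r h = h.
  by rewrite /h rmorphB !rmorphM r0 r1 r2 /q !rmorphD r0 r1 r2; ring.
have S3 g : set3 p e h g -> r g = g by case=> ->.
have [Sp Se Sh] := adjoin_set3 iota p e h.
have rT : r T = T by rewrite /T fmorph_div rW rh.
have fix4 g : adj (add1 (set3 p e h) T) g -> r g = g.
  by apply: (adjoin_stable rK) => g' [/S3|->].
have [{}Sp {}Se {}Sh ST] : [/\ adj (add1 (set3 p e h) T) p, adj (add1 (set3 p e h) T) e,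
    adj (add1 (set3 p e h) T) h & adj (add1 (set3 p e h) T) T].
  by split; [apply: adjoin_add1 | apply: adjoin_add1 | apply: adjoin_add1
    | apply: adjoin_add1_gen].
by split; apply: fix4; rewrite /t /s /y /A /cB /cb; adjoin_tac.
Qed.

Lemma rational_unit (L : F -> Prop) :
  (forall f, L f <-> adj (add1 (set3 R0 R1 R2) W) f /\ r f = f) -> rational iota L.
Proof.
move=> LE; have [e0 h0 A0 T1] := unit_neq0; have I := unit_independent_tsh.
have y2 := unit_y2; have Ah := unit_adjoin_h.
have CI := independent3_conic two0 I T1 y2 Ah.
have [Cs CT Cy Ch] := conic_adjoin two0 I T1 y2 Ah.
set Y := conic_Y t s T y in CI Cs CT Cy Ch; set Z := conic_Z t s T y in CI Cs CT Cy Ch.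
have [rt rs rT ry] := unit_fixed.
have [Ct CY CZ] := adjoin_set3 iota t Y Z; set S := set3 t Y Z in CI Cs CT Cy Ch Ct CY CZ.
have [Cp Ce] := unit_adjoin_pe Ct Cs.
have [Cq Cu Cv] := unit_adjoin_R Cp Ce Ch unit_cb_neq0.
pose S4 (g : F) : Prop := g \in [:: t; s; T; y].
have fix4 g : adj S4 g -> r g = g.
  by apply: (adjoin_stable rK) => g'; rewrite /S4 !inE => /or4P[] /eqP->.
have rS g : S g -> r g = g.
  have [S4t S4s S4T S4y] : [/\ adj S4 t, adj S4 s, adj S4 T & adj S4 y].
    by split; apply: adjoin_gen; rewrite /S4 !inE eqxx ?orbT.
  have [S4Y S4Z] := adjoin_conic_YZ S4t S4s S4T S4y.
  by case=> -> //; apply: fix4.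
have [R01 R12 R20] : [/\ R0 != R1, R1 != R2 & R2 != R0].
  by split; rewrite -subr_eq0;
    [neq0_at RI (idfun : {rmorphism K -> K}) (1 : K) (0 : K) (0 : K)
    |neq0_at RI (idfun : {rmorphism K -> K}) (0 : K) (1 : K) (0 : K)
    |neq0_at RI (idfun : {rmorphism K -> K}) (0 : K) (0 : K) (1 : K)];
    rewrite subr0 oner_eq0.
apply: (rational3 CI) => f; rewrite LE; split=> [[Sf rf]|Sf].
  apply: (adjoin_fixed_cyclic n0 Cq Cu Cv two R01 R12 R20 rK rS r0 r1 rf).
  apply: adjoin_trans Sf => g [Rg|->]; first by apply: adjoin_gen; right.
  have -> : W = T * h by rewrite divfK.
  by apply: adjoin_mono (adjoin_mul CT Ch) => g' ?; left.
split; last exact: adjoin_stable rK rS _ Sf.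
have [S0 S1 S2] := adjoin_set3 iota R0 R1 R2.
set Q := add1 _ _; have {S0 S1 S2}[S0 S1 S2] : [/\ adj Q R0, adj Q R1 & adj Q R2].
  by split; apply: adjoin_add1.
have SW : adj Q W by apply: adjoin_add1_gen.
have [Qu Qv] : adj Q u /\ adj Q v.
  by rewrite /u /v /masuda_u /masuda_v /masuda_den; split; adjoin_tac.
have Qp : adj Q p by rewrite /p; adjoin_tac.
have Qe : adj Q e by rewrite /e; adjoin_tac.
have Qh : adj Q h by rewrite /h /q; adjoin_tac.
have QT : adj Q T by rewrite /T; adjoin_tac.
have Qt : adj Q t by rewrite /t; adjoin_tac.
have Qs : adj Q s by rewrite /s; adjoin_tac.
have Qy : adj Q y by rewrite /y /A /cB /cb; adjoin_tac.
have [QY QZ] := adjoin_conic_YZ Qt Qs QT Qy.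
by apply: adjoin_trans Sf => g; case=> ->.
Qed.

End UnitCircle.

(** * Invariants of the four-group on three circle points *)

Section UnitTriples.

Variables (F : fieldType) (D : F).

(* Let e_j = c_j + t_j sqrt(-D) be of norm 1 ([c_j^2 + D t_j^2 = 1]). Then [pre] and [pim]
   are the coordinates of e_1 e_2 / e_0, and [hre] = Re e_0 + Re (e_1 / e_2). *)
Definition hre (c0 c1 c2 t0 t1 t2 : F) : F := c0 + c1 * c2 + D * t1 * t2.
Definition pre (c0 c1 c2 t0 t1 t2 : F) : F :=
  c0 * (c1 * c2 - D * t1 * t2) + D * t0 * (c1 * t2 + c2 * t1).
Definition pim (c0 c1 c2 t0 t1 t2 : F) : F :=
  c0 * (c1 * t2 + c2 * t1) - t0 * (c1 * c2 - D * t1 * t2).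

Variables (c0 c1 c2 t0 t1 t2 : F).
Hypotheses (n0 : c0 ^+ 2 = 1 - D * t0 ^+ 2) (n1 : c1 ^+ 2 = 1 - D * t1 ^+ 2)
  (n2 : c2 ^+ 2 = 1 - D * t2 ^+ 2).

(** If th_j is the argument of e_j and ph_0 = th_1 + th_2 - th_0, cyclically, then [pre] is cos ph_0
    and [hre] is 2 cos(ph_1/2) cos(ph_2/2). This identity and [hre_sqr], [pim_sum], [hre_pre] are
    trigonometric formulas using ph_1 + ph_2 = 2 th_0. *)
Lemma hre_mul : hre c1 c2 c0 t1 t2 t0 * hre c2 c0 c1 t2 t0 t1 =
  hre c0 c1 c2 t0 t1 t2 * (1 + pre c0 c1 c2 t0 t1 t2).
Proof. by rewrite /hre /pre; ring: n0 n1 n2. Qed.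

Lemma pre_pim : pre c0 c1 c2 t0 t1 t2 ^+ 2 = 1 - D * pim c0 c1 c2 t0 t1 t2 ^+ 2.
Proof. by rewrite /pim /pre; ring: n0 n1 n2. Qed.

Lemma hre_sqr : hre c0 c1 c2 t0 t1 t2 ^+ 2 -
  D * pim c1 c2 c0 t1 t2 t0 * pim c2 c0 c1 t2 t0 t1 = 2 * c0 * hre c0 c1 c2 t0 t1 t2.
Proof. by rewrite /hre /pim; ring: n0 n1 n2. Qed.

Lemma pim_sum :
  pim c1 c2 c0 t1 t2 t0 * hre c1 c2 c0 t1 t2 t0 ^+ 2 +
  pim c2 c0 c1 t2 t0 t1 * hre c2 c0 c1 t2 t0 t1 ^+ 2 =
  2 * t0 * hre c1 c2 c0 t1 t2 t0 * hre c2 c0 c1 t2 t0 t1.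
Proof. by rewrite /hre /pim; ring: n0 n1 n2. Qed.

Lemma hre_pre : hre c0 c1 c2 t0 t1 t2 =
  c0 * (1 + pre c1 c2 c0 t1 t2 t0) + D * t0 * pim c1 c2 c0 t1 t2 t0.
Proof. by rewrite /hre /pre /pim; ring: n0 n1 n2. Qed.

End UnitTriples.

Section CirclePair.

Variables (F : fieldType) (D a0 b0 a1 b1 : F).
Hypotheses (q0 : a0 ^+ 2 = D - b0 ^+ 2) (q1 : a1 ^+ 2 = D - b1 ^+ 2).

(** Hyperbolic subtraction: if b0 = sqrt D tanh u, a0 = sqrt D / cosh u, a1 = sqrt D tanh v, b1 =
    sqrt D / cosh v, then [ure] is 1 / cosh (v - u) and [uim] is tanh (v - u) / sqrt D. *)
Definition kden : F := D - a1 * b0.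
Definition ure : F := a0 * b1 / kden.
Definition uim : F := (a1 - b0) / kden.

Hypothesis k0 : kden != 0.

Lemma ure_uim : ure ^+ 2 = 1 - D * uim ^+ 2.
Proof.
rewrite /ure /uim; move: k0; rewrite /kden => k0'.
by field: q0 q1; rewrite ?k0'.
Qed.

Lemma kden_uim : kden * (1 + uim * b0) = a0 ^+ 2.
Proof.
by rewrite /uim mulrDr mulr1 mulrA mulrCA mulfV // /kden; ring: q0.
Qed.

End CirclePair.

(** The numerator of [hre] for the three units, over the product of the three [kden]. Its
    nonvanishing is a hypothesis of the next section: the a_j are square roots over the b_j, and
    specialization needs a parametrization of the circle. *)
Definition circle_num (F : fieldType) (d a0 b0 a1 b1 a2 b2 : F) : F :=
  a0 * b1 * (d - a2 * b1) * (d - a0 * b2) +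
  (a1 * b2 * (a2 * b0) + d * (a2 - b1) * (a0 - b2)) * (d - a1 * b0).

(* The degrees are balanced: clearing denominators homogenizes [circle_num]. *)
Lemma circle_num_div (F : fieldType) (d a0 b0 a1 b1 a2 b2 q0 q1 q2 : F) :
    q0 != 0 -> q1 != 0 -> q2 != 0 ->
  circle_num d (a0 / q0) (b0 / q0) (a1 / q1) (b1 / q1) (a2 / q2) (b2 / q2) =
  (a0 * b1 * (d * (q1 * q2) - a2 * b1) * (d * (q2 * q0) - a0 * b2) +
   (a1 * b2 * (a2 * b0) + d * (a2 * q1 - b1 * q2) * (a0 * q2 - b2 * q0)) *
   (d * (q0 * q1) - a1 * b0)) / (q0 * q1 * q2) ^+ 2.
Proof. by move=> n0 n1 n2; rewrite /circle_num; field; rewrite n0 n1 n2. Qed.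

Section CircleFamily.

Variables (K F : fieldType) (iota : {rmorphism K -> F}) (d : K).
Local Notation adj := (adjoin iota).
Local Notation alg := (algebraic iota).
Let D : F := iota d.
Hypotheses (two0 : 2 != 0 :> K) (d0 : d != 0).

Variables (a0 b0 a1 b1 a2 b2 : F) (s g1 g2 : {rmorphism F -> F}).
Hypotheses (q0 : a0 ^+ 2 = D - b0 ^+ 2) (q1 : a1 ^+ 2 = D - b1 ^+ 2)
  (q2 : a2 ^+ 2 = D - b2 ^+ 2).
Hypothesis bI : independent3 iota b0 b1 b2.
Hypothesis adjoin_circles : forall f, adj (fun g => g \in [:: a0; b0; a1; b1; a2; b2]) f.
Hypotheses (sK : forall c, s (iota c) = iota c) (g1K : forall c, g1 (iota c) = iota c)
  (g2K : forall c, g2 (iota c) = iota c).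
Hypotheses (sa0 : s a0 = a1) (sb0 : s b0 = b1) (sa1 : s a1 = a2) (sb1 : s b1 = b2)
  (sa2 : s a2 = a0) (sb2 : s b2 = b0).
Hypotheses (g1a0 : g1 a0 = - a0) (g1b0 : g1 b0 = b0) (g1a1 : g1 a1 = a1)
  (g1b1 : g1 b1 = - b1) (g1a2 : g1 a2 = - a2) (g1b2 : g1 b2 = - b2).
Hypotheses (g2a0 : g2 a0 = a0) (g2b0 : g2 b0 = - b0) (g2a1 : g2 a1 = - a1)
  (g2b1 : g2 b1 = - b1) (g2a2 : g2 a2 = - a2) (g2b2 : g2 b2 = b2).

Let c0 := ure D a0 b0 a1 b1.
Let c1 := ure D a1 b1 a2 b2.
Let c2 := ure D a2 b2 a0 b0.
Let t0 := uim D b0 a1.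
Let t1 := uim D b1 a2.
Let t2 := uim D b2 a0.
Let h0 := hre D c0 c1 c2 t0 t1 t2.
Let h1 := hre D c1 c2 c0 t1 t2 t0.
Let h2 := hre D c2 c0 c1 t2 t0 t1.

Hypothesis num_neq0 : circle_num D a0 b0 a1 b1 a2 b2 != 0.

Lemma circle_D_neq0 : D != 0.
Proof. by rewrite fmorph_eq0. Qed.

Lemma circle_kden_neq0 :
  [/\ kden D b0 a1 != 0, kden D b1 a2 != 0 & kden D b2 a0 != 0].
Proof.
have k0 : kden D b0 a1 != 0.
  apply/eqP; rewrite /kden => k0.
  (* Specialization applies to polynomials in the b_j only; the factor D + a1 b0 removes the square
     root a1. *)
  have : D ^+ 2 - (D - b1 ^+ 2) * b0 ^+ 2 != 0.
    rewrite /D; neq0_at bI (idfun : {rmorphism K -> K}) (0 : K) (0 : K) (0 : K).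
    by rewrite [0 ^+ 2]expr0n mulr0 subr0 expf_neq0.
  have -> : D ^+ 2 - (D - b1 ^+ 2) * b0 ^+ 2 = (D - a1 * b0) * (D + a1 * b0).
    by rewrite -q1; ring.
  by rewrite k0 mul0r eqxx.
have sD : s D = D by apply: sK.
have k1 : kden D b1 a2 != 0.
  by rewrite (_ : kden _ _ _ = s (kden D b0 a1)) ?fmorph_eq0 // /kden rmorphB rmorphM sD sa1 sb0.
split=> //.
by rewrite (_ : kden _ _ _ = s (kden D b1 a2)) ?fmorph_eq0 // /kden rmorphB rmorphM sD sa2 sb1.
Qed.

Let h0_neq0 : h0 != 0.
Proof.
have [k0 k1 k2] := circle_kden_neq0; have := num_neq0; apply: contraNneq => h00.
have -> : circle_num D a0 b0 a1 b1 a2 b2 = h0 * (kden D b0 a1 * kden D b1 a2 * kden D b2 a0).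
  rewrite /h0 /hre /c0 /c1 /c2 /t0 /t1 /t2 /ure /uim /circle_num.
  by move: k0 k1 k2; rewrite /kden => k0 k1 k2; field; rewrite k0 k1 k2.
by rewrite h00 mul0r.
Qed.

Lemma circle_unit :
  [/\ c0 ^+ 2 = 1 - D * t0 ^+ 2, c1 ^+ 2 = 1 - D * t1 ^+ 2
    & c2 ^+ 2 = 1 - D * t2 ^+ 2].
Proof.
have [k0 k1 k2] := circle_kden_neq0.
by split; [exact: ure_uim q0 q1 k0 | exact: ure_uim q1 q2 k1 | exact: ure_uim q2 q0 k2].
Qed.

Lemma circle_s : [/\ s c0 = c1, s c1 = c2 & s c2 = c0] /\
  [/\ s t0 = t1, s t1 = t2 & s t2 = t0].
Proof.
have sD : s D = D by apply: sK.
by split; split; rewrite /c0 /c1 /c2 /t0 /t1 /t2 /ure /uim /kden fmorph_div;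
  rewrite !(rmorphB, rmorphM) sD ?sa0 ?sa1 ?sa2 ?sb0 ?sb1 ?sb2.
Qed.

Lemma hre_morph (r : {rmorphism F -> F}) u0 u1 u2 v0 v1 v2 : r D = D ->
  r (hre D u0 u1 u2 v0 v1 v2) = hre D (r u0) (r u1) (r u2) (r v0) (r v1) (r v2).
Proof. by rewrite /hre => rD; rewrite !(rmorphD, rmorphM) rD. Qed.

Lemma pim_morph (r : {rmorphism F -> F}) u0 u1 u2 v0 v1 v2 : r D = D ->
  r (pim D u0 u1 u2 v0 v1 v2) = pim D (r u0) (r u1) (r u2) (r v0) (r v1) (r v2).
Proof. by rewrite /pim => rD; rewrite !(rmorphB, rmorphD, rmorphN, rmorphM) rD. Qed.

Lemma circle_h_s : [/\ s h0 = h1, s h1 = h2 & s h2 = h0].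
Proof.
have [[s0 s1 s2] [s0' s1' s2']] := circle_s.
by split; rewrite /h0 /h1 /h2 hre_morph ?sK // ?s0 ?s1 ?s2 ?s0' ?s1' ?s2'.
Qed.

Lemma circle_h_neq0 : [/\ h0 != 0, h1 != 0 & h2 != 0].
Proof.
have [s0 s1 s2] := circle_h_s; rewrite -s1 -s0 !fmorph_eq0; split=> //.
Qed.

Let p0 := pim D c0 c1 c2 t0 t1 t2.
Let p1 := pim D c1 c2 c0 t1 t2 t0.
Let p2 := pim D c2 c0 c1 t2 t0 t1.

(* D times the tangents of half the arguments, D [pim] / (1 + [pre]), by [hre_mul]. *)
Definition circle_R0 : F := D * p0 * h0 / (h1 * h2).
Definition circle_R1 : F := D * p1 * h1 / (h2 * h0).
Definition circle_R2 : F := D * p2 * h2 / (h0 * h1).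
Definition circle_W : F := 2 * (b0 / h0 + a0 / h2).

Local Notation R0 := circle_R0.
Local Notation R1 := circle_R1.
Local Notation R2 := circle_R2.
Local Notation W := circle_W.

Lemma circle_pim_s : [/\ s p0 = p1, s p1 = p2 & s p2 = p0].
Proof.
have [[s0 s1 s2] [s0' s1' s2']] := circle_s.
by split; rewrite /p0 /p1 /p2 pim_morph ?sK // ?s0 ?s1 ?s2 ?s0' ?s1' ?s2'.
Qed.

Lemma circle_R_s : [/\ s R0 = R1, s R1 = R2 & s R2 = R0].
Proof.
have [s0 s1 s2] := circle_h_s; have [s0' s1' s2'] := circle_pim_s.
by split; rewrite /R0 /R1 /R2 fmorph_div !rmorphM sK ?s0 ?s1 ?s2 ?s0' ?s1' ?s2'.
Qed.

Lemma circle_c0_neq0 : c0 != 0.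
Proof.
have [k0 _ _] := circle_kden_neq0.
have a0n : a0 != 0.
  have : D - b0 ^+ 2 != 0.
    rewrite /D; neq0_at bI (idfun : {rmorphism K -> K}) (0 : K) (0 : K) (0 : K).
    by rewrite expr0n subr0.
  by rewrite -q0; apply: contraNneq => ->; rewrite expr0n.
rewrite /c0 /ure !mulf_neq0 ?invr_eq0 //.
by neq0_at bI (idfun : {rmorphism K -> K}) (1 : K) (1 : K) (1 : K); apply: oner_neq0.
Qed.

(** The quotient of the two equations is the addition formula for the tangent of th_0 = (ph_1 +
    ph_2)/2; it determines the unit e_0 up to sign. *)
Lemma circle_R12 : D - R1 * R2 = 2 * D * c0 / h0 /\ R1 + R2 = 2 * D * t0 / h0.
Proof.
have [u0 u1 u2] := circle_unit; have [n0 n1 n2] := circle_h_neq0.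
have e1 := hre_sqr u0 u1 u2; have e2 := pim_sum u0 u1 u2.
rewrite -/h0 -/h1 -/h2 -/p1 -/p2 in e1 e2.
rewrite /R1 /R2; split; apply: (mulIf n0); rewrite divfK //.
  have -> : 2 * D * c0 = D * (2 * c0 * h0) / h0 by field; rewrite n0.
  by rewrite -e1; field; rewrite ?n0 ?n1 ?n2.
have -> : 2 * D * t0 = D * (2 * t0 * h1 * h2) / (h1 * h2) by field; rewrite n1 n2.
by rewrite -e2; field; rewrite ?n0 ?n1 ?n2.
Qed.

Lemma circle_DR : D + R0 ^+ 2 = 2 * D * h0 / (h1 * h2).
Proof.
have [u0 u1 u2] := circle_unit; have [n0 n1 n2] := circle_h_neq0.
have e1 := hre_mul u0 u1 u2; have e2 := pre_pim u0 u1 u2.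
rewrite -/h0 -/h1 -/h2 -/p0 in e1 e2.
set r := pre _ _ _ _ _ _ _ in e1 e2.
have -> : R0 ^+ 2 = D * (D * p0 ^+ 2) * h0 ^+ 2 / (h1 * h2) ^+ 2.
  by rewrite /R0; field; rewrite n1 n2.
have -> : D * p0 ^+ 2 = 1 - r ^+ 2 by rewrite e2; ring.
have h12 : h1 * h2 != 0 by rewrite mulf_neq0.
have r1 : 1 + r != 0 by apply: contraNneq h12; rewrite e1 => ->; rewrite mulr0.
by rewrite e1; field; rewrite r1 n0.
Qed.

Lemma circle_axis : a0 / h0 = b0 / h2 + R1 / h1.
Proof.
have [k0 k1 k2] := circle_kden_neq0; have [n0 n1 n2] := circle_h_neq0.
have e : a0 * h2 - b0 * h0 = D * p1.
  rewrite /h2 /h0 /p1 /hre /pim /c0 /c1 /c2 /t0 /t1 /t2 /ure /uim.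
  move: k0 k1 k2; rewrite /kden => k0 k1 k2.
  by field: q0 q1 q2; rewrite ?k0 ?k1 ?k2.
by rewrite /R1 -e; field; rewrite n0 n1 n2.
Qed.

(** Hyperbolic addition, undoing the subtraction that defines c0 and t0: a circle point and the unit
    e_0 determine the next point. *)
Lemma circle_next : 1 + t0 * b0 != 0 /\
  (a1 = (b0 + D * t0) / (1 + t0 * b0) /\ b1 = c0 * a0 / (1 + t0 * b0)).
Proof.
have [k0 k1 k2] := circle_kden_neq0.
have e := kden_uim q0 k0; rewrite -/t0 in e.
have a0n : a0 != 0.
  by have := circle_c0_neq0; rewrite /c0 /ure; apply: contraNneq => ->; rewrite !mul0r.
have l0 : 1 + t0 * b0 != 0.
  have : a0 ^+ 2 != 0 by rewrite expf_neq0.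
  by rewrite -e mulf_eq0 negb_or => /andP[].
split=> //; split; apply: (mulIf l0); rewrite divfK //.
  rewrite /t0 /uim; move: k0; rewrite /kden => k0.
  by field; rewrite k0.
by apply: (mulfI k0); rewrite mulrCA e /c0 /ure; field; rewrite k0.
Qed.

(** [circle_next] expresses s W through a0 and b0. The comparison rests on h1 / h2 = c0 + t0 R1,
    that is, cos(ph_2/2) / cos(ph_1/2) = cos th_0 + sin th_0 tan(ph_1/2). *)
Lemma circle_W_s : s W = W.
Proof.
have [n0 n1 n2] := circle_h_neq0; have [s0 s1 s2] := circle_h_s.
have [k0 k1 k2] := circle_kden_neq0; have [u0 u1 u2] := circle_unit.
have [l0 [a1E b1E]] := circle_next.
have s2' : s 2 = 2 by exact: rmorph_nat.
rewrite /W rmorphM s2' rmorphD !fmorph_div sb0 sa0 s0 s2; congr (_ * _).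
have e : h1 / h2 = c0 + t0 * R1.
  have e1 := hre_mul u1 u2 u0; have e2 := hre_pre u0 u1 u2.
  rewrite -/h0 -/h1 -/h2 -/p1 in e1 e2; set r := pre _ _ _ _ _ _ _ in e1 e2.
  rewrite /R1; apply: (mulIf n2); rewrite divfK //; apply: (mulIf n0).
  rewrite {1}e2; have -> : (c0 + t0 * (D * p1 * h1 / (h2 * h0))) * h2 * h0 =
    c0 * (h2 * h0) + t0 * D * p1 * h1 by field; rewrite n0 n2.
  by rewrite e1; ring.
have ax := circle_axis.
have ax' : R1 = (a0 / h0 - b0 / h2) * h1 by rewrite ax; field; rewrite n1 n2.
have e' : 1 / h2 = c0 / h1 + t0 * (a0 / h0 - b0 / h2).
  have -> : 1 / h2 = (h1 / h2) / h1 by field; rewrite n1 n2.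
  by rewrite e ax'; field; rewrite n0 n1 n2.
have -> : a0 / h2 = a0 * (1 / h2) by rewrite mul1r.
rewrite e' a1E b1E; apply: (mulIf l0).
have -> : (c0 * a0 / (1 + t0 * b0) / h1 + (b0 + D * t0) / (1 + t0 * b0) / h0)
  * (1 + t0 * b0) = c0 * a0 / h1 + (b0 + D * t0) / h0 by field; rewrite n0 n1 l0.
have -> : (b0 / h0 + a0 * (c0 / h1 + t0 * (a0 / h0 - b0 / h2))) * (1 + t0 * b0) =
  b0 / h0 * (1 + t0 * b0) + a0 * c0 / h1 + a0 * t0 * b0 * (c0 / h1 + t0 * (a0 / h0 - b0 / h2))
  + t0 * (a0 ^+ 2 / h0 - b0 * a0 / h2) by field; rewrite n0 n1 n2.
rewrite -e' q0; by field; rewrite n0 n1 n2.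
Qed.

Lemma circle_D_R : [/\ D + R0 ^+ 2 = 2 * D * h0 / (h1 * h2),
  D + R1 ^+ 2 = 2 * D * h1 / (h2 * h0) & D + R2 ^+ 2 = 2 * D * h2 / (h0 * h1)].
Proof.
have [s0 s1 s2] := circle_h_s; have [r0 r1 r2] := circle_R_s.
have s2' : s 2 = 2 by exact: rmorph_nat.
have e0 := circle_DR.
have e1 := congr1 s e0; rewrite rmorphD rmorphXn r0 fmorph_div !rmorphM sK s0 s1 s2 s2' in e1.
have e2 := congr1 s e1; rewrite rmorphD rmorphXn r1 fmorph_div !rmorphM sK s0 s1 s2 s2' in e2.
by split.
Qed.

(** By [circle_axis], W / 2 and R1 / h1 are, up to sign, the two coordinates of the product of a0 +
    i b0 and 1/h2 - i/h0. Their squares therefore add up to D (1/h0^2 + 1/h2^2), and [circle_D_R]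
    eliminates the h_j. *)
Lemma circle_norm :
  W ^+ 2 + (R0 * R1 * R2 / D) ^+ 2 = R0 ^+ 2 + R1 ^+ 2 + R2 ^+ 2 + 2 * D.
Proof.
have [n0 n1 n2] := circle_h_neq0; have [e0 e1 e2] := circle_D_R.
have ax := circle_axis; have Dn := circle_D_neq0.
have W2 : W ^+ 2 = 4 * D * (1 / h0 ^+ 2 + 1 / h2 ^+ 2) - 4 * (R1 ^+ 2 / h1 ^+ 2).
  have -> : R1 ^+ 2 / h1 ^+ 2 = (a0 / h0 - b0 / h2) ^+ 2.
    by rewrite ax; field; rewrite n1 n2.
  by rewrite /W; field: q0; rewrite n0 n2.
have {}e0 : R0 ^+ 2 = 2 * D * h0 / (h1 * h2) - D by rewrite -e0; ring.
have {}e1 : R1 ^+ 2 = 2 * D * h1 / (h2 * h0) - D by rewrite -e1; ring.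
have {}e2 : R2 ^+ 2 = 2 * D * h2 / (h0 * h1) - D by rewrite -e2; ring.
have -> : (R0 * R1 * R2 / D) ^+ 2 = R0 ^+ 2 * R1 ^+ 2 * R2 ^+ 2 / D ^+ 2.
  by field; rewrite Dn.
by rewrite W2 e0 e1 e2; field; rewrite n0 n1 n2 Dn.
Qed.

Lemma circle_fixed_g1 : [/\ g1 R0 = R0, g1 R1 = R1, g1 R2 = R2 & g1 W = W].
Proof.
have gD : g1 D = D by apply: g1K.
have [e0 e1 e2] : [/\ g1 c0 = c0, g1 c1 = - c1 & g1 c2 = - c2].
  split; rewrite /c0 /c1 /c2 /ure /kden fmorph_div !(rmorphB, rmorphM) gD;
    rewrite ?g1a0 ?g1a1 ?g1a2 ?g1b0 ?g1b1 ?g1b2 ?mulrNN // -[RHS]mulNr;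
    by congr (_ / _); ring.
have [f0 f1 f2] : [/\ g1 t0 = t0, g1 t1 = - t1 & g1 t2 = - t2].
  split; rewrite /t0 /t1 /t2 /uim /kden fmorph_div !(rmorphB, rmorphM) gD;
    rewrite ?g1a0 ?g1a1 ?g1a2 ?g1b0 ?g1b1 ?g1b2 ?mulrNN // -[RHS]mulNr;
    by congr (_ / _); ring.
have [k0 k1 k2] : [/\ g1 h0 = h0, g1 h1 = - h1 & g1 h2 = - h2].
  by split; rewrite /h0 /h1 /h2 hre_morph // e0 e1 e2 f0 f1 f2 /hre; ring.
have [m0 m1 m2] : [/\ g1 p0 = p0, g1 p1 = p1 & g1 p2 = p2].
  by split; rewrite /p0 /p1 /p2 pim_morph // e0 e1 e2 f0 f1 f2 /pim; ring.
have g12 : g1 2 = 2 by exact: rmorph_nat.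
have [n0 n1 n2] := circle_h_neq0.
split.
- by rewrite /R0 fmorph_div !rmorphM gD m0 k0 k1 k2; field; rewrite ?oppr_eq0 ?n0 ?n1 ?n2.
- by rewrite /R1 fmorph_div !rmorphM gD m1 k0 k1 k2; field; rewrite ?oppr_eq0 ?n0 ?n1 ?n2.
- by rewrite /R2 fmorph_div !rmorphM gD m2 k0 k1 k2; field; rewrite ?oppr_eq0 ?n0 ?n1 ?n2.
- by rewrite /W rmorphM g12 rmorphD !fmorph_div g1b0 g1a0 k0 k2; field;
    rewrite ?oppr_eq0 ?n0 ?n1 ?n2.
Qed.

Lemma circle_fixed_g2 : [/\ g2 R0 = R0, g2 R1 = R1, g2 R2 = R2 & g2 W = W].
Proof.
have gD : g2 D = D by apply: g2K.
have [e0 e1 e2] : [/\ g2 c0 = - c0, g2 c1 = - c1 & g2 c2 = c2].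
  split; rewrite /c0 /c1 /c2 /ure /kden fmorph_div !(rmorphB, rmorphM) gD;
    rewrite ?g2a0 ?g2a1 ?g2a2 ?g2b0 ?g2b1 ?g2b2 ?mulrNN // -[RHS]mulNr;
    by congr (_ / _); ring.
have [f0 f1 f2] : [/\ g2 t0 = - t0, g2 t1 = - t1 & g2 t2 = t2].
  split; rewrite /t0 /t1 /t2 /uim /kden fmorph_div !(rmorphB, rmorphM) gD;
    rewrite ?g2a0 ?g2a1 ?g2a2 ?g2b0 ?g2b1 ?g2b2 ?mulrNN // -[RHS]mulNr;
    by congr (_ / _); ring.
have [k0 k1 k2] : [/\ g2 h0 = - h0, g2 h1 = - h1 & g2 h2 = h2].
  by split; rewrite /h0 /h1 /h2 hre_morph // e0 e1 e2 f0 f1 f2 /hre; ring.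
have [m0 m1 m2] : [/\ g2 p0 = p0, g2 p1 = p1 & g2 p2 = p2].
  by split; rewrite /p0 /p1 /p2 pim_morph // e0 e1 e2 f0 f1 f2 /pim; ring.
have g12 : g2 2 = 2 by exact: rmorph_nat.
have [n0 n1 n2] := circle_h_neq0.
split.
- by rewrite /R0 fmorph_div !rmorphM gD m0 k0 k1 k2; field; rewrite ?oppr_eq0 ?n0 ?n1 ?n2.
- by rewrite /R1 fmorph_div !rmorphM gD m1 k0 k1 k2; field; rewrite ?oppr_eq0 ?n0 ?n1 ?n2.
- by rewrite /R2 fmorph_div !rmorphM gD m2 k0 k1 k2; field; rewrite ?oppr_eq0 ?n0 ?n1 ?n2.
- by rewrite /W rmorphM g12 rmorphD !fmorph_div g2b0 g2a0 k0 k2; field;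
    rewrite ?oppr_eq0 ?n0 ?n1 ?n2.
Qed.

(** The definition of W and [circle_axis] are linear equations for a0 and b0; a0 is eliminated. The
    factor c0 has the same signs as b0 under g1 and g2, so the product, unlike b0, is invariant. *)
Lemma circle_b0 : 2 * D + R0 ^+ 2 + R2 ^+ 2 != 0 ->
  b0 * c0 = (D - R1 * R2) / (2 * D) * (W / 2 - R1 * ((D + R0 ^+ 2) / (2 * D))) /
    ((D + R1 ^+ 2) * (2 * D + R0 ^+ 2 + R2 ^+ 2) / (4 * D ^+ 2)).
Proof.
have [n0 n1 n2] := circle_h_neq0; have [e0 e1 e2] := circle_D_R.
have ax := circle_axis; have Dn := circle_D_neq0; have [e12 _] := circle_R12.
have two : 2 != 0 :> F by rewrite -(rmorph_nat iota) fmorph_eq0.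
have -> : 2 * D + R0 ^+ 2 + R2 ^+ 2 = (D + R0 ^+ 2) + (D + R2 ^+ 2) by ring.
rewrite e12 e0 e1 e2 => nz.
have ax' : R1 = (a0 / h0 - b0 / h2) * h1 by rewrite ax; field; rewrite n1 n2.
have s0 : h0 ^+ 2 + h2 ^+ 2 != 0.
  apply: contraNneq nz => s0.
  have -> : 2 * D * h0 / (h1 * h2) + 2 * D * h2 / (h0 * h1) =
    2 * D * (h0 ^+ 2 + h2 ^+ 2) / (h0 * h1 * h2) by field; rewrite n0 n1 n2.
  by rewrite s0 mulr0 mul0r.
have s0' : 2 * D * h0 * h0 + 2 * D * h2 * h2 != 0.
  rewrite (_ : _ + _ = 2 * D * (h0 ^+ 2 + h2 ^+ 2)); last by ring.
  by rewrite !mulf_neq0.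
have four : 4 != 0 :> F by rewrite (_ : 4 = 2 * 2) ?mulf_neq0 //; ring.
by rewrite ax' /W; field; rewrite Dn four n0 n1 n2 s0' two.
Qed.

Lemma circle_R20 : D - R2 * R0 = 2 * D * c1 / h1 /\ R2 + R0 = 2 * D * t1 / h1.
Proof.
have [e f] := circle_R12; have [_ r1 r2] := circle_R_s; have [s0 _ _] := circle_h_s.
have [[sc0 _ _] [st0 _ _]] := circle_s; have sD : s D = D by apply: sK.
have s2' : s 2 = 2 by exact: rmorph_nat.
move: (congr1 s e) (congr1 s f).
rewrite rmorphB rmorphD fmorph_div [s (R1 * R2)]rmorphM r1 r2 sD.
rewrite [s (2 * D * c0)]rmorphM [s (2 * D)]rmorphM s2' sD sc0 s0.
by rewrite fmorph_div [s (2 * D * t0)]rmorphM [s (2 * D)]rmorphM s2' sD st0 s0.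
Qed.

Lemma circle_next2 : 1 + t1 * b1 != 0 /\
  (a2 = (b1 + D * t1) / (1 + t1 * b1) /\ b2 = c1 * a1 / (1 + t1 * b1)).
Proof.
have [l0 [e f]] := circle_next; have sD : s D = D by apply: sK.
have [[sc0 _ _] [st0 _ _]] := circle_s.
have sl : s (1 + t0 * b0) = 1 + t1 * b1 by rewrite rmorphD rmorph1 rmorphM st0 sb0.
split; first by rewrite -sl fmorph_eq0.
move: (congr1 s e) (congr1 s f); rewrite !fmorph_div sl sa1 sb1.
rewrite [s (b0 + _)]rmorphD [s (D * _)]rmorphM [s (c0 * _)]rmorphM.
by rewrite sD sb0 st0 sc0 sa0.
Qed.

Lemma circle_DR_neq0 : [/\ D + R0 ^+ 2 != 0, D + R1 ^+ 2 != 0 & D + R2 ^+ 2 != 0].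
Proof.
have [n0 n1 n2] := circle_h_neq0; have [-> -> ->] := circle_D_R.
have two : 2 != 0 :> F by rewrite -(rmorph_nat iota) fmorph_eq0.
by split; rewrite !(mulf_neq0, invr_eq0, circle_D_neq0).
Qed.

(** Products of two equations of [circle_D_R] give the h_j^2, so the h_j, then b0 and a0, and by
    [circle_next] the other points are algebraic over the R_j. *)
Lemma independent3_circle : independent3 iota R0 R1 R2.
Proof.
have [n0 n1 n2] := circle_h_neq0; have [e0 e1 e2] := circle_D_R.
have [d0' d1' d2'] := circle_DR_neq0; have ax := circle_axis.
have Dn := circle_D_neq0; have two : 2 != 0 :> F.
  by rewrite -(rmorph_nat iota) fmorph_eq0.
pose S := set3 R0 R1 R2; have [S0 S1 S2] := adjoin_set3 iota R0 R1 R2.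
have SD : adj S D by apply: adjoin_base.
have [H0 H1 H2] : [/\ alg S h0, alg S h1 & alg S h2].
  split; apply: algebraic_sqrt; apply: algebraic_adjoin.
  - have -> : h0 ^+ 2 = 4 * D ^+ 2 / ((D + R1 ^+ 2) * (D + R2 ^+ 2)).
      by rewrite e1 e2; field; rewrite ?n0 ?n1 ?n2 ?Dn ?two.
    by adjoin_tac.
  - have -> : h1 ^+ 2 = 4 * D ^+ 2 / ((D + R2 ^+ 2) * (D + R0 ^+ 2)).
      by rewrite e0 e2; field; rewrite ?n0 ?n1 ?n2 ?Dn ?two.
    by adjoin_tac.
  - have -> : h2 ^+ 2 = 4 * D ^+ 2 / ((D + R0 ^+ 2) * (D + R1 ^+ 2)).
      by rewrite e0 e1; field; rewrite ?n0 ?n1 ?n2 ?Dn ?two.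
    by adjoin_tac.
move/algebraic_adjoin: S0 => S0; move/algebraic_adjoin: S1 => S1.
move/algebraic_adjoin: S2 => S2; move/algebraic_adjoin: SD => SD.
have B0 : alg S b0.
  (* Squaring [circle_axis] and replacing a0^2 by D - b0^2 gives this quadratic for b0. Its leading
     coefficient might vanish, so the polynomial is shown nonzero through [B] and [C]: B = 0 forces
     R1 = 0, and then C = - D / h0^2. *)
  pose A := h0^-1 ^+ 2 + h2^-1 ^+ 2.
  pose B := 2 * R1 * h1^-1 * h2^-1.
  pose C := R1 ^+ 2 * h1^-1 ^+ 2 - D * h0^-1 ^+ 2.
  have pE i : (A%:P * 'X^2 + B%:P * 'X + C%:P : {poly F})`_i =
      A *+ (i == 2)%N + B *+ (i == 1)%N + C *+ (i == 0)%N.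
    rewrite !coefD !coefCM coefXn coefX coefC !mulr_natr.
    by case: (i == 0)%N.
  apply: (@algebraic_root _ _ _ _ (A%:P * 'X^2 + B%:P * 'X + C%:P)).
  - apply/eqP=> pz.
    have Bz : 0 = B by have := pE 1%N; rewrite pz coef0 /= ?mulr0n ?add0r ?addr0.
    have Cz : 0 = C by have := pE 0%N; rewrite pz coef0 /= ?mulr0n ?add0r.
    have r1 : R1 = 0.
      have -> : R1 = B * h1 * h2 / 2 by rewrite /B; field; rewrite n1 n2 two.
      by rewrite -Bz !mul0r.
    move/esym/eqP: Cz; rewrite /C r1 expr0n mul0r sub0r oppr_eq0 mulf_eq0.
    by rewrite (negbTE Dn) expf_eq0 invr_eq0 (negbTE n0).
  - rewrite /root !(hornerD, hornerM, hornerC, hornerXn, hornerX) /A /B /C.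
    have -> : (h0^-1 ^+ 2 + h2^-1 ^+ 2) * b0 ^+ 2 + 2 * R1 * h1^-1 * h2^-1 * b0
      + (R1 ^+ 2 * h1^-1 ^+ 2 - D * h0^-1 ^+ 2) = (b0 / h2 + R1 / h1) ^+ 2
      - (D - b0 ^+ 2) / h0 ^+ 2 by field; rewrite n0 n1 n2.
    by rewrite -ax -q0; apply/eqP; field; rewrite n0.
  - have Sn r : alg S r -> forall n, alg S (r *+ n) by move=> Sr n; apply: algebraicMn.
    have [Y0 Y1 Y2] : [/\ alg S h0^-1, alg S h1^-1 & alg S h2^-1].
      by split; apply: algebraicV.
    have T2 : alg S 2 by apply/Sn/algebraic_adjoin/adjoin1.
    move=> i; rewrite pE; apply: algebraicD; first apply: algebraicD; apply: Sn.
    + by apply: algebraicD; apply: algebraicX.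
    + by do !(apply: algebraicM => //).
    + apply: algebraicD; first by apply: algebraicM; apply: algebraicX.
      by apply/algebraicN/algebraicM => //; apply: algebraicX.
have sq b a : a ^+ 2 = D - b ^+ 2 -> alg S b -> alg S a.
  move=> aE Sb; apply: algebraic_sqrt; rewrite aE; apply: algebraicD => //.
  exact/algebraicN/algebraicX.
have T2V : alg S (2 * D)^-1.
  by apply: algebraicV; apply: algebraicM => //; apply/algebraicMn/algebraic_adjoin/adjoin1.
have A0 := sq _ _ q0 B0.
have next c t h r r' b a b' : D - r * r' = 2 * D * c / h -> r + r' = 2 * D * t / h ->
    h != 0 -> alg S r -> alg S r' -> alg S h -> alg S b -> alg S a ->
    b' = c * a / (1 + t * b) -> alg S b'.
  move=> cE tE hn Sr Sr' Sh Sb Sa ->.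
  have -> : c = (D - r * r') * h * (2 * D)^-1 by rewrite cE; field; rewrite hn Dn two.
  have -> : t = (r + r') * h * (2 * D)^-1 by rewrite tE; field; rewrite hn Dn two.
  apply: algebraicM; last first.
    apply/algebraicV/algebraicD; first exact/algebraic_adjoin/adjoin1.
    by do !(apply: algebraicM => //); apply: algebraicD.
  do !(apply: algebraicM => //); apply: algebraicD => //.
  by apply/algebraicN/algebraicM.
have [c0E t0E] := circle_R12; have [c1E t1E] := circle_R20.
have [_ [_ b1E]] := circle_next; have [_ [_ b2E]] := circle_next2.
have B1 : alg S b1 by apply: next c0E t0E n0 S1 S2 H0 B0 A0 b1E.
have A1 := sq _ _ q1 B1.
have B2 : alg S b2 by apply: next c1E t1E n1 S2 S0 H1 B1 A1 b2E.
exact: independent3_algebraic bI B0 B1 B2.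
Qed.

Lemma circle_b0_sqr :
  b0 ^+ 2 = (b0 * c0) ^+ 2 * (1 + D * ((R1 + R2) / (D - R1 * R2)) ^+ 2).
Proof.
have [u0 _ _] := circle_unit; have [-> ->] := circle_R12.
have [n0 _ _] := circle_h_neq0; have c0n := circle_c0_neq0; have Dn := circle_D_neq0.
have two : 2 != 0 :> F by rewrite -(rmorph_nat iota) fmorph_eq0.
have -> : 2 * D * t0 / h0 / (2 * D * c0 / h0) = t0 / c0.
  by field; rewrite ?n0 ?c0n ?Dn ?two.
by field: u0; rewrite c0n.
Qed.

(** Over K(R0, R1, R2, W), the elements a0 and b0 generate everything, because they give c0 and t0,
    then the next points. Both squares lie in this field; g2 negates b0 and fixes a0, and g1 negates
    a0, so one square root is removed at a time. *)
Lemma adjoin_circle_fixed f : g1 f = f -> g2 f = f -> adj (add1 (set3 R0 R1 R2) W) f.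
Proof.
move=> gf1 gf2; have I := independent3_circle.
have [n0 n1 n2] := circle_h_neq0; have c0n := circle_c0_neq0; have Dn := circle_D_neq0.
have two : 2 != 0 :> F by rewrite -(rmorph_nat iota) fmorph_eq0.
have [S0 S1 S2] := adjoin_set3 iota R0 R1 R2; set S := add1 _ _.
have SW : adj S W by apply: adjoin_add1_gen.
have {S0 S1 S2}[S0 S1 S2] : [/\ adj S R0, adj S R1 & adj S R2].
  by split; apply: adjoin_add1.
have SD : adj S D by apply: adjoin_base.
have nz : 2 * D + R0 ^+ 2 + R2 ^+ 2 != 0.
  rewrite /D; neq0_at I (idfun : {rmorphism K -> K}) (0 : K) (0 : K) (0 : K).
  by rewrite expr0n !addr0 mulf_neq0.
have nz' : 2 * D + R1 ^+ 2 + R0 ^+ 2 != 0.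
  rewrite /D; neq0_at I (idfun : {rmorphism K -> K}) (0 : K) (0 : K) (0 : K).
  by rewrite expr0n !addr0 mulf_neq0.
have b0E := circle_b0 nz.
have b1E : b1 * c1 = (D - R2 * R0) / (2 * D) * (W / 2 - R2 * ((D + R1 ^+ 2) / (2 * D))) /
    ((D + R2 ^+ 2) * (2 * D + R1 ^+ 2 + R0 ^+ 2) / (4 * D ^+ 2)).
  have [[sc0 _ _] _] := circle_s; have sD : s D = D by apply: sK.
  have [r0 r1 r2] := circle_R_s; have sW := circle_W_s.
  have := congr1 s b0E; rewrite [LHS]rmorphM sb0 sc0 => ->.
  have [s2' s4'] : s 2 = 2 /\ s 4 = 4 by split; exact: rmorph_nat.
  move: r0 r1 r2 sW sD s2' s4'; move: R0 R1 R2 W D (2 : F) (4 : F) => ? ? ? ? ? ? ?.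
  move=> r0 r1 r2 sW sD s2' s4'.
  rewrite !(fmorphV, rmorphM, rmorphB, rmorphD, rmorphN, rmorphXn).
  by rewrite r0 r1 r2 sW sD s2' s4'.
have [c0E t0E] := circle_R12; have [c1E t1E] := circle_R20.
have [l0 [a1E b1E']] := circle_next; have [l1 [a2E b2E]] := circle_next2.
have two' : 2 * D != 0 by rewrite mulf_neq0.
have DR12 : D - R1 * R2 != 0 by rewrite c0E mulf_neq0 ?invr_eq0 // mulf_neq0.
have c1n : c1 != 0 by have [[<- _ _] _] := circle_s; rewrite fmorph_eq0.
have DR20 : D - R2 * R0 != 0 by rewrite c1E mulf_neq0 ?invr_eq0 // mulf_neq0.
have [a0n b0n] : a0 != 0 /\ b0 != 0.
  split.
    have := c0n; rewrite /c0 /ure; apply: contraNneq => ->; by rewrite !mul0r.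
  by neq0_at bI (idfun : {rmorphism K -> K}) (1 : K) (1 : K) (1 : K); apply: oner_neq0.
have b1n : b1 != 0 by rewrite -sb0 fmorph_eq0.
pose S' := add1 (add1 S a0) b0.
have all f' : adj S' f'.
  have up g : adj S g -> adj S' g by move=> Sg; do 2!apply: adjoin_add1.
  have A0 : adj S' a0 by apply/adjoin_add1/adjoin_add1_gen.
  have B0 : adj S' b0 by apply: adjoin_add1_gen.
  move: (up _ S0) (up _ S1) (up _ S2) (up _ SW) (up _ SD) => Q0 Q1 Q2 QW QD.
  have C0 : adj S' c0.
    have -> : c0 = (b0 * c0) / b0 by field; rewrite b0n.
    rewrite b0E; move: Q0 Q1 Q2 QW; move: R0 R1 R2 W => *; adjoin_tac.
  have T0 : adj S' t0.
    have -> : t0 = c0 * (R1 + R2) / (D - R1 * R2).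
      by rewrite t0E c0E; field; rewrite ?n0 ?c0n ?Dn ?two.
    by move: Q1 Q2 C0; move: R1 R2 c0 => *; adjoin_tac.
  have A1 : adj S' a1 by rewrite a1E; move: T0; move: t0 => *; adjoin_tac.
  have B1 : adj S' b1 by rewrite b1E'; move: T0 C0; move: t0 c0 => *; adjoin_tac.
  have C1 : adj S' c1.
    have -> : c1 = (b1 * c1) / b1 by field; rewrite b1n.
    rewrite b1E; move: Q0 Q1 Q2 QW; move: R0 R1 R2 W => *; adjoin_tac.
  have T1 : adj S' t1.
    have -> : t1 = c1 * (R2 + R0) / (D - R2 * R0).
      by rewrite t1E c1E; field; rewrite ?n1 ?c1n ?Dn ?two.
    by move: Q2 Q0 C1; move: R2 R0 c1 => *; adjoin_tac.
  have A2 : adj S' a2 by rewrite a2E; move: T1; move: t1 => *; adjoin_tac.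
  have B2 : adj S' b2 by rewrite b2E; move: T1 C1; move: t1 c1 => *; adjoin_tac.
  apply: adjoin_trans (adjoin_circles f') => g.
  by rewrite !inE => /orP[/eqP->|/orP[/eqP->|/orP[/eqP->|/orP[/eqP->|/orP[]/eqP->]]]].
have Sb0 : adj S (b0 ^+ 2).
  rewrite circle_b0_sqr b0E; move: S0 S1 S2 SW SD; move: (S) R0 R1 R2 W D => *.
  by adjoin_tac.
have g1S g : S g -> g1 g = g by have [? ? ? ?] := circle_fixed_g1; case=> [[]|] ->.
have g2S g : S g -> g2 g = g by have [? ? ? ?] := circle_fixed_g2; case=> [[]|] ->.
have twoN (w : F) : w != 0 -> w != - w.
  move=> w0; rewrite -subr_eq0 opprK (_ : w + w = 2 * w) ?mulf_neq0 //; ring.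
have sqN (w : F) : w * - w = - w ^+ 2 by ring.
have f2 : adj (add1 S a0) f.
  apply: (@adjoin_fixed_quadratic _ _ _ _ b0 (- b0) _ g2) (all f) _ _ _ _ => //.
  - by rewrite subrr; apply: adjoin0.
  - by rewrite sqN; apply/adjoin_opp/adjoin_add1.
  - exact: twoN.
  - by move=> g [/g2S|->].
apply: (@adjoin_fixed_quadratic _ _ _ _ a0 (- a0) _ g1) f2 _ _ _ _ => //.
- by rewrite subrr; apply: adjoin0.
- by rewrite sqN q0; adjoin_tac.
- exact: twoN.
Qed.

Lemma rational_circle (L : F -> Prop) : d = 1 \/ (exists i, i ^+ 2 = -1 :> K) ->
  (forall f, L f <-> [/\ g1 f = f, g2 f = f & s f = f]) -> rational iota L.
Proof.
move=> dP LE; have {}LE f : L f <-> adj (add1 (set3 R0 R1 R2) W) f /\ s f = f.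
  rewrite LE; split=> [[f1 f2 fs]|[Sf fs]]; first by split=> //; apply: adjoin_circle_fixed.
  have [r10 r11 r12 w1] := circle_fixed_g1; have [r20 r21 r22 w2] := circle_fixed_g2.
  by split=> //; [apply: adjoin_stable g1K _ _ Sf | apply: adjoin_stable g2K _ _ Sf];
    move=> g [[]|] ->.
have [s0 s1 s2] := circle_R_s; have norm := circle_norm; have sW := circle_W_s.
have I := independent3_circle.
case: dP => [d1|[i i2]]; last exact: (rational_markov two0 d0 i2 I norm sK s0 s1 s2 sW LE).
have D1 : D = 1 by rewrite /D d1 rmorph1.
apply: (rational_unit two0 I _ sK s0 s1 s2 sW LE).
by move: norm; rewrite D1 divr1 mulr1.
Qed.

End CircleFamily.

(** * The case eps = -1: reduction to circle points *)

Section Negative.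

Variables (K F : fieldType) (iota : {rmorphism K -> F}) (a : K) (x y z : F).
Variables t l s : {rmorphism F -> F}.
Local Notation adj := (adjoin iota).
Local Notation alg := (algebraic iota).
Let A : F := iota a.
Let tl : {rmorphism F -> F} := t \o l.
Hypothesis xyzI : independent3 iota x y z.
Hypothesis adjoin_gens : forall f, adj (set3 x y z) f.
Hypotheses (two0 : 2 != 0 :> K) (a0 : a != 0).
Hypotheses (tK : forall c, t (iota c) = iota c) (lK : forall c, l (iota c) = iota c)
  (sK : forall c, s (iota c) = iota c).
Hypotheses (tx : t x = A / x) (ty : t y = - (A / y)) (tz : t z = - z).
Hypotheses (lx : l x = - (A / x)) (ly : l y = - y) (lz : l z = A / z).
Hypotheses (sx : s x = y) (sy : s y = z) (sz : s z = x).

Let two : 2 != 0 :> F. Proof. by rewrite -(rmorph_nat iota) fmorph_eq0. Qed.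
Let An : A != 0. Proof. by rewrite fmorph_eq0. Qed.

(** V acts by signs on these two combinations, and the conic usum^2 - vdiff^2 = 4 A becomes a circle
    in each of the three cases after scaling or division. *)
Definition usum (w : F) : F := w + A / w.
Definition vdiff (w : F) : F := w - A / w.

Lemma usumN w : usum (- w) = - usum w.
Proof. by rewrite /usum invrN mulrN opprD. Qed.

Lemma vdiffN w : vdiff (- w) = - vdiff w.
Proof. by rewrite /vdiff invrN mulrN opprD. Qed.

Lemma usum_inv w : usum (A / w) = usum w.
Proof. by rewrite /usum invf_div mulrCA mulfV // mulr1 addrC. Qed.

Lemma vdiff_inv w : vdiff (A / w) = - vdiff w.
Proof. by rewrite /vdiff invf_div mulrCA mulfV // mulr1 opprB. Qed.

Lemma rmorph_usum (r : {rmorphism F -> F}) w : r A = A -> r (usum w) = usum (r w).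
Proof. by move=> rA; rewrite rmorphD fmorph_div rA. Qed.

Lemma rmorph_vdiff (r : {rmorphism F -> F}) w : r A = A -> r (vdiff w) = vdiff (r w).
Proof. by move=> rA; rewrite rmorphB fmorph_div rA. Qed.

Lemma tau_signs :
  [/\ t (usum x) = usum x, t (usum y) = - usum y & t (usum z) = - usum z] /\
  [/\ t (vdiff x) = - vdiff x, t (vdiff y) = vdiff y & t (vdiff z) = - vdiff z].
Proof.
have tA : t A = A by apply: tK.
by rewrite !rmorph_usum // !rmorph_vdiff // tx ty tz !(usumN, usum_inv, vdiffN, vdiff_inv) opprK.
Qed.

Lemma lambda_signs :
  [/\ l (usum x) = - usum x, l (usum y) = - usum y & l (usum z) = usum z] /\
  [/\ l (vdiff x) = vdiff x, l (vdiff y) = - vdiff y & l (vdiff z) = - vdiff z].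
Proof.
have lA : l A = A by apply: lK.
by rewrite !rmorph_usum // !rmorph_vdiff // lx ly lz !(usumN, usum_inv, vdiffN, vdiff_inv) opprK.
Qed.

Lemma tau_lambda_signs :
  [/\ tl (usum x) = - usum x, tl (usum y) = usum y
    & tl (usum z) = - usum z] /\
  [/\ tl (vdiff x) = - vdiff x, tl (vdiff y) = - vdiff y
    & tl (vdiff z) = vdiff z].
Proof.
have [[tux tuy tuz] [tvx tvy tvz]] := tau_signs.
have [[lux luy luz] [lvx lvy lvz]] := lambda_signs.
by rewrite /= lux luy luz lvx lvy lvz !rmorphN tux tuy tuz tvx tvy tvz !opprK.
Qed.

Lemma sigma_cycle :
  [/\ s (usum x) = usum y, s (usum y) = usum z & s (usum z) = usum x] /\
  [/\ s (vdiff x) = vdiff y, s (vdiff y) = vdiff z & s (vdiff z) = vdiff x].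
Proof.
have sA : s A = A by apply: sK.
by rewrite !rmorph_usum // !rmorph_vdiff // sx sy sz.
Qed.

Lemma usum_vdiff w : w != 0 -> usum w ^+ 2 = vdiff w ^+ 2 + 4 * A.
Proof. by move=> w0; rewrite /usum /vdiff; field. Qed.

Lemma xyz_neq0 : [/\ x != 0, y != 0 & z != 0].
Proof.
by split;
  [neq0_at xyzI (idfun : {rmorphism K -> K}) (1 : K) (0 : K) (0 : K)
  |neq0_at xyzI (idfun : {rmorphism K -> K}) (0 : K) (1 : K) (0 : K)
  |neq0_at xyzI (idfun : {rmorphism K -> K}) (0 : K) (0 : K) (1 : K)];
  rewrite oner_eq0.
Qed.

Lemma sqr_xyz_neq0 :
  [/\ x ^+ 2 + A != 0, y ^+ 2 + A != 0 & z ^+ 2 + A != 0] /\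
  [/\ x ^+ 2 - A != 0, y ^+ 2 - A != 0 & z ^+ 2 - A != 0].
Proof.
by rewrite /A; split; split;
  neq0_at xyzI (idfun : {rmorphism K -> K}) (0 : K) (0 : K) (0 : K);
  rewrite expr0n /= ?add0r ?oppr_eq0.
Qed.

Lemma usumE w : w != 0 -> usum w = (w ^+ 2 + A) / w.
Proof. by move=> w0; rewrite /usum; field. Qed.

Lemma vdiffE w : w != 0 -> vdiff w = (w ^+ 2 - A) / w.
Proof. by move=> w0; rewrite /vdiff; field. Qed.

Lemma usum_neq0 : [/\ usum x != 0, usum y != 0 & usum z != 0].
Proof.
have [x0 y0 z0] := xyz_neq0; have [[? ? ?] _] := sqr_xyz_neq0.
by rewrite !usumE // !mulf_neq0 ?invr_eq0.
Qed.

Lemma vdiff_neq0 : [/\ vdiff x != 0, vdiff y != 0 & vdiff z != 0].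
Proof.
have [x0 y0 z0] := xyz_neq0; have [_ [? ? ?]] := sqr_xyz_neq0.
by rewrite !vdiffE // !mulf_neq0 ?invr_eq0.
Qed.

Lemma adjoin_usum_vdiff S w : adj S (usum w) -> adj S (vdiff w) -> adj S w.
Proof.
move=> Su Sv; have -> : w = (usum w + vdiff w) / 2.
  by rewrite /usum /vdiff; move: (A / w) => *; field.
by move: Su Sv; move: (usum w) (vdiff w) => *; adjoin_tac.
Qed.

Lemma circle_gens (d : K) a0' b0 a1 b1 a2 b2 :
    a0' ^+ 2 = iota d - b0 ^+ 2 -> a1 ^+ 2 = iota d - b1 ^+ 2 ->
    a2 ^+ 2 = iota d - b2 ^+ 2 ->
    (forall S, adj S a0' -> adj S b0 -> adj S x) ->
    (forall S, adj S a1 -> adj S b1 -> adj S y) ->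
    (forall S, adj S a2 -> adj S b2 -> adj S z) ->
  independent3 iota b0 b1 b2 /\
  forall f, adj (fun g => g \in [:: a0'; b0; a1; b1; a2; b2]) f.
Proof.
move=> q0 q1 q2 S0 S1 S2; split.
  have [B0 B1 B2] := adjoin_set3 iota b0 b1 b2; set B := set3 _ _ _ in B0 B1 B2.
  have step u v w : u ^+ 2 = iota d - v ^+ 2 -> adj B v ->
      (forall S, adj S u -> adj S v -> adj S w) -> alg B w.
    move=> q Bv Sw.
    have Bu : alg B u.
      apply/algebraic_sqrt/algebraic_adjoin; rewrite q.
      by apply: adjoin_sub; [apply: adjoin_base | apply: adjoin_exp].
    have := Sw (add1 B u) (adjoin_add1_gen _ _ _) (adjoin_add1 _ Bv).
    apply: algebraic_adjoin_closed => g [Bg|->] //.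
    by apply/algebraic_adjoin/adjoin_gen.
  by apply: (independent3_algebraic xyzI);
    [apply: step q0 _ S0 | apply: step q1 _ S1 | apply: step q2 _ S2].
move=> f; apply: adjoin_trans (adjoin_gens f) => g.
by case=> ->; [apply: S0 | apply: S1 | apply: S2]; apply: adjoin_gen; rewrite !inE eqxx ?orbT.
Qed.

(** Any two of the three involutions generate V; the pair serving as g1, g2 is dictated by the signs
    of the chosen circle coordinates. *)
Lemma fixed_tau_lambda_sigma f : fixed (generated3 t l s) f <->
  [/\ tl f = f, t f = f & s f = f].
Proof.
rewrite fixed_generated3 /=; split=> [[tf -> sf]|[tlf tf sf]] //.
by split=> //; apply: (fmorph_inj t); rewrite tlf tf.
Qed.

Lemma fixed_lambda_tau_sigma f : fixed (generated3 t l s) f <->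
  [/\ l f = f, tl f = f & s f = f].
Proof.
by rewrite fixed_generated3 /=; split=> -[]; [move=> tf lf; rewrite lf | move=> lf; rewrite lf].
Qed.

Lemma rmorph_twice_div (r : {rmorphism F -> F}) B w : r B = B ->
  r (2 * B / w) = 2 * B / r w.
Proof. by move=> rB; rewrite fmorph_div rmorphM rB rmorph_nat. Qed.

Lemma rational_sqr_pos b : a = b ^+ 2 -> rational iota (fixed (generated3 t l s)).
Proof.
move=> ab; pose B := iota b.
have AE : A = B ^+ 2 by rewrite /A /B ab rmorphXn.
have Bn : B != 0 by have := An; rewrite AE expf_eq0.
have [ux uy uz] := usum_neq0; have [x0 y0 z0] := xyz_neq0.
have cir w : w != 0 -> usum w != 0 ->
    (2 * B / usum w) ^+ 2 = iota 1 - (vdiff w / usum w) ^+ 2.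
  move=> w0 u0; have := usum_vdiff w0; rewrite rmorph1 AE.
  by move: (usum w) (vdiff w) u0 => u v u0 E; field: E.
have rec w S : usum w != 0 -> adj S (2 * B / usum w) -> adj S (vdiff w / usum w) -> adj S w.
  move=> u0 S1 S2; have SB : adj S B by apply: adjoin_base.
  have Su : adj S (usum w).
    have -> : usum w = 2 * B / (2 * B / usum w) by field; rewrite two Bn u0.
    by apply: adjoin_div => //; adjoin_tac.
  apply: (adjoin_usum_vdiff Su).
  have -> : vdiff w = vdiff w / usum w * usum w by rewrite divfK.
  exact: adjoin_mul.
have [bI gens] := circle_gens (cir x x0 ux) (cir y y0 uy) (cir z z0 uz)
  (fun S => @rec x S ux) (fun S => @rec y S uy) (fun S => @rec z S uz).
have [[tux tuy tuz] [tvx tvy tvz]] := tau_signs.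
have [[lux luy luz] [lvx lvy lvz]] := tau_lambda_signs.
have [[sux suy suz] [svx svy svz]] := sigma_cycle.
have tlK c : tl (iota c) = iota c by rewrite /= lK tK.
apply: (rational_circle (g1 := tl) (g2 := t) two0 (oner_neq0 K) (cir x x0 ux)
  (cir y y0 uy) (cir z z0 uz) bI gens sK tlK tK) fixed_tau_lambda_sigma;
  try by rewrite ?rmorph_twice_div ?(sK, tK, lK, tlK) // ?fmorph_div ?(sux, suy, suz, svx, svy, svz)
    ?(lux, luy, luz, lvx, lvy, lvz) ?(tux, tuy, tuz, tvx, tvy, tvz)
    ?invrN ?(mulrN, mulNr, opprK).
- have [[qx qy qz] _] := sqr_xyz_neq0.
  have al w : w != 0 -> w ^+ 2 + A != 0 -> 2 * B / usum w = 2 * B * w / (w ^+ 2 + A).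
    by move=> w0 q0; rewrite usumE //; field; rewrite q0 w0.
  have be w : w != 0 -> w ^+ 2 + A != 0 -> vdiff w / usum w = (w ^+ 2 - A) / (w ^+ 2 + A).
    by move=> w0 q0; rewrite usumE // vdiffE //; field; rewrite q0 w0.
  rewrite !al // !be // circle_num_div // mulf_neq0 ?invr_eq0 ?expf_neq0 ?mulf_neq0 //.
  rewrite /A /B; neq0_at xyzI (idfun : {rmorphism K -> K}) (0 : K) (0 : K) (0 : K).
  by rewrite (_ : _ + _ = a ^+ 6) ?expf_neq0 //; ring.
- by left.
Qed.

Lemma rational_sqr_neg b : a = - b ^+ 2 -> rational iota (fixed (generated3 t l s)).
Proof.
move=> ab; pose B := iota b.
have AE : A = - B ^+ 2 by rewrite /A /B ab rmorphN rmorphXn.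
have Bn : B != 0 by have := An; rewrite AE oppr_eq0 expf_eq0.
have [vx vy vz] := vdiff_neq0; have [x0 y0 z0] := xyz_neq0.
have cir w : w != 0 -> vdiff w != 0 ->
    (usum w / vdiff w) ^+ 2 = iota 1 - (2 * B / vdiff w) ^+ 2.
  move=> w0 v0; have := usum_vdiff w0; rewrite rmorph1 AE.
  by move: (usum w) (vdiff w) v0 => u v v0 E; field: E.
have rec w S : vdiff w != 0 -> adj S (usum w / vdiff w) -> adj S (2 * B / vdiff w) -> adj S w.
  move=> v0 S1 S2; have SB : adj S B by apply: adjoin_base.
  have Sv : adj S (vdiff w).
    have -> : vdiff w = 2 * B / (2 * B / vdiff w) by field; rewrite two Bn v0.
    by apply: adjoin_div => //; adjoin_tac.
  apply: adjoin_usum_vdiff => //.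
  have -> : usum w = usum w / vdiff w * vdiff w by rewrite divfK.
  exact: adjoin_mul.
have [bI gens] := circle_gens (cir x x0 vx) (cir y y0 vy) (cir z z0 vz)
  (fun S => @rec x S vx) (fun S => @rec y S vy) (fun S => @rec z S vz).
have [[tux tuy tuz] [tvx tvy tvz]] := tau_lambda_signs.
have [[lux luy luz] [lvx lvy lvz]] := lambda_signs.
have [[sux suy suz] [svx svy svz]] := sigma_cycle.
have tlK c : tl (iota c) = iota c by rewrite /= lK tK.
apply: (rational_circle (g1 := l) (g2 := tl) two0 (oner_neq0 K) (cir x x0 vx)
  (cir y y0 vy) (cir z z0 vz) bI gens sK lK tlK) fixed_lambda_tau_sigma;
  try by rewrite ?rmorph_twice_div ?(sK, tK, lK, tlK) // ?fmorph_div ?(sux, suy, suz, svx, svy, svz)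
    ?(lux, luy, luz, lvx, lvy, lvz) ?(tux, tuy, tuz, tvx, tvy, tvz)
    ?invrN ?(mulrN, mulNr, opprK).
- have [_ [qx qy qz]] := sqr_xyz_neq0.
  have al w : w != 0 -> w ^+ 2 - A != 0 -> usum w / vdiff w = (w ^+ 2 + A) / (w ^+ 2 - A).
    by move=> w0 q0; rewrite usumE // vdiffE //; field; rewrite q0 w0.
  have be w : w != 0 -> w ^+ 2 - A != 0 -> 2 * B / vdiff w = 2 * B * w / (w ^+ 2 - A).
    by move=> w0 q0; rewrite vdiffE //; field; rewrite q0 w0.
  rewrite !al // !be // circle_num_div // mulf_neq0 ?invr_eq0 ?expf_neq0 ?mulf_neq0 //.
  rewrite /A /B; neq0_at xyzI (idfun : {rmorphism K -> K}) (0 : K) (0 : K) (0 : K).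
  by rewrite (_ : _ + _ = a ^+ 6) ?expf_neq0 //; ring.
- by left.
Qed.

Lemma rational_sqrt_m1 (i : K) : i ^+ 2 = -1 -> rational iota (fixed (generated3 t l s)).
Proof.
move=> i2; pose I := iota i.
have I2 : I ^+ 2 = -1 by rewrite -rmorphXn i2 rmorphN rmorph1.
have In : I != 0 by have := oner_neq0 F; rewrite -oppr_eq0 -I2 expf_eq0.
have [x0 y0 z0] := xyz_neq0.
have cir w : w != 0 -> (I * vdiff w / 2) ^+ 2 = iota a - (usum w / 2) ^+ 2.
  move=> w0; have := usum_vdiff w0; rewrite -/A.
  by move: (usum w) (vdiff w) => u v E; field: E I2.
have rec w S : adj S (I * vdiff w / 2) -> adj S (usum w / 2) -> adj S w.
  move=> S1 S2; have SI : adj S I by apply: adjoin_base.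
  apply: adjoin_usum_vdiff.
    by have -> : usum w = usum w / 2 * 2 by [rewrite divfK]; adjoin_tac.
  have -> : vdiff w = I * vdiff w / 2 * 2 / I by field; rewrite In two.
  by apply: adjoin_div => //; apply: adjoin_mul => //; adjoin_tac.
have [bI gens] := circle_gens (cir x x0) (cir y y0) (cir z z0)
  (@rec x) (@rec y) (@rec z).
have [[tux tuy tuz] [tvx tvy tvz]] := tau_signs.
have [[lux luy luz] [lvx lvy lvz]] := lambda_signs.
have [[sux suy suz] [svx svy svz]] := sigma_cycle.
have half (r : {rmorphism F -> F}) w : r (w / 2) = r w / 2.
  by rewrite fmorph_div rmorph_nat.
have [sI tI lI] : [/\ s I = I, t I = I & l I = I] by split; [apply: sK | apply: tK | apply: lK].
apply: (rational_circle (g1 := t) (g2 := l) two0 a0 (cir x x0)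
  (cir y y0) (cir z z0) bI gens sK tK lK);
  try by rewrite half ?rmorphM ?(sI, tI, lI) ?(sux, suy, suz, svx, svy, svz)
    ?(lux, luy, luz, lvx, lvy, lvz) ?(tux, tuy, tuz, tvx, tvy, tvz) ?(mulrN, mulNr).
- have al w : w != 0 -> I * vdiff w / 2 = I * (w ^+ 2 - A) / (2 * w).
    by move=> w0; rewrite vdiffE //; field; rewrite two w0.
  have be w : w != 0 -> usum w / 2 = (w ^+ 2 + A) / (2 * w).
    by move=> w0; rewrite usumE //; field; rewrite two w0.
  rewrite !al // !be // circle_num_div ?mulf_neq0 // ?invr_eq0 ?expf_neq0 ?mulf_neq0 //.
  (* At the origin the two terms of the numerator cancel, so it is evaluated at the point (x, x, x)
     over F. The factorization that results is then nonzero by a second specialization, at 0. *)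
  rewrite /A /I; neq0_at xyzI iota x x x; rewrite -/A -/I.
  rewrite (_ : _ + _ = A * (2 * x) ^+ 2 * (A * (2 * x) ^+ 2 - I * (x ^+ 4 - A ^+ 2)) ^+ 2).
    rewrite mulf_neq0 ?expf_neq0 ?mulf_neq0 ?expf_neq0 ?mulf_neq0 //.
    rewrite /A /I; neq0_at xyzI (idfun : {rmorphism K -> K}) (0 : K) (0 : K) (0 : K).
    rewrite (_ : _ - _ = i * a ^+ 2); last by ring.
    by rewrite mulf_neq0 ?expf_neq0 // -(fmorph_eq0 iota).
  by ring: I2.
- by right; exists i.
- exact: fixed_generated3.
Qed.

End Negative.

(** * Square classes from the degree hypothesis *)

(** Squaring sa = c + d sm gives 2 c d sm = a + d^2 - c^2. Either sm lies in K, or c d = 0 and a is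
    c^2 or - d^2. *)
Lemma sqr_of_dependent (K M : fieldType) (J : {rmorphism K -> M}) (a : K) (sa sm : M) :
    2 != 0 :> K -> sa ^+ 2 = J a -> sm ^+ 2 = -1 ->
    (exists i, sm = J i) \/ (exists c d, sa = J c + J d * sm) ->
  [\/ exists b : K, a = b ^+ 2, exists b : K, a = - b ^+ 2 | exists i : K, i ^+ 2 = -1].
Proof.
move=> two sa2 sm2; have JI c c' : J c = J c' -> c = c' by apply: fmorph_inj.
have sqrt_m1 k : sm = J k -> exists i : K, i ^+ 2 = -1.
  by move=> smE; exists k; apply: JI; rewrite rmorphXn -smE sm2 rmorphN rmorph1.
case=> [[i /sqrt_m1]|[c [d saE]]]; first exact: Or33.
have E : J (2 * c * d) * sm = J (a + d ^+ 2 - c ^+ 2).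
  rewrite rmorphB rmorphD -sa2 saE !rmorphXn !rmorphM rmorph_nat.
  by move: (J c) (J d) => C D; ring: sm2.
have [z0|d0] := eqVneq (2 * c * d) 0; last first.
  apply/Or33/(sqrt_m1 ((a + d ^+ 2 - c ^+ 2) / (2 * c * d))).
  by rewrite fmorph_div -E mulrAC mulfV ?mul1r ?fmorph_eq0.
move/eqP: z0; rewrite !mulf_eq0 (negPf two) /= => /orP[]/eqP z0.
  apply: Or32; exists d; apply: JI.
  by rewrite -sa2 saE z0 rmorph0 add0r exprMn sm2 mulrN1 rmorphN rmorphXn.
apply: Or31; exists c; apply: JI.
by rewrite -sa2 saE z0 rmorph0 mul0r addr0 rmorphXn.
Qed.

Lemma sqr_of_dim_le2 (K : fieldType) (L : fieldExtType K) (a : K) (sa sm : L) :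
    2 != 0 :> K -> sa ^+ 2 = a%:A -> sm ^+ 2 = -1 ->
    (\dim <<1 & [:: sa; sm]>> <= 2)%N ->
  [\/ exists b : K, a = b ^+ 2, exists b : K, a = - b ^+ 2 | exists i : K, i ^+ 2 = -1].
Proof.
move=> two sa2 sm2 dim2; apply: (@sqr_of_dependent K L (in_alg L) a sa sm) => //.
have sub : (<<[:: sa; sm; 1%R]>> <= <<1 & [:: sa; sm]>>)%VS.
  apply/span_subvP => v; rewrite !inE => /or3P[] /eqP->.
  - by apply: seqv_sub_adjoin; rewrite !inE eqxx.
  - by apply: seqv_sub_adjoin; rewrite !inE eqxx orbT.
  - by apply: subvP (subv_adjoin_seq _ _) _ _; apply: memv_line.
(* Three elements in dimension at most 2 are dependent; since 1 is nonzero, either sm is a multiple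
   of 1 or sa is a combination of sm and 1. *)
have : ~~ free [:: sa; sm; 1%R].
  by apply: contraL (leq_trans (dimvS sub) dim2) => /eqP ->.
rewrite !free_cons nil_free andbT span_cons span_seq1 span_nil memv0 oner_eq0 andbT.
rewrite negb_and !negbK => /orP[|/vlineP[k ->]]; last by left; exists k.
case/memv_addP=> _ /vlineP[d ->] [_ /vlineP[c ->] ->].
by right; exists c, d; rewrite addrC /= mulr_algl.
Qed.

Theorem theorem1p7 (K : fieldType) (charK : 2%N \notin [pchar K])
    (a : K) (a_neq0 : a != 0) (eps1 : K) (eps1E : eps1 = 1 \/ eps1 = -1)
    (tau1 lambda1 sigma3B : {rmorphism ratfun K -> ratfun K})
    (tau1E : is_Kaut tau1
       (constF K a / x) (constF K (eps1 * a) / y) (constF K eps1 * z))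
    (lambda1E : is_Kaut lambda1
       (constF K (eps1 * a) / x) (constF K eps1 * y) (constF K a / z))
    (sigma3BE : is_Kaut sigma3B y z x) :
  let G711 := generated3 tau1 lambda1 sigma3B in
  (eps1 = 1 -> rational (constF K) (fixed G711)) /\
  (eps1 = -1 ->
   (exists (L : fieldExtType K) (sqrt_a sqrt_m1 : L),
      [/\ sqrt_a ^+ 2 = a%:A, sqrt_m1 ^+ 2 = -1
        & (\dim <<1 & [:: sqrt_a; sqrt_m1]>> <= 2)%N]) ->
   rational (constF K) (fixed G711)).
Proof.
have two : 2 != 0 :> K by move: charK; rewrite inE.
have I := @independent3_xyz K; have G := @adjoin_xyz K.
have [_ tK [tx ty tz]] := tau1E; have [_ lK [lx ly lz]] := lambda1E.
have [_ sK [sx sy sz]] := sigma3BE.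
split=> [e1|e1 [L [sa [sm [sa2 sm2 dim2]]]]].
  rewrite e1 ?mul1r ?rmorph1 ?mul1r in tx ty tz lx ly lz.
  exact: (rational_positive I G two a_neq0 tK lK sK tx ty tz lx ly lz sx sy sz).
rewrite e1 mulN1r rmorphN mulNr in ty; rewrite e1 mulN1r rmorphN mulNr in lx.
rewrite e1 rmorphN1 mulN1r in tz; rewrite e1 rmorphN1 mulN1r in ly.
case: (sqr_of_dim_le2 two sa2 sm2 dim2) => -[b bE].
- exact: (rational_sqr_pos I G two a_neq0 tK lK sK tx ty tz lx ly lz sx sy sz bE).
- exact: (rational_sqr_neg I G two a_neq0 tK lK sK tx ty tz lx ly lz sx sy sz bE).
- exact: (rational_sqrt_m1 I G two a_neq0 tK lK sK tx ty tz lx ly lz sx sy sz bE).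
Qed.
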